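(* Suppose that $(Y,d_Y)$ is a length space and that the following are satisfied: 1. $\alpha>0$ and $\psi\in C([0,\infty))\cap C^1((0,\infty))$ is a non-constant non-negative function such that $\psi(t)\le\alpha^{-1}\psi'(t)$ for every $t\in(0,\infty)$; 2. if $Y$ is unbounded, then $\psi(0)=0$. Then $[0,\infty)\times_\psi Y$ is Gromov $\delta$-hyperbolic, with $\delta=\delta(\alpha,\psi(0)\operatorname{diam}(Y))$ depending only on $\alpha$ and $\psi(0)\operatorname{diam}(Y)$ if $\psi(0)\ne0$, and with $\delta=\delta(\alpha)$ depending only on $\alpha$ if $\psi(0)=0$. If additionally $Y$ is complete and bounded and there exists a positive real number $C$ such that $\psi(t)\le Ce^{\alpha t}$ for all $t\in[0,\infty)$, then for $\varepsilon>0$ sufficiently small the Gromov boundary $\partial_G([0,\infty)\times_\psi Y)$ equipped with its induced metric $d_\varepsilon$ is quasisymmetrically homeomorphic to $Y$.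
   Context: **Paths.** A path in a (pseudo)metric space $(Z,d_Z)$ is a continuous map $\gamma:[a,b]\to Z$; $\operatorname{len}_{d_Z}(\gamma)$ is the supremum of $\sum_i d_Z(\gamma(t_{i-1}),\gamma(t_i))$ over partitions; $\gamma$ is rectifiable if this is finite, and a rectifiable $\gamma$ is absolutely continuous if $t\mapsto \operatorname{len}_{d_Z}(\gamma|_{[a,t]})$ is absolutely continuous. The metric speed is $|\gamma'(t)|=\lim_{u\to t} d_Z(\gamma(u),\gamma(t))/|u-t|$ (exists a.e. for absolutely continuous $\gamma$). $(Z,d_Z)$ is a length space if any two points are joined by a rectifiable path and $d_Z(x,y)$ is the infimum of lengths of rectifiable paths from $x$ to $y$. **Warped products.** Fix a norm $\|\cdot\|$ on $\mathbb{R}^2$ that is unitary ($\|(1,0)\|=\|(0,1)\|=1$) and coordinate-increasing ($\|(a,c)\|\le\|(b,d)\|$ whenever $0\le a\le b$, $0\le c\le d$); the choice is arbitrary. For length spaces $X,Y$ and continuous $\varphi:X\to[0,\infty)$, and for a path $\gamma=(\gamma_X,\gamma_Y):[a,b]\to X\times Y$ absolutely continuous with respect to the $\ell^1$-product metric, set $\ell_\varphi(\gamma)=\int_a^b\|(|\gamma_X'(t)|,\varphi(\gamma_X(t))|\gamma_Y'(t)|)\|\,dt$. Let $d_\varphi((x,y),(x',y'))=\inf_\gamma\ell_\varphi(\gamma)$ over absolutely continuous paths from $(x,y)$ to $(x',y')$ (a pseudometric). $X\times_\varphi Y$ is the quotient of $X\times Y$ identifying points at $d_\varphi$-distance $0$,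 with the induced metric $d_\varphi$. Here $X=[0,\infty)$ has the Euclidean metric. **Gromov hyperbolicity.** In a metric space $(Z,d_Z)$, the Gromov product is $\langle x|y\rangle_w=\frac12(d_Z(x,w)+d_Z(y,w)-d_Z(x,y))$. $Z$ is Gromov $\delta$-hyperbolic ($\delta\ge0$) if $\langle x|y\rangle_w\ge\min\{\langle x|z\rangle_w,\langle y|z\rangle_w\}-\delta$ for all $x,y,z,w\in Z$. Fix a base point $x_0\in Z$. A sequence $(x_i)$ is a Gromov sequence if $\lim_{i,j\to\infty}\langle x_i|x_j\rangle_{x_0}=\infty$. The Gromov boundary $\partial_GZ$ is the set of Gromov sequences modulo the equivalence $(x_i)\sim(y_i)$ iff $\lim_{i\to\infty}\langle x_i|y_i\rangle_{x_0}=\infty$. For $\overline x,\overline y\in\partial_GZ$, $\langle\overline x|\overline y\rangle_{x_0}=\inf\{\liminf_{i,j\to\infty}\langle x_i|y_j\rangle_{x_0}:(x_i)\in\overline x,(y_i)\in\overline y\}$, $\tilde d_\varepsilon(\overline x,\overline y)=e^{-\varepsilon\langle\overline x|\overline y\rangle_{x_0}}$ (with $e^{-\infty}=0$), and $d_\varepsilon(\overline x,\overline y)=\inf\sum_{i=1}^k\tilde d_\varepsilon(\overline x_{i-1},\overline x_i)$ over finite chains $\overline x=\overline x_0,\dots,\overline x_k=\overline y$ in $\partial_GZ$. **Quasisymmetry.** Given a homeomorphism $\eta:[0,\infty)\to[0,\infty)$, a map $f:Z\to W$ of metric spaces is $\eta$-quasisymmetric if $\frac{d_W(f(x),f(y))}{d_W(f(x),f(z))}\le\eta\left(\frac{d_Z(x,y)}{d_Z(x,z)}\right)$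 for all triples of distinct points $x,y,z\in Z$. Two spaces are quasisymmetrically homeomorphic if there is a homeomorphism between them that is $\eta$-quasisymmetric for some $\eta$. *)

(* Defs.v *)
From mathcomp Require Import all_boot all_order all_algebra.
From mathcomp Require Import all_classical all_reals all_analysis.

Set Implicit Arguments.
Unset Strict Implicit.
Unset Printing Implicit Defensive.

Import Order.TTheory GRing.Theory Num.Theory.
Import numFieldNormedType.Exports.

Local Open Scope classical_set_scope.
Local Open Scope ring_scope.

(* Spaces are given by a carrier [T] and a distance [d : T -> T -> R], because
   several of the distances below are only pseudometrics, or are metrics only
   for some values of a parameter. *)

Section MetricSpaces.
Context {R : realType}.

Definition is_metric (T : Type) (d : T -> T -> R) : Prop :=
  [/\ forall x y, d x y = 0 <-> x = y,
      forall x y, d x y = d y x &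
      forall x y z, d x z <= d x y + d y z].

Definition dist_bounded (T : Type) (d : T -> T -> R) : Prop :=
  exists M : R, forall x y, d x y <= M.

(* Meaningful when [d] is bounded: [sup] is a real number, equal to 0 on sets
   without a supremum. *)
Definition dist_diam (T : Type) (d : T -> T -> R) : R :=
  sup [set d x y | x in [set: T] & y in [set: T]].

Definition complete_space (T : uniformType) : Prop :=
  forall F : set_system T, ProperFilter F -> cauchy F -> exists x : T, F --> x.

Definition dist_continuous (T U : Type) (dT : T -> T -> R) (dU : U -> U -> R)
    (f : T -> U) : Prop :=
  forall x (e : R), 0 < e ->
    exists2 r : R, 0 < r & forall y, dT y x < r -> dU (f y) (f x) < e.

Definition dist_homeomorphism (T U : Type) (dT : T -> T -> R)
    (dU : U -> U -> R) (f : T -> U) : Prop :=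
  exists g : U -> T, [/\ cancel f g, cancel g f,
    dist_continuous dT dU f & dist_continuous dU dT g].

Definition sum_dist (T U : Type) (dT : T -> T -> R) (dU : U -> U -> R)
    (p q : T * U) : R := dT p.1 q.1 + dU p.2 q.2.

End MetricSpaces.

(* The metric space obtained from (T, d) by identifying points at distance 0.
   A point is an equivalence class; when [d] is a pseudometric, [quotient_dist]
   does not depend on the representatives chosen by [cid]. *)
Section MetricQuotient.
Context {R : realType} {T : Type} (d : T -> T -> R).

Definition dist_quotient : Type :=
  {A : set T | exists p, A = [set q | d p q = 0]}.

Definition quotient_repr (A : dist_quotient) : T := sval (cid (svalP A)).

Definition quotient_dist (A B : dist_quotient) : R :=
  d (quotient_repr A) (quotient_repr B).

End MetricQuotient.

(* A path [a, b] -> T is a total function R -> T of which only the values on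
   [a, b] are relevant. *)
Section Paths.
Context {R : realType}.

Section OneSpace.
Context {T : Type} (d : T -> T -> R).

Definition is_path (a b : R) (g : R -> T) : Prop :=
  a <= b /\
  forall t (e : R), t \in `[a, b] -> 0 < e ->
    exists2 r : R, 0 < r &
      forall u, u \in `[a, b] -> `|u - t| < r -> d (g u) (g t) < e.

Definition dist_variation (a b : R) (g : R -> T) (s : seq R) : R :=
  let G := g \o nth b (a :: s) in
  \sum_(0 <= n < size s) d (G n) (G n.+1).

Definition path_length (a b : R) (g : R -> T) : \bar R :=
  ereal_sup [set (dist_variation a b g s)%:E | s in itv_partition a b].

Definition rectifiable (a b : R) (g : R -> T) : Prop :=
  is_path a b g /\ (path_length a b g < +oo)%E.

End OneSpace.

(* The non-overlapping intervals [s i, t i] are listed from left to right. *)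
Definition absolutely_continuous_on (a b : R) (f : R -> R) : Prop :=
  forall e : R, 0 < e -> exists2 r : R, 0 < r &
    forall (n : nat) (s t : 'I_n -> R),
      (forall i, [/\ a <= s i, s i <= t i & t i <= b]) ->
      (forall i j : 'I_n, (i < j)%N -> t i <= s j) ->
      \sum_(i < n) (t i - s i) < r ->
      \sum_(i < n) `|f (t i) - f (s i)| < e.

Context {T : Type} (d : T -> T -> R).

Definition ac_path (a b : R) (g : R -> T) : Prop :=
  rectifiable d a b g /\
  absolutely_continuous_on a b (fun t => fine (path_length d a t g)).

(* At the two endpoints of [a, b] this may depend on the values of [g] outside
   [a, b]; metric speeds are only used under an integral sign. *)
Definition metric_speed (g : R -> T) (t : R) : R :=
  lim ((fun u => d (g u) (g t) / `|u - t|) @ t^').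

Definition length_space : Prop :=
  forall x y : T,
    (exists a b g, [/\ rectifiable d a b g, g a = x & g b = y]) /\
    (d x y)%:E = ereal_inf [set l | exists a b g,
      [/\ rectifiable d a b g, g a = x, g b = y & l = path_length d a b g]].

End Paths.

Section WarpedProducts.
Context {R : realType}.

Definition is_norm2 (N : R * R -> R) : Prop :=
  [/\ forall v, N v = 0 -> v = (0, 0),
      forall k a b, N (k * a, k * b) = `|k| * N (a, b) &
      forall a b a' b', N (a + a', b + b') <= N (a, b) + N (a', b')].

Definition unitary_norm (N : R * R -> R) : Prop :=
  N (1, 0) = 1 /\ N (0, 1) = 1.

Definition coordinate_increasing (N : R * R -> R) : Prop :=
  forall a b c d, 0 <= a -> a <= b -> 0 <= c -> c <= d -> N (a, c) <= N (b, d).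

Context (N : R * R -> R) {X Y : Type}.
Variables (dX : X -> X -> R) (dY : Y -> Y -> R) (phi : X -> R).

Definition warped_length (a b : R) (g : R -> X * Y) : \bar R :=
  (\int[lebesgue_measure]_(t in `[a, b])
    (N (metric_speed dX (fst \o g) t,
        phi (g t).1 * metric_speed dY (snd \o g) t))%:E)%E.

Definition warped_pseudodist (p q : X * Y) : R :=
  fine (ereal_inf [set l | exists a b g,
    [/\ ac_path (sum_dist dX dY) a b g, g a = p, g b = q &
        l = warped_length a b g]]).

Definition warped_product : Type := dist_quotient warped_pseudodist.

Definition warped_dist : warped_product -> warped_product -> R :=
  @quotient_dist R (X * Y) warped_pseudodist.

End WarpedProducts.

Arguments warped_dist {R} N {X Y} dX dY phi _ _.

Definition half_line (R : realType) : Type := {x : R | 0 <= x}.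

Definition half_line_dist {R : realType} (x y : half_line R) : R :=
  `|sval x - sval y|.

Section GromovHyperbolicity.
Context {R : realType} {Z : Type} (d : Z -> Z -> R).

Definition gromov_product (w x y : Z) : R := (d x w + d y w - d x y) / 2.

Definition gromov_hyperbolic (delta : R) : Prop :=
  [/\ is_metric d, 0 <= delta &
      forall x y z w,
        Num.min (gromov_product w x z) (gromov_product w y z) - delta
          <= gromov_product w x y].

Context (x0 : Z).

Definition gromov_sequence (u : nat -> Z) : Prop :=
  (fun ij : nat * nat => gromov_product x0 (u ij.1) (u ij.2))
    @ filter_prod \oo \oo --> +oo.

Definition gromov_equiv (u v : nat -> Z) : Prop :=
  (fun i : nat => gromov_product x0 (u i) (v i)) @ \oo --> +oo.

Definition gromov_boundary : Type :=
  {A : set (nat -> Z) | exists u, gromov_sequence u /\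
     A = [set v | gromov_sequence v /\ gromov_equiv u v]}.

Definition boundary_product (x y : gromov_boundary) : \bar R :=
  ereal_inf [set limf_einf
      (fun ij : nat * nat => (gromov_product x0 (u ij.1) (v ij.2))%:E)
      (filter_prod \oo \oo)
    | u in sval x & v in sval y].

Definition boundary_predist (eps : R) (x y : gromov_boundary) : R :=
  fine (expeR (- (eps%:E * boundary_product x y))%E).

Definition boundary_dist (eps : R) (x y : gromov_boundary) : R :=
  inf [set l | exists (k : nat) (c : nat -> gromov_boundary),
    [/\ (0 < k)%N, c 0%N = x, c k = y &
        l = \sum_(0 <= i < k) boundary_predist eps (c i) (c i.+1)]].

End GromovHyperbolicity.

Arguments boundary_dist {R Z} d x0 eps x y.

Section Quasisymmetry.
Context {R : realType}.

Definition half_line_homeomorphism (eta : R -> R) : Prop :=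
  exists theta : R -> R,
    [/\ forall t, 0 <= t -> 0 <= eta t /\ theta (eta t) = t,
        forall t, 0 <= t -> 0 <= theta t /\ eta (theta t) = t,
        {within `[0, +oo[, continuous eta} &
        {within `[0, +oo[, continuous theta}].

Context {Z W : Type} (dZ : Z -> Z -> R) (dW : W -> W -> R).

Definition quasisymmetric (eta : R -> R) (f : Z -> W) : Prop :=
  forall x y z, x <> y -> y <> z -> x <> z ->
    dW (f x) (f y) / dW (f x) (f z) <= eta (dZ x y / dZ x z).

Definition quasisymmetrically_homeomorphic : Prop :=
  [/\ is_metric dZ, is_metric dW &
      exists (f : Z -> W) (eta : R -> R),
        [/\ dist_homeomorphism dZ dW f, half_line_homeomorphism eta &
            quasisymmetric eta f]].

End Quasisymmetry.

(* Main.v *)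
Require Import Defs.
From HB Require Import structures.
From mathcomp Require Import all_boot all_order all_algebra.
From mathcomp Require Import all_classical all_reals all_analysis.
From mathcomp Require Import measurable_realfun real_interval.
From mathcomp Require Import ring lra zify.

(** A point [(s, y)] of the warped product is at height [s]. Since [psi] grows at
    least like [expR (alpha * t)], horizontal travel is exponentially cheaper near
    the apex, so the efficient way from [(s, y)] to [(t, z)] is to descend to some
    height [r], to cross at cost [psi r * d y z], and to climb up again. Put
    [cone_product p q = (s + t - d p q) / 2], the Gromov product relative to the
    apex, up to an additive constant. Everything follows from two facts:
    - [cone_product p q >= r - psi r * d y z / 2] for [r] below both heights
      ([cone_product_ge]), by the route just described;
    - [psi m * d y z <= 4 / alpha] for [0 <= m < cone_product p q]
      ([psi_cone_product_le]). Indeed a path of length [L] cannot be lower than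
      [m + | l - l0 |] after length [l], where [m = (s + t - L) / 2] and
      [l0 = (L + s - t) / 2] would be the length spent descending. There [psi] is at least
      [psi m * expR (alpha * | l - l0 |)], so the horizontal distance covered is at
      most the integral of [expR (- (alpha * | l - l0 |)) / psi m], which is
      [2 / (alpha * psi m)]. The formal version ([warped_profile_estimate])
      replaces the integral by a telescoping sum and loses a factor [2].

    Hyperbolicity: if [m] is below [cone_product p r] and [cone_product q r], then
    [psi m] times the horizontal distance of [p] and [q] is at most [8 / alpha] by
    the triangle inequality, hence [cone_product p q >= m - 4 / alpha]
    ([cone_three_points]). When [m] would be negative the bound comes from crossing
    at the apex, at cost [psi 0] times the diameter of [Y]. Four-point
    hyperbolicity is a formal consequence ([four_points]).

    Boundary: [psi] is unbounded, so the two facts show that a sequence is a Gromov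
    sequence exactly when its heights tend to infinity and its other coordinates
    form a Cauchy sequence, and that equivalent sequences are those with the same
    limit in [Y]; this identifies the boundary with the complete space [Y]. When
    [psi] is also at most [C * expR (alpha * t)], both facts turn into a two-sided
    estimate: [expR (- alpha * product)] is comparable to the distance in [Y]
    ([cone_product_distinct]). So the boundary predistance with parameter [eps] is
    comparable to the power [eps / alpha] of the distance of [Y]. For [eps < alpha]
    that power is itself a distance, so passing to infima over chains changes
    nothing, and a bijection under which one distance is comparable to a power of
    the other is quasisymmetric ([boundary_quasisymmetric]).

    The analytic input is that the warped length of an absolutely continuous path,
    an integral of limits of difference quotients, does bound the increments of
    its two coordinates ([warped_density]). This rests on the existence almost
    everywhere of the metric derivative and on the fact that its integral
    dominates distances ([metric_derivative]), proved by applying the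
    Radon-Nikodym and Lebesgue differentiation theorems to the distances from
    countably many points of the path. *)

Set Implicit Arguments.
Unset Strict Implicit.
Unset Printing Implicit Defensive.

Import Order.TTheory GRing.Theory Num.Theory.
Import numFieldNormedType.Exports.

Local Open Scope classical_set_scope.
Local Open Scope ring_scope.

(** * Densities of monotone absolutely continuous functions *)

Section Clip.
Context {R : realType}.
Implicit Types a b x y : R.

Definition clip a b x : R := Num.max a (Num.min x b).

Lemma clip_in a b x : a <= b -> clip a b x \in `[a, b].
Proof.
move=> ab; rewrite in_itv/= /clip le_max lexx/= ge_max ab/= ge_min lexx.
by rewrite orbT.
Qed.

Lemma clip_id a b x : x \in `[a, b] -> clip a b x = x.
Proof. by rewrite in_itv/= /clip => /andP[ax xb]; rewrite min_l// max_r. Qed.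

Lemma clip_le a b x y : x <= y -> clip a b x <= clip a b y.
Proof.
move=> xy; rewrite /clip ge_max !le_max lexx/= ge_min; apply/orP; right.
by rewrite le_min !ge_min xy lexx orbT.
Qed.

Lemma clip_contract a b x y : x <= y -> clip a b y - clip a b x <= y - x.
Proof.
move=> xy; rewrite /clip /Num.max /Num.min.
by do !case: ifPn; rewrite -?leNgt => *; lra.
Qed.

End Clip.

Section Density.
Context {R : realType}.
Local Notation mu := (@lebesgue_measure R).

Lemma sum_clip_lt a b (V : R -> R) : a <= b ->
  absolutely_continuous_on a b V -> forall e : R, 0 < e ->
  exists2 r : R, 0 < r & forall (n : nat) (s t : 'I_n -> R),
    (forall i, s i <= t i) ->
    (forall i j : 'I_n, (i < j)%N -> t i <= s j) ->
    \sum_(i < n) (t i - s i) < r ->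
    \sum_(i < n) `|V (clip a b (t i)) - V (clip a b (s i))| < e.
Proof.
move=> ab acV e e0; have [r r0 Hr] := acV e e0; exists r => // n s t st ts sr.
apply: (Hr n (clip a b \o s) (clip a b \o t)).
- move=> i /=.
  have := clip_in (s i) ab; have := clip_in (t i) ab.
  by rewrite !in_itv/= => /andP[_ ->] /andP[-> _]; split => //; exact: clip_le.
- by move=> i j ij; exact/clip_le/ts.
- by apply: le_lt_trans sr; apply: ler_sum => i _; exact: clip_contract.
Qed.

(** Absolute continuity is stated for intervals listed from left to right;
    pairwise disjoint intervals can be put in that order. *)
Lemma sum_disjoint_lt a b (V : R -> R) : a <= b ->
  absolutely_continuous_on a b V -> forall e : R, 0 < e ->
  exists2 r : R, 0 < r & forall (l : seq nat) (s t : nat -> R),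
    uniq l ->
    {in l, forall i, s i < t i} ->
    {in l &, forall i j, i != j -> t i <= s j \/ t j <= s i} ->
    \sum_(i <- l) (t i - s i) < r ->
    \sum_(i <- l) `|V (clip a b (t i)) - V (clip a b (s i))| < e.
Proof.
move=> ab acV e e0; have [r r0 Hr] := sum_clip_lt ab acV e0.
exists r => // l s t ul st dis sr.
pose leS := [rel i j | s i <= s j].
have leS_tr : transitive leS by move=> j i k /=; exact: le_trans.
have leS_tot : total leS by move=> i j /=; exact: le_total.
have [l' pl sl'] : exists2 l', perm_eq l' l & sorted leS l'.
  by exists (sort leS l); [rewrite perm_sort|exact: sort_sorted].
have ul' : uniq l' by rewrite (perm_uniq pl).
have sumE (F : nat -> R) :
    \sum_(i <- l) F i = \sum_(i < size l') F (nth 0%N l' i).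
  by rewrite -(perm_big _ pl)/= (big_nth 0%N) big_mkord.
move: sr; rewrite !sumE => sr.
apply: (Hr _ (fun i => s (nth 0%N l' i)) (fun i => t (nth 0%N l' i))) => //.
- by move=> i; apply/ltW/st; rewrite -(perm_mem pl) mem_nth.
move=> i j ij.
have il : nth 0%N l' i \in l by rewrite -(perm_mem pl) mem_nth.
have jl : nth 0%N l' j \in l by rewrite -(perm_mem pl) mem_nth.
have nij : nth 0%N l' i != nth 0%N l' j.
  by rewrite nth_uniq//; apply/eqP => ijE; rewrite ijE ltnn in ij.
have leij : s (nth 0%N l' i) <= s (nth 0%N l' j).
  by apply: (sorted_ltn_nth leS_tr 0%N sl') => //; rewrite inE.
have [//|ji] := dis _ _ il jl nij.
have := st _ jl; have := st _ il; lra.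
Qed.

Section LebesgueStieltjes.
Variables (a b : R) (V : R -> R).
Hypothesis ab : a <= b.
Hypothesis ndV : {in `[a, b] &, {homo V : x y / x <= y}}.
Hypothesis acV : absolutely_continuous_on a b V.

(** Constant extension of [V] to the line, as Stieltjes measures are attached to
    functions defined everywhere. *)
Definition clip_ext : R -> R := V \o clip a b.

Lemma clip_ext_nd : nondecreasing clip_ext.
Proof. by move=> x y xy; apply: ndV; rewrite ?clip_in//; exact: clip_le. Qed.

Lemma clip_ext_continuous : continuous clip_ext.
Proof.
move=> x; apply/cvgrPdist_lt => e e0.
have [r r0 Hr] := sum_clip_lt ab acV e0.
near=> y.
have xyr : `|x - y| < r by near: y; exact: cvgr_dist_lt.
have [xy|yx] := leP x y.
  have := Hr 1%N (fun=> x) (fun=> y).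
  rewrite !big_ord1 distrC; apply => //.
    by move=> i j; rewrite !ord1.
  by move: xyr; rewrite distrC ger0_norm// subr_ge0.
have := Hr 1%N (fun=> y) (fun=> x).
rewrite !big_ord1; apply => //.
- by move=> _; exact: ltW.
- by move=> i j; rewrite !ord1.
- by move: xyr; rewrite ger0_norm// subr_ge0 ltW.
Unshelve. all: by end_near. Qed.

HB.instance Definition _ := isCumulative.Build R _ R clip_ext
  clip_ext_nd (right_continuousW clip_ext_continuous).

Let lsm : {measure set (measurableTypeR R) -> \bar R} :=
  lebesgue_stieltjes_measure clip_ext.

Lemma lsm_itv x y : x <= y -> lsm `]x, y]%classic = (clip_ext y - clip_ext x)%:E.
Proof.
move=> xy; transitivity (wlength clip_ext `]x, y]%classic).
  by apply: measurable_mu_extE; exact: is_ocitv.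
by rewrite wlength_itv_bnd// EFinB.
Qed.

Lemma lsm_itv_fin : (lsm `]a, b]%classic < +oo)%E.
Proof. by rewrite lsm_itv// ltry. Qed.

Lemma bounded_open_itv (I : set R) : open I -> is_interval I ->
  I `<=` `]a - 1, b + 1[ -> I = `]inf I, sup I[%classic.
Proof.
move=> oI iI Iab; rewrite -interval_bounded_interior//.
- by apply/esym/interior_id.
- by exists (a - 1) => x /Iab /=; rewrite in_itv/= => /andP[/ltW].
- by exists (b + 1) => x /Iab /=; rewrite in_itv/= => /andP[_ /ltW].
Qed.

(** An open set is a disjoint union of open intervals, to finitely many of
    which absolute continuity applies at a time. *)
Lemma lsm_open_le (e : R) : 0 < e -> exists2 r : R, 0 < r &
  forall U : set R, open U -> U `<=` `]a - 1, b + 1[ ->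
    (mu U < r%:E)%E -> (lsm U <= e%:E)%E.
Proof.
move=> e0; have [r r0 Hr] := sum_disjoint_lt ab acV e0.
exists r => // U oU Uab Ur.
pose I := open_disjoint_itv oU.
have UE : U = \bigcup_q I q := open_disjoint_itv_bigcup oU.
have tI : trivIset setT I := open_disjoint_itv_trivIset (oU:=oU).
have IE q : I q = `]inf (I q), sup (I q)[%classic.
  apply: bounded_open_itv; [exact: open_disjoint_itv_open|
    exact: open_disjoint_itv_is_interval|].
  by apply: subset_trans Uab; rewrite UE; exact: bigcup_sup.
have mI q : measurable (I q) by rewrite IE.
rewrite UE measure_semi_bigcup//=; last by apply: bigcup_measurable => k _; exact: mI.
apply: lime_le; first exact: is_cvg_nneseries.
apply: nearW => n.
pose ne q := inf (I q) < sup (I q).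
have I0 q : ~~ ne q -> I q = set0.
  by move=> neq; rewrite IE set_itv_ge// bnd_simp.
have lsmI q : ne q -> (lsm (I q) <= (clip_ext (sup (I q)) - clip_ext (inf (I q)))%:E)%E.
  move=> neq; rewrite -lsm_itv; last exact: ltW.
  apply: le_measure; rewrite ?inE//; first exact: mI.
  by rewrite {1}IE; exact: subset_itv_oo_oc.
pose l := [seq q <- iota 0 n | ne q].
apply: (@le_trans _ _ (\sum_(q <- l) `|clip_ext (sup (I q)) - clip_ext (inf (I q))|)%:E).
  rewrite big_filter /index_iota subn0 (bigID ne)/= [X in (_ + X)%E]big1 ?adde0.
    rewrite -sumEFin; apply: lee_sum => q neq.
    by rewrite (le_trans (lsmI _ neq))// lee_fin ler_norm.
  by move=> q /I0 ->; rewrite measure0.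
rewrite lee_fin ltW//.
apply: (Hr l (fun q => inf (I q)) (fun q => sup (I q))).
- by rewrite filter_uniq// iota_uniq.
- by move=> q; rewrite mem_filter => /andP[].
- move=> i j; rewrite !mem_filter => /andP[nei _] /andP[nej _] ij.
  apply/orP; rewrite -implyNb -ltNge; apply/implyP => ji; rewrite leNgt.
  apply/negP => ij'.
  move/trivIsetP : tI => /(_ i j Logic.I Logic.I ij).
  apply/eqP/set0P.
  pose lo := Num.max (inf (I i)) (inf (I j)).
  pose hi := Num.min (sup (I i)) (sup (I j)).
  have lohi : lo < hi.
    rewrite /lo /hi gt_max !lt_min.
    by apply/andP; split; apply/andP; split.
  have [] := midf_lt lohi.
  have inI k x : inf (I k) < x -> x < sup (I k) -> I k x.
    by move=> kx xk; rewrite IE /= in_itv/= kx.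
  rewrite {1}/lo {2}/hi gt_max lt_min => /andP[? ?] /andP[? ?].
  by exists ((lo + hi) / 2); split; exact: inI.
rewrite -lte_fin; apply: le_lt_trans Ur.
rewrite UE measure_semi_bigcup//=; last by apply: bigcup_measurable => k _; exact: mI.
apply: (@le_trans _ _ (\sum_(0 <= q < n) mu (I q))%E); last first.
  exact: nneseries_lim_ge.
rewrite big_filter /index_iota subn0 [leRHS](bigID ne)/=.
rewrite [X in (_ <= _ + X)%E]big1 ?adde0; last by move=> q /I0 ->; rewrite measure0.
rewrite -sumEFin; apply: lee_sum => q neq.
rewrite [X in mu X]IE lebesgue_measure_itv/= lte_fin.
by move: neq; rewrite /ne => ->.
Qed.

(** Restricted to ]a, b] the measure is finite, as the Radon-Nikodym theorem needs. *)
Let nu : {finite_measure set (measurableTypeR R) -> \bar R} :=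
  @mfrestr _ (measurableTypeR R) R `]a, b]%classic lsm (measurable_itv `]a, b]) lsm_itv_fin.

Lemma lsm_dominated : nu `<< mu.
Proof.
apply/null_content_dominatesP => A mA muA.
apply/eqP; rewrite eq_le measure_ge0 andbT.
apply/lee_addgt0Pr => e e0; rewrite add0e.
have [r r0 Hr] := lsm_open_le e0.
have [|U [oU AU UA]] := @lebesgue_regularity_outer R A r mA _ r0.
  by rewrite muA.
pose W := U `&` `]a - 1, b + 1[.
have oW : open W by apply: openI => //; exact: interval_open.
apply: (@le_trans _ _ (lsm W)).
  apply: le_measure; rewrite ?inE.
  - exact: measurableI.
  - exact: open_measurable.
  - move=> x [/AU Ux]; split => //; move: b0; rewrite /= !in_itv/= => /andP[? ?].
    by apply/andP; split; lra.
apply: Hr => //; first by move=> x [].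
have mU : measurable U by exact: open_measurable.
apply: (@le_lt_trans _ _ (mu U)).
  by apply: le_measure; rewrite ?inE//; [exact: open_measurable|move=> x []].
rewrite -[X in mu X](setDUK AU).
apply: (@le_lt_trans _ _ (mu A + mu (U `\` A))%E).
  by apply: measureU2 => //; exact: measurableD.
by rewrite muA add0e.
Qed.

(** The Lebesgue-Stieltjes measure of [V] is dominated by the Lebesgue measure, and
    its Radon-Nikodym derivative is the density. *)
Lemma ac_density : exists f : R -> R,
  [/\ measurable_fun setT f, forall x, 0 <= f x,
      mu.-integrable setT (EFin \o f) &
      forall s t, a <= s -> s <= t -> t <= b ->
        (\int[mu]_(x in `[s, t]) (f x)%:E = (V t - V s)%:E)%E].
Proof.
have [f [f0 ffin intf fE]] := radon_nikodym_sigma_finite lsm_dominated.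
have fEfine : EFin \o (fine \o f) = f.
  by apply/funext => x /=; rewrite fineK.
have mf : measurable_fun setT (EFin \o (fine \o f)).
  by rewrite fEfine; exact: measurable_int intf.
exists (fine \o f); split.
- exact/measurable_EFinP.
- by move=> x /=; rewrite fine_ge0.
- by rewrite fEfine.
move=> s t as_ st tb.
have sab : s \in `[a, b] by rewrite in_itv/= as_ (le_trans st).
have tab : t \in `[a, b] by rewrite in_itv/= tb (le_trans as_).
transitivity (\int[mu]_(x in `]s, t]) f x)%E.
  rewrite -[in RHS]fEfine -integral_itv_obnd_cbnd//.
  exact: measurable_funTS.
rewrite -fE//.
transitivity (lsm `]s, t]%classic).
  rewrite /nu /= /mfrestr /mrestr; congr (lsm _); apply/seteqP; split => x /=.
    by case.
  rewrite !in_itv/= => /andP[sx xt]; split; rewrite ?sx//=.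
  by rewrite (le_lt_trans as_)//= (le_trans xt).
by rewrite lsm_itv// /clip_ext/= !clip_id.
Qed.

End LebesgueStieltjes.
End Density.

(** * Metrics, path length and controls *)

Section Metric.
Context {R : realType} {T : Type} {d : T -> T -> R}.
Hypothesis dM : is_metric d.

Lemma dist_xx x : d x x = 0. Proof. by case: dM => /(_ x x)[_ ->]. Qed.

Lemma dist_sym x y : d x y = d y x. Proof. by case: dM. Qed.

Lemma dist_tri x y z : d x z <= d x y + d y z. Proof. by case: dM. Qed.

Lemma dist_ge0 x y : 0 <= d x y.
Proof. by have := dist_tri x y x; rewrite dist_xx (dist_sym y x); lra. Qed.

Lemma dist_diff x y z : `|d x z - d y z| <= d x y.
Proof.
have := dist_tri x y z; have := dist_tri y x z; rewrite (dist_sym y x) => ? ?.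
by rewrite ler_norml; lra.
Qed.

End Metric.

Section PathLength.
Context {R : realType} {T : Type} {d : T -> T -> R}.
Hypothesis dM : is_metric d.
Implicit Types (a b s t : R) (g : R -> T) (V : R -> R) (p : seq R).

(** A function whose increments dominate the distances along a path: unlike the
    length function it can be transformed and glued at will. *)
Definition path_control a b g V : Prop :=
  [/\ a <= b, absolutely_continuous_on a b V &
   forall s t, a <= s -> s <= t -> t <= b -> d (g s) (g t) <= V t - V s].

Lemma path_control_nd a b g V : path_control a b g V ->
  {in `[a, b] &, {homo V : x y / x <= y}}.
Proof.
case=> _ _ gV x y; rewrite !in_itv/= => /andP[ax _] /andP[_ yb] xy.
by rewrite -subr_ge0; apply: le_trans (gV _ _ ax xy yb); exact: dist_ge0.
Qed.

Lemma dist_variation_nil a b g : dist_variation d a b g [::] = 0.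
Proof. by rewrite /dist_variation big_geq. Qed.

Lemma dist_variation_cons a b g x p :
  dist_variation d a b g (x :: p) = d (g a) (g x) + dist_variation d x b g p.
Proof. by rewrite /dist_variation/= big_nat_recl. Qed.

Lemma dist_variation_rcons a b c g p : last a p = b ->
  dist_variation d a c g (rcons p c) =
  dist_variation d a b g p + d (g b) (g c).
Proof.
elim: p a => [a /= ->|x p IH a /= xpb].
  by rewrite dist_variation_cons !dist_variation_nil addrC.
by rewrite !dist_variation_cons IH// addrA.
Qed.

Lemma dist_variation_le_control a b t g V p :
  (forall x y, a <= x -> x <= y -> y <= b -> d (g x) (g y) <= V y - V x) ->
  a <= t -> itv_partition t b p -> dist_variation d t b g p <= V b - V t.
Proof.
move=> gV; elim: p t => [|x p IH] t at_ tp.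
  by rewrite dist_variation_nil (itv_partition_nil tp) subrr.
have xb := itv_partition_le (itv_partition_cons tp).
have tx : t <= x by case: tp => /= /andP[/ltW].
rewrite dist_variation_cons.
have := IH _ (le_trans at_ tx) (itv_partition_cons tp).
have := gV _ _ at_ tx xb; lra.
Qed.

Lemma path_length_ge0 a b g : a <= b -> (0 <= path_length d a b g)%E.
Proof.
rewrite le_eqVlt => /orP[/eqP <-|ab].
  apply: ereal_sup_ubound; exists [::]; last by rewrite dist_variation_nil.
  by split.
apply: (@le_trans _ _ (d (g a) (g b))%:E); first by rewrite lee_fin dist_ge0.
apply: ereal_sup_ubound; exists [:: b]; first exact: itv_partition1.
by rewrite dist_variation_cons dist_variation_nil addr0.
Qed.

(** Append [t] to the partitions of [[a, s]]. *)
Lemma path_length_add_dist a s t g : a <= s -> s <= t ->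
  (path_length d a s g + (d (g s) (g t))%:E <= path_length d a t g)%E.
Proof.
move=> as_; rewrite le_eqVlt => /orP[/eqP <-|st].
  by rewrite (dist_xx dM) adde0.
rewrite -leeBrDr//; apply: ge_ereal_sup => _ [p [pp /eqP pl] <-].
rewrite leeBrDr// -EFinD -dist_variation_rcons//.
apply: ereal_sup_ubound; exists (rcons p t) => //; split.
  by rewrite rcons_path pp pl.
by rewrite last_rcons.
Qed.

(** Inserting [s] into a partition of [[a, t]] does not decrease its sum, and the
    part of the sum beyond [s] telescopes. *)
Lemma path_length_le_add a s t g V : a <= s -> s <= t ->
  (forall x y, s <= x -> x <= y -> y <= t -> d (g x) (g y) <= V y - V x) ->
  (path_length d a t g <= path_length d a s g + (V t - V s)%:E)%E.
Proof.
move=> as_ st gV; apply: ge_ereal_sup => _ [p pp <-].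
suff [q qs pq] : exists2 q, itv_partition a s q &
    dist_variation d a t g p <= dist_variation d a s g q + (V t - V s).
  apply: le_trans (leeD2r _ (ereal_sup_ubound _)); last by exists q.
  by rewrite lee_fin.
elim: p a as_ pp => [|x p IH] a as_ pp.
  have at_ := itv_partition_nil pp.
  have sa : s = a by apply: le_anti; rewrite as_ at_ st.
  exists [::]; first by split => //=; rewrite sa.
  by rewrite !dist_variation_nil sa at_; lra.
have ax : a < x by case: pp => /= /andP[].
have xt := itv_partition_le (itv_partition_cons pp).
have [xs|sx] := leP x s.
  have [q [qp qs] pq] := IH _ xs (itv_partition_cons pp).
  exists (x :: q); first by split => //=; rewrite ax.
  by rewrite !dist_variation_cons -addrA lerD2l.
have dvx : dist_variation d x t g p <= V t - V x.
  by apply: (dist_variation_le_control gV); [exact: ltW|exact: itv_partition_cons pp].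
have dsx := gV _ _ (lexx s) (ltW sx) xt.
move: as_; rewrite le_eqVlt => /orP[/eqP as_|as_].
  exists [::]; first by split => //=; rewrite as_.
  by rewrite dist_variation_cons dist_variation_nil as_; lra.
exists [:: s]; first exact: itv_partition1.
rewrite !dist_variation_cons dist_variation_nil.
have := dist_tri dM (g a) (g s) (g x); lra.
Qed.

Lemma rectifiable_length_fin a b g t : (path_length d a b g < +oo)%E ->
  a <= t -> t <= b -> path_length d a t g \is a fin_num.
Proof.
move=> gfin at_ tb; rewrite ge0_fin_numE ?path_length_ge0//.
apply: le_lt_trans gfin; apply: le_trans (path_length_add_dist g at_ tb).
by rewrite leeDl// lee_fin dist_ge0.
Qed.

Lemma rectifiable_length_control a b g : (path_length d a b g < +oo)%E ->
  forall s t, a <= s -> s <= t -> t <= b ->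
  d (g s) (g t) <= fine (path_length d a t g) - fine (path_length d a s g).
Proof.
move=> gfin s t as_ st tb.
rewrite -lee_fin EFinB !fineK; last 2 first.
- by apply: (rectifiable_length_fin gfin) => //; exact: le_trans tb.
- by apply: (rectifiable_length_fin gfin) => //; exact: le_trans st.
have sfin : path_length d a s g \is a fin_num.
  by apply: (rectifiable_length_fin gfin) => //; exact: le_trans tb.
by rewrite leeBrDr// addeC; exact: path_length_add_dist.
Qed.

Lemma ac_path_control a b g : ac_path d a b g ->
  path_control a b g (fun t => fine (path_length d a t g)).
Proof.
by case=> -[[ab _] gfin] ac; split => //; exact: rectifiable_length_control.
Qed.

(** The increments of the length function are at most those of [V], so it inherits
    absolute continuity. *)
Lemma control_ac_path a b g V : path_control a b g V -> ac_path d a b g.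
Proof.
move=> /[dup] /path_control_nd ndV [ab acV gV].
have gfin : (path_length d a b g < +oo)%E.
  apply: le_lt_trans (path_length_le_add (lexx a) ab gV) _; rewrite [X in (X + _)%E](_ : _ = 0%E) ?add0e ?ltry//.
  apply/eqP; rewrite eq_le path_length_ge0// andbT.
  apply: ge_ereal_sup => _ [p /itv_partitionxx -> <-].
  by rewrite dist_variation_nil.
have Vle x y : a <= x -> x <= y -> y <= b -> V x <= V y.
  move=> ax xy yb; apply: ndV => //; rewrite in_itv/=.
    by rewrite ax (le_trans xy).
  by rewrite yb (le_trans ax).
split; [split => //; split => //|].
  move=> t e; rewrite in_itv/= => /andP[at_ tb] e0.
  have [r r0 Hr] := acV e e0; exists r => // u; rewrite in_itv/= => /andP[au ub].
  have [tu|ut] := leP t u; move=> utr.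
    rewrite (dist_sym dM); apply: le_lt_trans (gV _ _ at_ tu ub) _.
    have := Hr 1%N (fun=> t) (fun=> u); rewrite !big_ord1 ger0_norm ?subr_ge0 ?Vle//.
    by apply => // [i j|]; rewrite ?ord1// (le_lt_trans (ler_norm _)).
  move/ltW in ut.
  apply: le_lt_trans (gV _ _ au ut tb) _.
  have := Hr 1%N (fun=> u) (fun=> t); rewrite !big_ord1 ger0_norm ?subr_ge0 ?Vle//.
  by apply => // [i j|]; rewrite ?ord1// (le_lt_trans (ler_norm _))// distrC.
move=> e e0; have [r r0 Hr] := acV e e0; exists r => // n s t st ts sr.
apply: le_lt_trans (Hr n s t st ts sr); apply: ler_sum => i _.
have [as_ sti tb] := st i.
rewrite [leRHS]ger0_norm ?subr_ge0 ?Vle//.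
have h := rectifiable_length_control gfin as_ sti tb.
rewrite ger0_norm; last by apply: le_trans h; exact: dist_ge0.
have sfin : path_length d a (s i) g \is a fin_num.
  by apply: (rectifiable_length_fin gfin) => //; exact: le_trans tb.
have tfin : path_length d a (t i) g \is a fin_num.
  by apply: (rectifiable_length_fin gfin) => //; exact: le_trans sti.
rewrite lerBlDl -lee_fin EFinD !fineK//.
apply: path_length_le_add => // x y sx xy yt; apply: gV => //.
  exact: le_trans sx.
exact: le_trans tb.
Qed.

End PathLength.

(** * The metric derivative *)

Section LebesguePoints.
Context {R : realType}.
Local Notation mu := (@lebesgue_measure R).

Lemma derive1_small_o (F : R -> R) (t : R) : derivable F t 1 ->
  forall e : R, 0 < e -> exists2 r : R, 0 < r & forall u : R, `|u - t| < r ->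
    `|F u - F t - derive1 F t * (u - t)| <= e * `|u - t|.
Proof.
move=> dF e e0.
have /cvgrPdist_le /(_ e e0) : (fun h => h^-1 *: (F (h + t) - F t)) @ 0^' --> derive1 F t.
  have E : (fun h => h^-1 *: (F (h + t) - F t)) =
           (fun h => h^-1 *: ((F \o shift t) (h *: 1) - F t)).
    by apply/funext => h /=; rewrite [h *: 1]mulr1.
  by move: dF; rewrite /derivable/= -E.
move=> -[r /= r0 Hr].
exists r => // u ur.
have [->|ut] := eqVneq u t; first by rewrite !subrr mulr0 subr0 normr0 mulr0.
have utn0 : u - t != 0 by rewrite subr_eq0.
have := Hr (u - t); rewrite /ball/= sub0r normrN => /(_ ur utn0).
rewrite subrK => H.
have -> : F u - F t - derive1 F t * (u - t) =
    - ((u - t) * (derive1 F t - (u - t)^-1 *: (F u - F t))).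
  by rewrite /GRing.scale/=; field.
by rewrite normrN normrM mulrC ler_wpM2r.
Qed.

(** Differentiability at [t] with derivative [c], relative to [[a, b]] and without
    quotients. *)
Definition slope_in (a b : R) (F : R -> R) (t c : R) : Prop :=
  forall e : R, 0 < e -> exists2 r : R, 0 < r &
    forall u, a <= u -> u <= b -> `|u - t| < r ->
    `|F u - F t - c * (u - t)| <= e * `|u - t|.

Lemma lebesgue_pt_slope (f F : R -> R) (a b t : R) :
  mu.-integrable setT (EFin \o f) ->
  (forall u, a <= u -> u <= b ->
     (\int[mu]_(x in `[a, u]) (f x)%:E = (F u - F a)%:E)%E) ->
  lebesgue_pt f t -> a < t -> t < b -> slope_in a b F t (f t).
Proof.
move=> intf FE ft at_ tb e e0.
have [||dG Gf] := @FTC1_lebesgue_pt _ f (BLeft a) t b tb _ _ ft.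
- by apply: integrableS intf.
- by rewrite lte_fin.
set G := (fun y => _) in dG Gf.
have FG u : a <= u -> u <= b -> G u = F u - F a.
  by move=> au ub; rewrite /G /Rintegral FE.
have [r r0 Hr] := derive1_small_o dG e0.
exists r => // u au ub ur; have := Hr u ur.
have GE : G u - G t = F u - F t by rewrite (FG t)// ?ltW// FG//; lra.
by rewrite Gf GE.
Qed.

Lemma slope_in_le a b F G t c c' : a < t -> t < b ->
  slope_in a b F t c -> slope_in a b G t c' ->
  (forall u, a <= u -> u <= b -> `|F u - F t| <= `|G u - G t|) ->
  `|c| <= `|c'|.
Proof.
move=> at_ tb Fc Gc FG; apply/ler_addgt0Pl => e e0.
have e20 : 0 < e / 2 by lra.
have [r r0 Hr] := Fc _ e20; have [r' r'0 Hr'] := Gc _ e20.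
pose u := t + Num.min (Num.min r r') (b - t) / 2.
have [h0 hr hr' hb] : [/\ 0 < u - t, u - t < r, u - t < r' & u < b].
  rewrite /u; set k := Num.min _ _.
  have k0 : 0 < k by rewrite /k !lt_min r0 r'0 subr_gt0.
  have : k <= r /\ k <= r' /\ k <= b - t.
    by rewrite /k !ge_min !lexx !orbT.
  by move=> [? [? ?]]; split; lra.
have au : a <= u by lra.
have := Hr u au (ltW hb); have := Hr' u au (ltW hb); have := FG u au (ltW hb).
rewrite (gtr0_norm h0) => FGu /(_ hr') Gu /(_ hr) Fu.
rewrite -(ler_pM2r h0) mulrDl -(gtr0_norm h0) -!normrM.
have := ler_normB (F u - F t) (F u - F t - c * (u - t)).
rewrite (_ : _ - (_ - _) = c * (u - t)); last by ring.
have := ler_normD (c' * (u - t)) (G u - G t - c' * (u - t)).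
rewrite (_ : _ + (_ - _) = G u - G t); last by ring.
rewrite (gtr0_norm h0); lra.
Qed.

Lemma integral_primitive (f : R -> R) (a s t : R) :
  mu.-integrable setT (EFin \o f) -> a <= s -> s <= t ->
  (\int[mu]_(x in `[s, t]) (f x)%:E =
   (\int[mu]_(x in `[a, t]) f x - \int[mu]_(x in `[a, s]) f x)%:E)%E.
Proof.
move=> intf as_ st.
have intS (A : set R) : measurable A -> mu.-integrable A (EFin \o f).
  by move=> mA; apply: integrableS intf.
rewrite Rintegral_itvB; [|exact: intS|by rewrite bnd_simp..].
rewrite Rintegral_itv_obnd_cbnd; last exact: intS.
rewrite /Rintegral fineK//.
by apply: integrable_fin_num => //; exact: intS.
Qed.

End LebesguePoints.

Section MetricDerivative.
Context {R : realType} {T : Type} {d : T -> T -> R}.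
Hypothesis dM : is_metric d.
Local Notation mu := (@lebesgue_measure R).

(** The points at which the distance functions of [metric_derivative] are based. *)
Lemma clip_rat_dense (a b : R) : a <= b -> exists p : nat -> R,
  (forall n, p n \in `[a, b]) /\
  forall s e : R, s \in `[a, b] -> 0 < e -> exists n, `|p n - s| < e.
Proof.
move=> ab; pose p n := clip a b (if unpickle n is Some q then ratr q else a).
exists p; split; first by move=> n; exact: clip_in.
move=> s e sab e0.
have [q qs] := rat_in_itvoo (ltr_pwDr e0 (lexx s)).
exists (pickle q); rewrite /p pickleK -(clip_id sab).
move: qs; rewrite in_itv/= => /andP[/ltW sq qse].
have := clip_contract a b sq; have := clip_le a b sq => h1 h2.
by rewrite ger0_norm ?subr_ge0//; lra.
Qed.

Variables (a b : R) (g : R -> T) (V : R -> R).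
Hypothesis gV : path_control (d := d) a b g V.

(** The distance to a fixed point is not monotone, but adding [V] makes it so.
    This gives it a density, as a difference of two monotone functions. *)
Lemma control_add_dist z : [/\
  {in `[a, b] &, {homo (fun t => V t + d (g t) z) : x y / x <= y}} &
  absolutely_continuous_on a b (fun t => V t + d (g t) z)].
Proof.
have [ab acV Vg] := gV; have ndV := path_control_nd dM gV.
have incr s t : a <= s -> s <= t -> t <= b ->
    `|d (g t) z - d (g s) z| <= V t - V s.
  move=> as_ st tb; apply: le_trans (Vg _ _ as_ st tb).
  by rewrite (dist_sym dM (g s) (g t)); exact: (dist_diff dM).
split=> [x y|].
  rewrite !in_itv/= => /andP[ax _] /andP[_ yb] xy.
  by have := incr _ _ ax xy yb; rewrite ler_norml; lra.
move=> e e0; have e20 : 0 < e / 2 by lra.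
have [r r0 Hr] := acV _ e20; exists r => // n s t st ts sr.
have := Hr n s t st ts sr.
suff : \sum_(i < n) `|V (t i) + d (g (t i)) z - (V (s i) + d (g (s i)) z)|
   <= 2 * \sum_(i < n) `|V (t i) - V (s i)| by lra.
rewrite mulr_sumr; apply: ler_sum => i _; have [as_ sti tb] := st i.
have := incr _ _ as_ sti tb.
have := ler_norm (V (t i) - V (s i)).
rewrite !ler_norml => ? ?; apply/andP; split; lra.
Qed.

Lemma control_cvg s e : s \in `[a, b] -> 0 < e -> exists2 r : R, 0 < r &
  forall u, u \in `[a, b] -> `|u - s| < r -> d (g u) (g s) < e.
Proof. by have [[[_ gc] _] _] := control_ac_path dM gV; exact: gc. Qed.

(** Let [k n] be the density of the distance to the [n]-th point [p n] of a dense
    sequence on the path. The speed is the supremum [m] of the [`|k n|]. It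
    dominates distances because [d (g s) (g t)] is the supremum of the increments
    of the distances to the [p n]. At a common Lebesgue point of [m] and of all the
    [k n] the difference quotients of the path are asymptotically at most [m t] for
    this reason, and at least every [`|k n t|] by the triangle inequality. *)
Let metric_derivative_lt : a < b -> exists m : R -> R,
  [/\ measurable_fun setT m, forall x, 0 <= m x,
      mu.-integrable setT (EFin \o m),
      forall s t, a <= s -> s <= t -> t <= b ->
        ((d (g s) (g t))%:E <= \int[mu]_(x in `[s, t]) (m x)%:E)%E &
      {ae mu, forall t, t \in `]a, b[ ->
        (fun u => d (g u) (g t) / `|u - t|) @ t^' --> m t}].
Proof.
move=> ab; have [leab acV Vg] := gV; have ndV := path_control_nd dM gV.
have [f [mf f0 intf fE]] := ac_density leab ndV acV.
have [p [pab pd]] := clip_rat_dense leab.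
pose phi n t := d (g t) (g (p n)).
have /choice[k kP] : forall n, exists k : R -> R,
    [/\ measurable_fun setT k, mu.-integrable setT (EFin \o k) &
    forall s t, a <= s -> s <= t -> t <= b ->
      (\int[mu]_(x in `[s, t]) (k x)%:E = (phi n t - phi n s)%:E)%E].
  move=> n; have [nd ac] := control_add_dist (g (p n)).
  have [fn [mfn _ intfn fnE]] := ac_density leab nd ac.
  exists (fn \- f); split.
  - exact: measurable_funB.
  - by rewrite (_ : _ \o _ = (EFin \o fn) \- (EFin \o f))%E//; exact: integrableB.
  - move=> s t as_ st tb; under eq_integral do rewrite /= EFinB.
    rewrite integralB_EFin//; [|exact: integrableS intfn|exact: integrableS intf].
    by rewrite fnE// fE// -EFinB /phi; congr (_%:E); ring.
(* The truncation by [f] makes the supremum finite everywhere, and almost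
   everywhere it changes nothing, by [k_f] below. *)
pose h x n := Num.min `|k n x| (f x).
pose m x := sup (range (h x)).
have hub x : has_ubound (range (h x)).
  by exists (f x) => _ [n _ <-]; rewrite /h ge_min lexx orbT.
have hm x n : h x n <= m x.
  by apply: ub_le_sup => //; exists n.
have m_f x : m x <= f x.
  apply: ge_sup; first by exists (h x 0%N); exists 0%N.
  by move=> _ [n _ <-]; rewrite /h ge_min lexx orbT.
have m0 x : 0 <= m x.
  by apply: le_trans (hm x 0%N); rewrite /h le_min normr_ge0 f0.
have mm : measurable_fun setT m.
  have -> : m = fun x => sups (h x) 0.
    apply/funext => x; congr (sup _); apply/seteqP; split=> _ [n nT <-];
    by exists n.
  apply: (@measurable_fun_sups _ _ _ _ (fun n x => h x n)) => [x _|n]; first exact: hub.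
  apply: measurable_minr => //; apply: measurableT_comp => //.
  by have [] := kP n.
have intm : mu.-integrable setT (EFin \o m).
  apply: le_integrable intf => //; first exact/measurable_EFinP.
  by move=> x _ /=; rewrite lee_fin !ger0_norm.
have kpt n t : t \in `]a, b[ -> lebesgue_pt (k n) t ->
    slope_in a b (phi n) t (k n t).
  have [mk intk kE] := kP n.
  rewrite in_itv/= => /andP[at_ tb] kt.
  by apply: lebesgue_pt_slope => // u au ub; exact: kE.
have k_f n t : t \in `]a, b[ -> lebesgue_pt f t -> lebesgue_pt (k n) t ->
    `|k n t| <= f t.
  move=> tab ft kt; have := kpt _ _ tab kt.
  move: (tab); rewrite in_itv/= => /andP[at_ tb] kslope.
  rewrite -[leRHS](ger0_norm (f0 t)).
  apply: (@slope_in_le _ a b _ V _ _ _ at_ tb kslope).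
    by apply: (@lebesgue_pt_slope _ f V) => // u au ub; exact: fE.
  have incr x y : a <= x -> x <= y -> y <= b ->
      `|phi n x - phi n y| <= `|V x - V y|.
    move=> ax xy yb; rewrite (distrC (V x)); apply: le_trans (ler_norm _).
    by apply: le_trans (Vg _ _ ax xy yb); exact: (dist_diff dM).
  move=> u au ub; have [tu|/ltW ut] := leP t u; last exact: (incr u t au ut (ltW tb)).
  by rewrite distrC (distrC (V u)); exact: (incr t u (ltW at_) tu ub).
have locint (q : R -> R) : mu.-integrable setT (EFin \o q) ->
    locally_integrable setT q.
  by move=> intq; apply: open_integrable_locally => //; exact: openT.
have aeF := ae_filter_ringOfSetsType mu.
have aef := lebesgue_differentiation (locint _ intf).
have aem := lebesgue_differentiation (locint _ intm).
have aek : {ae mu, forall x n, lebesgue_pt (k n) x}.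
  apply/ae_foralln => n; apply: lebesgue_differentiation.
  by apply: locint; have [] := kP n.
have dist_le s t : a <= s -> s <= t -> t <= b ->
    ((d (g s) (g t))%:E <= \int[mu]_(x in `[s, t]) (m x)%:E)%E.
  move=> as_ st tb.
  have sab : s \in `[a, b] by rewrite in_itv/= as_ (le_trans st).
  have phi_le n : ((phi n t - phi n s)%:E <= \int[mu]_(x in `[s, t]) (m x)%:E)%E.
    have [mk intk kE] := kP n.
    have mkE : measurable_fun setT (EFin \o k n) by exact/measurable_EFinP.
    have openE (q : R -> \bar R) : measurable_fun setT q ->
        (\int[mu]_(x in `[s, t]) q x = \int[mu]_(x in `]s, t[) q x)%E.
      by move=> mq; apply: integral_itv_bndoo; exact: measurable_funTS.
    rewrite -kE// (openE _ mkE) openE; last exact/measurable_EFinP.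
    apply: le_trans (lee_abs _) _.
    apply: le_trans (le_abse_integral _ _ _) _ => //; first exact: measurable_funTS.
    apply: ae_ge0_le_integral => //.
    - by apply/measurable_funTS; apply: measurableT_comp => //; exact/measurable_EFinP.
    - by move=> x _; rewrite lee_fin.
    - exact/measurable_funTS/measurable_EFinP.
    apply: filterS2 aef aek => x fx kx; rewrite /= in_itv/= => /andP[sx xt].
    have xab : x \in `]a, b[.
      by rewrite in_itv/= (le_lt_trans as_ sx) (lt_le_trans xt tb).
    rewrite lee_fin; apply: le_trans (hm x n).
    by rewrite /h le_min lexx k_f.
  apply/lee_addgt0Pr => e e0; have e20 : 0 < e / 2 by lra.
  have [r r0 Hr] := control_cvg sab e20.
  have [n pn] := pd s r sab r0.
  apply: le_trans (leeD2r _ (phi_le n)).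
  rewrite -EFinD lee_fin /phi.
  have := Hr _ (pab n) pn; rewrite (dist_sym dM (g (p n))).
  have := dist_tri dM (g s) (g (p n)) (g t); rewrite (dist_sym dM (g (p n))); lra.
exists m; split => //.
apply: filterS3 aef aem aek => t ft mt kt tab.
have := tab; rewrite in_itv/= => /andP[at_ tb].
apply/cvgrPdist_le => e e0.
pose M u := \int[mu]_(x in `[a, u]) m x.
have Mslope : slope_in a b M t (m t).
  by apply: lebesgue_pt_slope => // u au ub; exact: integral_primitive.
have [r r0 Hr] := Mslope _ e0.
have [n mtn] : exists n, m t - e / 2 < `|k n t|.
  have hsup : has_sup (range (h t)).
    by split; [exists (h t 0%N); exists 0%N|exact: hub].
  have e20 : 0 < e / 2 by lra.
  have [_ [n _ <-] hn] := sup_adherent e20 hsup.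
  by exists n; apply: lt_le_trans hn _; rewrite /h ge_min lexx.
have e20 : 0 < e / 2 by lra.
have [r' r'0 Hr'] := kpt n t tab (kt n) _ e20.
have rad0 : 0 < Num.min (Num.min r r') (Num.min (t - a) (b - t)).
  by rewrite !lt_min r0 r'0 !subr_gt0 at_ tb.
exists (Num.min (Num.min r r') (Num.min (t - a) (b - t))) => //= u.
rewrite /ball_/= distrC !lt_min => /andP[/andP[ur ur'] /andP[ua ub]] ut.
have {}ut : 0 < `|u - t| by rewrite normr_gt0 subr_eq0.
have au : a <= u by move: ua; rewrite ltr_norml => /andP[]; lra.
have {}ub : u <= b by move: ub; rewrite ltr_norml => /andP[]; lra.
have dM_u : d (g u) (g t) <= `|M u - M t|.
  have dM_le x y : a <= x -> x <= y -> y <= b -> d (g x) (g y) <= `|M y - M x|.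
    move=> ax xy yb; rewrite -lee_fin; apply: le_trans (dist_le _ _ ax xy yb) _.
    by rewrite (integral_primitive intm ax xy) lee_fin ler_norm.
  have [tu|/ltW ut'] := leP t u; first by rewrite (dist_sym dM) dM_le// ltW.
  by rewrite distrC dM_le// ltW.
have dphi : `|phi n u - phi n t| <= d (g u) (g t) by exact: (dist_diff dM).
have Mu := Hr u au ub ur; have phiu := Hr' u au ub ur'.
rewrite -(ler_pM2r ut) -[X in _ * X <= _](gtr0_norm ut) -normrM mulrBl divfK ?gt_eqF//.
have mu_lt := ltr_pM2r ut (m t - e / 2) `|k n t|; rewrite mtn in mu_lt.
have := ler_normB (phi n u - phi n t) (phi n u - phi n t - k n t * (u - t)).
rewrite (_ : _ - (_ - _) = k n t * (u - t)); last by ring.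
have := ler_normD (m t * (u - t)) (M u - M t - m t * (u - t)).
rewrite (_ : _ + (_ - _) = M u - M t); last by ring.
rewrite !(normrM _ (u - t)) (ger0_norm (m0 t)) => h1 h2.
by rewrite mulrBl in mu_lt; rewrite ler_norml; apply/andP; split; lra.
Qed.

Theorem metric_derivative : exists m : R -> R,
  [/\ measurable_fun setT m, forall x, 0 <= m x,
      mu.-integrable setT (EFin \o m),
      forall s t, a <= s -> s <= t -> t <= b ->
        ((d (g s) (g t))%:E <= \int[mu]_(x in `[s, t]) (m x)%:E)%E &
      {ae mu, forall t, t \in `]a, b[ ->
        (fun u => d (g u) (g t) / `|u - t|) @ t^' --> m t}].
Proof.
have [ab|ba] := ltP a b; first exact: metric_derivative_lt.
exists (cst 0); split => //.
- exact: integrable0.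
- move=> s t as_ st tb; have -> : s = t by lra.
  by rewrite (dist_xx dM) integral_ge0.
- by apply: aeW => t; rewrite in_itv/= => /andP[]; lra.
Qed.

End MetricDerivative.

(** * Norms, null sets and metric speeds *)

Section NullSets.
Local Open Scope ereal_scope.
Context d (T : measurableType d) (R : realType).
Variable mu : {measure set T -> \bar R}.
Import HBNNSimple.

(** Without measurability the integral of a nonnegative function is the
    supremum of the integrals of the simple functions below it, and these can be
    set to zero on [N]. *)
Lemma ge0_integral_null_setD (D N : set T) (f : T -> \bar R) :
  measurable N -> mu N = 0 -> (forall x, 0 <= f x) ->
  \int[mu]_(x in D) f x = \int[mu]_(x in D `\` N) f x.
Proof.
move=> mN N0 f0; rewrite integral_mkcond [RHS]integral_mkcond.
have fD0 A x : 0 <= (f \_ A) x by rewrite patchE; case: ifP.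
rewrite !ge0_integralTE//; apply/eqP; rewrite eq_le; apply/andP; split.
  apply: ge_ereal_sup => _ [h /= hf <-].
  have mNC : measurable (~` N) by exact: measurableC.
  have -> : sintegral mu h = sintegral mu (proj_nnsfun h mNC).
    rewrite -!integralT_nnsfun; apply: ae_eq_integral => //.
    - exact/measurable_EFinP.
    - exact/measurable_EFinP.
    exists N; split => // x /= /not_implyP[_ hx]; apply: contrapT => Nx.
    by apply: hx; rewrite /= mindicE mem_set// mulr1.
  apply: ereal_sup_ubound; exists (proj_nnsfun h mNC) => // x /=.
  rewrite mindicE patchE; have [xN|xN] := boolP (x \in N).
    by rewrite in_setC xN/= mulr0; case: ifP.
  have := hf x; rewrite patchE in_setD xN andbT in_setC xN mulr1.
  exact.
apply: ge_ereal_sup => _ [h /= hf <-].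
apply: ereal_sup_ubound; exists h => // x; apply: le_trans (hf x) _.
by rewrite !patchE in_setD; case: ifPn => [/andP[-> _]//|_]; case: ifP.
Qed.

End NullSets.

Section Norm2.
Context {R : realType} {N : R * R -> R}.
Hypotheses (nN : is_norm2 N) (uN : unitary_norm N)
  (cN : coordinate_increasing N).
Implicit Types a b c x y : R.

Lemma norm2_0 : N (0, 0) = 0.
Proof. by case: nN => _ /(_ 0 0 0) + _; rewrite mulr0 normr0 mul0r. Qed.

Lemma norm2_ge0 v : 0 <= N v.
Proof.
case: v => a b; case: nN => _ h tri.
have := tri a b (- a) (- b); rewrite !subrr norm2_0.
by have := h (-1) a b; rewrite !mulN1r normrN1 mul1r => ->; lra.
Qed.

Lemma norm2_le_add a b : N (a, b) <= `|a| + `|b|.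
Proof.
case: nN => _ h tri; case: uN => u1 u2.
have := tri a 0 0 b; rewrite addr0 add0r.
have := h a 1 0; have := h b 0 1.
by rewrite !mulr0 !mulr1 u1 u2 !mulr1 => -> ->.
Qed.

Lemma norm2_lipschitz a b x y : N (a, b) <= N (x, y) + (`|a - x| + `|b - y|).
Proof.
case: nN => _ _ /(_ x y (a - x) (b - y)); rewrite !subrKC.
by move=> /le_trans; apply; rewrite lerD2l norm2_le_add.
Qed.

Lemma norm2_ge_fst a b : 0 <= a -> 0 <= b -> a <= N (a, b).
Proof.
move=> a0 b0; case: uN => u1 _; case: nN => _ /(_ a 1 0) + _.
rewrite mulr1 mulr0 u1 mulr1 (ger0_norm a0) => E.
by rewrite -[leLHS]E; apply: cN.
Qed.

Lemma norm2_ge_snd a b : 0 <= a -> 0 <= b -> b <= N (a, b).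
Proof.
move=> a0 b0; case: uN => _ u2; case: nN => _ /(_ b 0 1) + _.
rewrite mulr1 mulr0 u2 mulr1 (ger0_norm b0) => E.
by rewrite -[leLHS]E; apply: cN.
Qed.

(** The norm is the supremum of countably many functions that are sums of a
    function of each coordinate. *)
Lemma measurable_norm2 (u v : R -> R) :
  measurable_fun setT u -> measurable_fun setT v ->
  measurable_fun setT (fun t => N (u t, v t)).
Proof.
move=> mu_ mv.
pose p n : R * R := if unpickle n is Some q then (ratr (q : rat * rat).1, ratr q.2)
  else (0, 0).
pose h n t := N (p n) - (`|u t - (p n).1| + `|v t - (p n).2|).
have hN n t : h n t <= N (u t, v t).
  have := norm2_lipschitz (p n).1 (p n).2 (u t) (v t).
  by rewrite -surjective_pairing /h (distrC (u t)) (distrC (v t)) lerBlDr.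
have hub t : has_ubound (range (h ^~ t)) by exists (N (u t, v t)) => _ [n _ <-].
have -> : (fun t => N (u t, v t)) = fun t => sups (h ^~ t) 0.
  apply/funext => t; apply/le_anti/andP; split; last first.
    by apply: ge_sup => [|_ [n _ <-]//]; exists (h 0%N t); exists 0%N.
  apply/ler_addgt0Pr => e e0; have e40 : 0 < e / 4 by lra.
  have [q1 /[!in_itv]/= /andP[q1l q1r]] := rat_in_itvoo (ltr_pwDr e40 (lexx (u t))).
  have [q2 /[!in_itv]/= /andP[q2l q2r]] := rat_in_itvoo (ltr_pwDr e40 (lexx (v t))).
  pose n := pickle (q1, q2).
  have -> : sups (h^~ t) 0 = sup (range (h ^~ t)).
    by congr (sup _); apply/seteqP; split=> _ [k kT <-]; exists k.
  apply: (@le_trans _ _ (h n t + e)); last first.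
    by rewrite lerD2r; apply: ub_le_sup => //; exists n.
  rewrite /h /p pickleK/=.
  have := norm2_lipschitz (u t) (v t) (ratr q1) (ratr q2).
  by rewrite !ltr0_norm ?subr_lt0//; lra.
apply: measurable_fun_sups => // n.
apply: measurable_funB; first exact: measurable_cst.
by apply: measurable_funD; apply: measurableT_comp => //;
   apply: measurable_funB => //; exact: measurable_cst.
Qed.

End Norm2.

Section MetricSpeed.
Context {R : realType} {T : Type} {d : T -> T -> R}.
Implicit Types (g : R -> T) (t : R).

Lemma metric_speed_local g1 g2 a b t :
  t \in `]a, b[ -> (forall u, u \in `]a, b[ -> g1 u = g2 u) ->
  metric_speed d g1 t = metric_speed d g2 t.
Proof.
move=> tab g12; congr (lim _).
have near12 : \forall u \near t^',
    d (g1 u) (g1 t) / `|u - t| = d (g2 u) (g2 t) / `|u - t|.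
  near=> u; rewrite !g12//.
  by near: u; apply: nbhs_dnbhs; exact: near_in_itvoo.
apply/seteqP; split; apply: near_eq_cvg => //.
by apply: filterS near12 => u ->.
Unshelve. all: by end_near. Qed.

Lemma metric_speed_reflect g c t :
  metric_speed d (g \o (fun u => c - u)) t = metric_speed d g (c - t).
Proof.
congr (lim _); apply/seteqP; split => A /= [r /= r0 rA]; exists r => //= u.
- rewrite /ball_/= => ur ut; have := rA (c - u).
  rewrite /ball_/= subKr (_ : c - u - t = - (u - (c - t))) ?normrN; last by ring.
  apply; first by rewrite (_ : t - _ = - (c - t - u)) ?normrN//; ring.
  by apply: contra_neq ut => <-; ring.
- rewrite /ball_/= => ur ut; have := rA (c - u).
  rewrite /ball_/=.
  rewrite (_ : c - t - (c - u) = u - t); last by ring.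
  rewrite (_ : c - u - (c - t) = - (u - t)) ?normrN; last by ring.
  apply; first by rewrite distrC.
  by apply: contra_neq ut => /(congr1 (fun x => c - x)); rewrite !subKr.
Qed.

Lemma metric_speed_cvg g t l :
  (fun u => d (g u) (g t) / `|u - t|) @ t^' --> l -> metric_speed d g t = l.
Proof. by move=> gl; exact: cvg_lim. Qed.

End MetricSpeed.

(** * Reflecting and gluing integrands *)

Section Reflection.
Context {R : realType}.
Local Notation mu := (@lebesgue_measure R).
Implicit Types (a b c : R) (f w : R -> R).

Lemma measurable_reflect c : measurable_fun setT (fun t : R => c - t).
Proof. by apply: measurable_funB => //; exact: measurable_cst. Qed.

Lemma lebesgue_measure_reflect c (A : set R) : measurable A ->
  pushforward mu (fun t : measurableTypeR R => c - t : measurableTypeR R) A = mu A.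
Proof.
move=> mA; apply/esym/lebesgue_measure_unique => //=; first exact: measurable_reflect.
move=> _ _ [[x y]] _ <-; rewrite /pushforward.
have -> : (fun t : R => c - t) @^-1` `]x, y]%classic = `[c - y, c - x[%classic.
  by apply/seteqP; split=> t /=; rewrite !in_itv/= => /andP[? ?]; apply/andP; split; lra.
rewrite !lebesgue_measure_itv/= !lte_fin ltrD2l ltrN2.
by case: ifP => // _; congr (_%:E); lra.
Qed.

Lemma ge0_integral_reflect c a b (w : R -> \bar R) :
  measurable_fun setT w -> (forall t, (0 <= w t)%E) ->
  (\int[mu]_(t in `[(c - b)%R, (c - a)%R]) w (c - t)%R = \int[mu]_(t in `[a, b]) w t)%E.
Proof.
move=> mw w0.
pose phi (t : measurableTypeR R) : measurableTypeR R := c - t.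
have -> : `[(c - b), (c - a)]%classic = phi @^-1` `[a, b]%classic.
  by apply/seteqP; split=> t /=; rewrite /phi !in_itv/= => /andP[? ?];
    apply/andP; split; lra.
rewrite -[LHS](@ge0_integral_pushforward _ _ _ _ _ phi (measurable_reflect c) mu
  `[a, b]%classic w)//; last exact: measurable_funTS.
apply: eq_measure_integral; first exact: measurable_reflect.
by move=> ? A mA _; exact: lebesgue_measure_reflect.
Qed.

(** A measurable substitute for an integrand known only almost everywhere. *)
Definition ae_version a b f w : Prop :=
  [/\ measurable_fun setT w, forall t, 0 <= w t &
      {ae mu, forall t, t \in `]a, b[ -> f t = w t}].

Lemma ae_version_integral a b f w : (forall t, 0 <= f t) ->
  ae_version a b f w ->
  (\int[mu]_(t in `[a, b]) (f t)%:E = \int[mu]_(t in `[a, b]) (w t)%:E)%E.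
Proof.
move=> f0 [mw w0 [M [mM M0 subM]]].
have mE : measurable (M `|` [set a; b]).
  by apply: measurableU => //; apply: measurableU.
have E0 : mu (M `|` [set a; b]) = 0.
  have null0 A B : measurable A -> measurable B -> mu A = 0%E -> mu B = 0%E ->
      mu (A `|` B) = 0%E.
    move=> mA mB A0 B0; apply/eqP; rewrite -measure_le0.
    apply: (@le_trans _ _ (mu A + mu B)%E); first exact: measureU2.
    by rewrite A0 B0 adde0.
  apply: (null0 M [set a; b]) => //; first exact: measurableU.
  by apply: (null0 [set a] [set b]) => //; exact: lebesgue_measure_set1.
rewrite (ge0_integral_null_setD _ mE E0)// [RHS](ge0_integral_null_setD _ mE E0)//.
apply: eq_integral => t /[!inE] -[/= /[!in_itv]/= /andP[at_ tb]].
move=> /not_orP[Mt /not_orP[ta tb']].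
congr (_%:E); apply: contrapT => ftw; apply: Mt; apply: subM => /= H.
apply/ftw/H; rewrite in_itv/= !lt_neqAle at_ tb !andbT.
by apply/andP; split; apply/eqP => // /esym.
Qed.

Lemma ae_version_reflect c a b f w : ae_version a b f w ->
  ae_version (c - b) (c - a) (fun t => f (c - t)) (fun t => w (c - t)).
Proof.
move=> [mw w0 [M [mM M0 subM]]]; split => //.
  exact: (measurableT_comp mw (measurable_reflect c)).
exists ((fun t : R => c - t) @^-1` M); split.
- by rewrite -[X in measurable X]setTI; exact: measurable_reflect.
- by have := lebesgue_measure_reflect c mM; rewrite /pushforward M0.
- move=> t /= ft; apply: subM => /= H; apply: ft => tab; apply: H.
  by move: tab; rewrite !in_itv/= => /andP[? ?]; apply/andP; split; lra.
Qed.

Lemma ge0_integral_itv_split (w : R -> R) a b c : a <= b -> b <= c ->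
  measurable_fun setT w -> (forall t, 0 <= w t) ->
  (\int[mu]_(t in `[a, c]) (w t)%:E =
   \int[mu]_(t in `[a, b]) (w t)%:E + \int[mu]_(t in `[b, c]) (w t)%:E)%E.
Proof.
move=> ab bc mw w0.
have mwE (A : set R) : measurable_fun A (EFin \o w).
  exact/measurable_funTS/measurable_EFinP.
rewrite -[in RHS](@integral_itv_obnd_cbnd _ b); last exact: mwE.
rewrite -ge0_integral_setU//=; last 2 first.
- by move=> t _; rewrite lee_fin.
- apply/disj_setPS => t [] /=; rewrite !in_itv/= => /andP[_ tb] /andP[bt _].
  by rewrite ltNge tb in bt.
by rewrite -itv_bndbnd_setU// bnd_simp.
exact: mwE.
Qed.

Lemma ae_version_concat a b c f f1 f2 w1 w2 : a <= b -> b <= c ->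
  (forall t, 0 <= f t) ->
  (forall t, t \in `]a, b[ -> f t = f1 t) ->
  (forall t, t \in `]b, c[ -> f t = f2 t) ->
  ae_version a b f1 w1 -> ae_version b c f2 w2 ->
  (\int[mu]_(t in `[a, c]) (f t)%:E =
   \int[mu]_(t in `[a, b]) (w1 t)%:E + \int[mu]_(t in `[b, c]) (w2 t)%:E)%E.
Proof.
move=> ab bc f0 ff1 ff2 [mw1 w10 ae1] [mw2 w20 ae2].
have aeF := ae_filter_ringOfSetsType mu.
pose w t := if t < b then w1 t else w2 t.
have w_ge0 t : 0 <= w t by rewrite /w; case: ifP.
have mw : measurable_fun setT w.
  apply: measurable_fun_ifT => //.
  by apply: measurable_fun_ltr => //; exact: measurable_cst.
have ww1 t : t \in `]a, b[ -> w1 t = w t.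
  by rewrite in_itv/= /w => /andP[_ ->].
have ww2 t : t \in `]b, c[ -> w2 t = w t.
  by rewrite in_itv/= /w => /andP[/ltW bt _]; rewrite ltNge bt.
rewrite (@ae_version_integral a c f w)//; last first.
  split => //.
  have aeb : {ae mu, forall t, t != b}.
    exists [set b]; split => //; first exact: lebesgue_measure_set1.
    by move=> t /= /negP; rewrite negbK => /eqP.
  apply: filterS3 ae1 ae2 aeb => t t1 t2 tb; rewrite in_itv/= => /andP[at_ tc].
  have [tltb|blet] := ltP t b.
    have tab : t \in `]a, b[ by rewrite in_itv/= at_.
    by rewrite ff1// t1// ww1.
  have tbc : t \in `]b, c[ by rewrite in_itv/= tc lt_neqAle eq_sym tb blet.
  by rewrite ff2// t2// ww2.
rewrite (ge0_integral_itv_split ab bc mw w_ge0).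
congr (_ + _)%E; apply/esym/ae_version_integral => //.
- by split => //; apply: aeW.
- by split => //; apply: aeW.
Qed.

End Reflection.

(** * Warped lengths of absolutely continuous paths *)

Section WarpedPaths.
Context {R : realType} {N : R * R -> R}.
Hypotheses (nN : is_norm2 N) (uN : unitary_norm N)
  (cN : coordinate_increasing N).
Context {X Y : Type} {dX : X -> X -> R} {dY : Y -> Y -> R} {phi : X -> R}.
Hypotheses (dXM : is_metric dX) (dYM : is_metric dY).
Hypothesis phi0 : forall x, 0 <= phi x.
Hypothesis phiC : dist_continuous dX (fun u v : R => `|u - v|) phi.
Local Notation mu := (@lebesgue_measure R).
Local Notation dXY := (sum_dist dX dY).
Implicit Types (g : R -> X * Y) (a b c s t : R).

(** The integrand of [warped_length]. *)
Definition warped_speed g t : R :=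
  N (metric_speed dX (fst \o g) t, phi (g t).1 * metric_speed dY (snd \o g) t).

Lemma warped_speed_ge0 g t : 0 <= warped_speed g t.
Proof. exact: (norm2_ge0 nN). Qed.

Lemma sum_dist_metric : is_metric dXY.
Proof.
split=> [[x y] [x' y']|[x y] [x' y']|[x y] [x' y'] [x'' y'']]; rewrite /sum_dist/=.
- split=> [/eqP|[-> ->]]; last by rewrite (dist_xx dXM) (dist_xx dYM) addr0.
  rewrite paddr_eq0; [|exact: (dist_ge0 dXM)|exact: (dist_ge0 dYM)].
  case/andP=> /eqP xx' /eqP yy'.
  by case: dXM => /(_ x x')[/(_ xx') -> _]; case: dYM => /(_ y y')[/(_ yy') -> _].
- by rewrite (dist_sym dXM) (dist_sym dYM).
- by have := dist_tri dXM x x' x''; have := dist_tri dYM y y' y''; lra.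
Qed.

Lemma control_fst a b g V : path_control (d := dXY) a b g V ->
  path_control (d := dX) a b (fst \o g) V.
Proof.
case=> ab acV gV; split => // s t as_ st tb.
apply: le_trans (gV s t as_ st tb); rewrite /sum_dist lerDl.
exact: (dist_ge0 dYM).
Qed.

Lemma control_snd a b g V : path_control (d := dXY) a b g V ->
  path_control (d := dY) a b (snd \o g) V.
Proof.
case=> ab acV gV; split => // s t as_ st tb.
apply: le_trans (gV s t as_ st tb); rewrite /sum_dist lerDr.
exact: (dist_ge0 dXM).
Qed.

Lemma continuous_along a b (x : R -> X) V : path_control (d := dX) a b x V ->
  continuous (fun t => phi (x (clip a b t))).
Proof.
move=> gV t; have [ab _ _] := gV; apply/cvgrPdist_lt => e e0.
have [r r0 Hr] := phiC (x (clip a b t)) e0.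
have [r' r'0 Hr'] := control_cvg dXM gV (clip_in t ab) r0.
near=> u; rewrite distrC; apply: Hr; apply: Hr'; first exact: clip_in.
have : `|u - t| < r' by rewrite distrC; near: u; exact: cvgr_dist_lt.
rewrite !ltr_norml => /andP[? ?].
have [tu|/ltW ut] := leP t u.
  by have := clip_contract a b tu; have := clip_le a b tu; lra.
by have := clip_contract a b ut; have := clip_le a b ut; lra.
Unshelve. all: by end_near. Qed.

(** Passes a Lipschitz bound to the metric speed. *)
Lemma limit_quotient_le {T : Type} {d : T -> T -> R} (h : R -> T) a b t l A :
  t \in `]a, b[ ->
  (fun u => d (h u) (h t) / `|u - t|) @ t^' --> l ->
  (forall u, u \in `[a, b] -> d (h u) (h t) <= A * `|u - t|) -> l <= A.
Proof.
move=> tab hl hA.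
have lE : lim ((fun u => d (h u) (h t) / `|u - t|) @ t^') = l by exact: cvg_lim.
rewrite -lE; apply: limr_le; first by apply/cvg_ex; exists l.
near=> u.
have ut : 0 < `|u - t|.
  by rewrite normr_gt0 subr_eq0; near: u; exact: nbhs_dnbhs_neq.
rewrite ler_pdivrMr//; apply: hA.
apply: subset_itv_oo_cc; near: u; apply: nbhs_dnbhs; exact: near_in_itvoo.
Unshelve. all: by end_near. Qed.

(** The part of an absolutely continuous path that matters for its warped
    length: a density [w] of that length, which dominates the increments of
    both coordinates. The last clause bounds the length of explicit paths. *)
Lemma warped_density a b g : ac_path dXY a b g -> exists w : R -> R,
  [/\ ae_version a b (warped_speed g) w, mu.-integrable setT (EFin \o w),
      forall s t, a <= s -> s <= t -> t <= b ->
        ((dX (g s).1 (g t).1)%:E <= \int[mu]_(u in `[s, t]) (w u)%:E)%E,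
      forall s t k, a <= s -> s <= t -> t <= b -> 0 <= k ->
        (forall u, s <= u -> u <= t -> k <= phi (g u).1) ->
        ((k * dY (g s).2 (g t).2)%:E <= \int[mu]_(u in `[s, t]) (w u)%:E)%E &
      forall A B P, 0 <= A -> 0 <= B ->
        (forall u v, u \in `[a, b] -> v \in `[a, b] ->
           dX (g u).1 (g v).1 <= A * `|u - v|) ->
        (forall u v, u \in `[a, b] -> v \in `[a, b] ->
           dY (g u).2 (g v).2 <= B * `|u - v|) ->
        (forall u, u \in `[a, b] -> phi (g u).1 <= P) ->
        {ae mu, forall t, t \in `]a, b[ -> w t <= A + P * B}].
Proof.
move=> /(ac_path_control sum_dist_metric); set V := (fun t : R => _) => gV.
have gXV := control_fst gV; have gYV := control_snd gV.
have [ab _ _] := gV.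
have [mX [mmX mX0 intX dXle aeX]] := metric_derivative dXM gXV.
have [mY [mmY mY0 intY dYle aeY]] := metric_derivative dYM gYV.
have phic := continuous_along gXV.
pose f t := phi (g (clip a b t)).1.
have mf : measurable_fun setT f by exact: continuous_measurable_fun.
have f0 t : 0 <= f t by exact: phi0.
pose w t := N (mX t, f t * mY t).
have mw : measurable_fun setT w.
  by apply: (measurable_norm2 nN uN) => //; exact: measurable_funM.
have w0 t : 0 <= w t by exact: (norm2_ge0 nN).
have aeF := ae_filter_ringOfSetsType mu.
have [M fM] : exists M, forall t, f t <= M.
  have [c cab fc] := @EVT_max R f a b ab (continuous_subspaceT phic).
  exists (f c) => t; rewrite /f -(clip_id (clip_in t ab)); exact: fc (clip_in t ab).
exists w; split.
- split => //; apply: filterS2 aeX aeY => t tX tY tab.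
  rewrite /warped_speed (metric_speed_cvg (tX tab)) (metric_speed_cvg (tY tab)).
  by rewrite /w /f clip_id//; exact: subset_itv_oo_cc.
- have int2 : mu.-integrable setT (EFin \o (fun t => mX t + M * mY t)).
    rewrite (_ : _ \o _ = (EFin \o mX) \+ (fun t => M%:E * (EFin \o mY) t))%E//.
    by apply: integrableD => //; exact: integrableZl.
  apply: le_integrable int2 => //; first exact/measurable_EFinP.
  move=> t _ /=; rewrite lee_fin !ger0_norm//; last first.
    by rewrite addr_ge0// mulr_ge0// (le_trans (f0 t)).
  apply: le_trans (norm2_le_add nN uN _ _) _.
  by rewrite (ger0_norm (mX0 t)) ger0_norm ?mulr_ge0// lerD2l ler_wpM2r.
- move=> s t as_ st tb; apply: le_trans (dXle _ _ as_ st tb) _.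
  apply: ge0_le_integral => //.
  - by move=> u _; rewrite lee_fin.
  - exact/measurable_funTS/measurable_EFinP.
  - exact/measurable_funTS/measurable_EFinP.
  - by move=> u _; rewrite lee_fin (norm2_ge_fst nN uN cN)// mulr_ge0.
- move=> s t k as_ st tb k0 kphi.
  apply: (@le_trans _ _ (\int[mu]_(u in `[s, t]) (k * mY u)%:E)%E).
    under eq_integral do rewrite EFinM.
    rewrite ge0_integralZl_EFin//.
    - by rewrite EFinM; apply: lee_wpmul2l => //; exact: dYle.
    - by move=> u _; rewrite lee_fin.
    - exact/measurable_funTS/measurable_EFinP.
  apply: ge0_le_integral => //.
  - by move=> u _; rewrite lee_fin mulr_ge0.
  - by apply/measurable_funTS/measurable_EFinP; exact: measurable_funM.
  - exact/measurable_funTS/measurable_EFinP.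
  - move=> u; rewrite /= in_itv/= => /andP[su ut].
    rewrite lee_fin; apply: le_trans (norm2_ge_snd nN uN cN _ _) => //; last first.
      by rewrite mulr_ge0.
    rewrite ler_wpM2r// /f clip_id ?kphi//.
    by rewrite in_itv/= (le_trans as_)//= (le_trans ut).
- move=> A B P A0 B0 gA gB gP.
  apply: filterS2 aeX aeY => t tX tY tab.
  have tabc : t \in `[a, b] by exact: subset_itv_oo_cc.
  have lX : mX t <= A.
    by apply: (limit_quotient_le tab (tX tab)) => u uab; exact: gA.
  have lY : mY t <= B.
    by apply: (limit_quotient_le tab (tY tab)) => u uab; exact: gB.
  apply: le_trans (norm2_le_add nN uN _ _) _.
  rewrite (ger0_norm (mX0 t)) ger0_norm ?mulr_ge0// lerD//.
  by apply: ler_pM => //; rewrite /f clip_id//; exact: gP.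
Qed.

End WarpedPaths.

(** * Reflecting and gluing paths *)

Section Transforming.
Context {R : realType}.
Implicit Types (a b c k : R) (V : R -> R).

Lemma ac_on_reflect a b k V : absolutely_continuous_on a b V ->
  absolutely_continuous_on (k - b) (k - a) (fun t => - V (k - t)).
Proof.
move=> acV e e0; have [r r0 Hr] := acV e e0; exists r => // n s t st ts sr.
rewrite (reindex_inj rev_ord_inj)/=.
rewrite (eq_bigr (fun i => `|V (k - s (rev_ord i)) - V (k - t (rev_ord i))|)); last first.
  by move=> i _; congr `|_|; ring.
apply: (Hr n (fun i => k - t (rev_ord i)) (fun i => k - s (rev_ord i))).
- by move=> i; have [? ? ?] := st (rev_ord i); split; lra.
- move=> i j ij; have rji : (rev_ord j < rev_ord i)%N.
    by have := ltn_ord j; rewrite /=; lia.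
  by have := ts _ _ rji; lra.
move: sr; rewrite (reindex_inj rev_ord_inj)/=; apply: le_lt_trans.
by apply: ler_sum => i _; lra.
Qed.

(** An interval that contains [b] is cut there: truncating the endpoints at [b] on
    either side gives admissible families for [V1] and [V2]. *)
Lemma ac_on_glue a b c V1 V2 : a <= b -> b <= c ->
  absolutely_continuous_on a b V1 -> absolutely_continuous_on b c V2 ->
  absolutely_continuous_on a c (fun t => V1 (Num.min t b) + V2 (Num.max t b)).
Proof.
move=> ab bc ac1 ac2 e e0; have e20 : 0 < e / 2 by lra.
have [r1 r10 Hr1] := ac1 _ e20; have [r2 r20 Hr2] := ac2 _ e20.
exists (Num.min r1 r2) => [|n s t st ts]; first by rewrite lt_min r10.
rewrite lt_min => /andP[sr1 sr2].
have := Hr1 n (fun i => Num.min (s i) b) (fun i => Num.min (t i) b).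
have := Hr2 n (fun i => Num.max (s i) b) (fun i => Num.max (t i) b).
move=> H2 H1.
have {}H2 : \sum_(i < n) `|V2 (Num.max (t i) b) - V2 (Num.max (s i) b)| < e / 2.
  apply: H2.
  - move=> i; have [? ? ?] := st i; split.
    + by rewrite le_max lexx orbT.
    + by rewrite /Num.max; do !case: ifPn; rewrite -?leNgt => *; lra.
    + by rewrite ge_max; apply/andP.
  - move=> i j /ts tis.
    by rewrite /Num.max; do !case: ifPn; rewrite -?leNgt => *; lra.
  - apply: le_lt_trans sr2; apply: ler_sum => i _; have [_ sti _] := st i.
    by rewrite /Num.max; do !case: ifPn; rewrite -?leNgt => *; lra.
have {}H1 : \sum_(i < n) `|V1 (Num.min (t i) b) - V1 (Num.min (s i) b)| < e / 2.
  apply: H1.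
  - move=> i; have [? ? ?] := st i; split.
    + by rewrite le_min; apply/andP.
    + by rewrite /Num.min; do !case: ifPn; rewrite -?leNgt => *; lra.
    + by rewrite ge_min lexx orbT.
  - move=> i j /ts tis.
    by rewrite /Num.min; do !case: ifPn; rewrite -?leNgt => *; lra.
  - apply: le_lt_trans sr1; apply: ler_sum => i _; have [_ sti _] := st i.
    by rewrite /Num.min; do !case: ifPn; rewrite -?leNgt => *; lra.
apply: (@le_lt_trans _ _ (\sum_(i < n) (`|V1 (Num.min (t i) b) - V1 (Num.min (s i) b)|
  + `|V2 (Num.max (t i) b) - V2 (Num.max (s i) b)|))).
  apply: ler_sum => i _; apply: le_trans (ler_normD _ _).
  by rewrite opprD addrACA.
by rewrite big_split/=; lra.
Qed.

Context {T : Type} {d : T -> T -> R}.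
Hypothesis dM : is_metric d.
Implicit Types g : R -> T.

Lemma ac_path_reflect a b k g : ac_path d a b g ->
  ac_path d (k - b) (k - a) (fun t => g (k - t)).
Proof.
move=> /(ac_path_control dM)[ab acV gV].
apply: (control_ac_path dM (V := fun t => - fine (path_length d a (k - t) g))).
split; [by lra|exact: (ac_on_reflect k acV)|move=> s t ks st tk].
rewrite (dist_sym dM); have := gV (k - t) (k - s); lra.
Qed.

Lemma ac_path_concat a b c g1 g2 : ac_path d a b g1 -> ac_path d b c g2 ->
  g1 b = g2 b -> ac_path d a c (fun t => if t <= b then g1 t else g2 t).
Proof.
move=> /(ac_path_control dM)[ab ac1 gV1] /(ac_path_control dM)[bc ac2 gV2] g12.
pose V1 t := fine (path_length d a t g1).
pose V2 t := fine (path_length d b t g2).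
have {}gV1 s t : a <= s -> s <= t -> t <= b -> d (g1 s) (g1 t) <= V1 t - V1 s.
  exact: gV1.
have {}gV2 s t : b <= s -> s <= t -> t <= c -> d (g2 s) (g2 t) <= V2 t - V2 s.
  exact: gV2.
apply: (control_ac_path dM (V := fun t => V1 (Num.min t b) + V2 (Num.max t b))).
split; [exact: le_trans bc|exact: ac_on_glue|move=> s t as_ st tc].
case: (leP t b) => [tb|/ltW bt].
  have sb := le_trans st tb; rewrite sb (min_l sb) (max_r sb).
  by have := gV1 s t as_ st tb; lra.
case: (leP s b) => [sb|/ltW bs].
  apply: le_trans (dist_tri dM _ (g1 b) _) _.
  have := gV1 s b as_ sb (lexx b); have := gV2 b t (lexx b) bt tc.
  by rewrite -g12; lra.
by have := gV2 s t bs st tc; lra.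
Qed.

Lemma ac_path_cst a z : ac_path d a a (fun=> z).
Proof.
apply: (control_ac_path dM (V := cst 0)); split => // [e e0|s t _ _ _].
  by exists 1 => // n s t _ _ _; rewrite big1// => i _; rewrite subrr normr0.
by rewrite (dist_xx dM) subrr.
Qed.

End Transforming.

(** * The warped pseudodistance *)

Section WarpedDistance.
Context {R : realType} {N : R * R -> R}.
Hypotheses (nN : is_norm2 N) (uN : unitary_norm N)
  (cN : coordinate_increasing N).
Context {X Y : Type} {dX : X -> X -> R} {dY : Y -> Y -> R} {phi : X -> R}.
Hypotheses (dXM : is_metric dX) (dYM : is_metric dY).
Hypothesis phi0 : forall x, 0 <= phi x.
Hypothesis phiC : dist_continuous dX (fun u v : R => `|u - v|) phi.
Local Notation mu := (@lebesgue_measure R).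
Local Notation dXY := (sum_dist dX dY).
Local Notation wlen := (warped_length N dX dY phi).
Implicit Types (p q r : X * Y).

Definition warped_lengths p q : set (\bar R) :=
  [set l | exists a b g, [/\ ac_path dXY a b g, g a = p, g b = q &
    l = wlen a b g]].

Let speed0 g t : 0 <= warped_speed (N := N) (dX := dX) (dY := dY) (phi := phi) g t :=
  warped_speed_ge0 nN g t.

Lemma warped_lengths_fin p q l : warped_lengths p q l ->
  exists2 x : R, 0 <= x & l = x%:E.
Proof.
move=> [a [b [g [/(warped_density nN uN cN dXM dYM phi0 phiC) + _ _ ->]]]].
move=> [w [wv wint _ _ _]].
rewrite /warped_length -/(warped_speed g) (ae_version_integral (speed0 g) wv).
have [_ w0 _] := wv.
exists (fine (\int[mu]_(t in `[a, b]) (w t)%:E)%E).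
  by rewrite fine_ge0// integral_ge0// => t _; rewrite lee_fin.
rewrite fineK//; apply: integrable_fin_num => //.
by apply: integrableS wint.
Qed.

Lemma warped_length_reflect a b k g : ac_path dXY a b g ->
  wlen (k - b) (k - a) (fun t => g (k - t)) = wlen a b g.
Proof.
move=> /(warped_density nN uN cN dXM dYM phi0 phiC) [w [wv _ _ _ _]].
rewrite /warped_length -/(warped_speed g) (ae_version_integral (speed0 g) wv).
have [mw w0 _] := wv.
have wE0 t : (0 <= (EFin \o w) t)%E by rewrite lee_fin.
have mwE : measurable_fun setT (EFin \o w) by exact/measurable_EFinP.
rewrite -(ge0_integral_reflect k a b mwE wE0).
have kg0 t : 0 <= warped_speed (N := N) (dX := dX) (dY := dY) (phi := phi) g (k - t).
  exact: speed0.
have kv := ae_version_reflect k wv.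
transitivity (\int[mu]_(t in `[(k - b)%R, (k - a)%R]) (warped_speed
    (N := N) (dX := dX) (dY := dY) (phi := phi) g (k - t)%R)%:E)%E; last first.
  exact: (ae_version_integral kg0 kv).
apply: eq_integral => t _; rewrite /warped_speed -!metric_speed_reflect.
by [].
Qed.

Lemma warped_lengths_refl p : warped_lengths p p 0%E.
Proof.
exists 0, 0, (fun=> p); split => //; first exact: (ac_path_cst (sum_dist_metric dXM dYM)).
by rewrite /warped_length set_itv1 integral_set1.
Qed.

Lemma warped_lengths_sym p q l : warped_lengths p q l -> warped_lengths q p l.
Proof.
move=> [a [b [g [acg ga gb ->]]]].
exists (0 - b), (0 - a), (fun t => g (0 - t)); split.
- exact: (ac_path_reflect (sum_dist_metric dXM dYM)).
- by rewrite subKr.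
- by rewrite subKr.
- by rewrite warped_length_reflect.
Qed.

(** The second path has to start when the first one ends. A translation of the
    parameter is a composition of two reflections, so reverse the second path and
    then reflect it back to the right place. *)
Lemma warped_lengths_add p q r l1 l2 : warped_lengths p q l1 ->
  warped_lengths q r l2 -> warped_lengths p r (l1 + l2)%E.
Proof.
move=> [a [b [g1 [ac1 g1a g1b ->]]]] /warped_lengths_sym[c [e [g [acg gc ge ->]]]].
pose k := b + e.
pose g2 t := g (k - t).
pose c' := k - c.
have kb : k - e = b by rewrite /k addrK.
have ac2 : ac_path dXY b c' g2.
  by rewrite -kb; exact: (ac_path_reflect (sum_dist_metric dXM dYM)).
have g12 : g1 b = g2 b by rewrite g1b /g2 /k addrAC subrr add0r ge.
exists a, c', (fun t => if t <= b then g1 t else g2 t); split.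
- exact: (ac_path_concat (sum_dist_metric dXM dYM)).
- by have [[[-> _] _] _] := ac1.
- have [[[bc' _] _] _] := ac2.
  have [c'b|_] := leP c' b; last by rewrite /g2 subKr.
  have -> : c' = b by apply/le_anti/andP.
  by rewrite g12 (_ : b = c') /g2 ?subKr//; apply/le_anti/andP.
rewrite -(warped_length_reflect k acg) kb -/c' -/g2.
have [w1 [w1v _ _ _ _]] := warped_density nN uN cN dXM dYM phi0 phiC ac1.
have [w2 [w2v _ _ _ _]] := warped_density nN uN cN dXM dYM phi0 phiC ac2.
rewrite {1 2}/warped_length -/(warped_speed g1) -/(warped_speed g2).
rewrite (ae_version_integral (speed0 g1) w1v) (ae_version_integral (speed0 g2) w2v).
have [[[ab _] _] _] := ac1; have [[[bc' _] _] _] := ac2.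
apply/esym; rewrite /warped_length.
apply: (ae_version_concat ab bc' _ _ _ w1v w2v).
- exact: speed0.
- move=> t tab; rewrite /warped_speed; congr (N (_, _ * _)).
  + apply: metric_speed_local tab _ => u /=.
    by rewrite in_itv/= => /andP[_ /ltW ->].
  + by move: tab; rewrite in_itv/= => /andP[_ /ltW ->].
  + apply: metric_speed_local tab _ => u /=.
    by rewrite in_itv/= => /andP[_ /ltW ->].
- move=> t tab; rewrite /warped_speed; congr (N (_, _ * _)).
  + apply: metric_speed_local tab _ => u /=.
    by rewrite in_itv/= => /andP[bu _]; rewrite leNgt bu.
  + by move: tab; rewrite in_itv/= => /andP[bu _]; rewrite leNgt bu.
  + apply: metric_speed_local tab _ => u /=.
    by rewrite in_itv/= => /andP[bu _]; rewrite leNgt bu.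
Qed.

Lemma warped_lengths_lipschitz a b g A B P : a <= b -> 0 <= A -> 0 <= B ->
  (forall u v, u \in `[a, b] -> v \in `[a, b] ->
     dX (g u).1 (g v).1 <= A * `|u - v|) ->
  (forall u v, u \in `[a, b] -> v \in `[a, b] ->
     dY (g u).2 (g v).2 <= B * `|u - v|) ->
  (forall u, u \in `[a, b] -> phi (g u).1 <= P) ->
  exists2 l, warped_lengths (g a) (g b) l & (l <= ((A + P * B) * (b - a))%:E)%E.
Proof.
move=> ab A0 B0 gA gB gP.
have acg : ac_path dXY a b g.
  apply: (control_ac_path (sum_dist_metric dXM dYM) (V := fun t => (A + B) * t)).
  split => //.
    move=> e e0; exists (e / (A + B + 1)); first by rewrite divr_gt0//; lra.
    move=> n s t st _; rewrite ltr_pdivlMr; last lra.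
    apply: le_lt_trans; rewrite mulrC mulr_sumr; apply: ler_sum => i _.
    have [_ sti _] := st i; rewrite -mulrBr normrM !ger0_norm ?subr_ge0//; last lra.
    by apply: ler_wpM2r; lra.
  move=> s t as_ st tb; rewrite /sum_dist -mulrBr mulrDl.
  have sab : s \in `[a, b] by rewrite in_itv/= as_ (le_trans st).
  have tab : t \in `[a, b] by rewrite in_itv/= tb (le_trans as_).
  have := gA _ _ sab tab; have := gB _ _ sab tab.
  by rewrite distrC ger0_norm ?subr_ge0//; lra.
exists (wlen a b g); first by exists a, b, g.
have [w [wv _ _ _ wAB]] := warped_density nN uN cN dXM dYM phi0 phiC acg.
have {}wAB := wAB A B P A0 B0 gA gB gP.
rewrite /warped_length -/(warped_speed g) (ae_version_integral (speed0 g) wv).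
have [mw w0 _] := wv.
have P0 : 0 <= P.
  by apply: le_trans (gP a _) => //; rewrite in_itv/= lexx.
have openE (q : R -> R) : measurable_fun setT q ->
    (\int[mu]_(x in `[a, b]) (q x)%:E = \int[mu]_(x in `]a, b[) (q x)%:E)%E.
  by move=> mq; apply: integral_itv_bndoo; exact/measurable_funTS/measurable_EFinP.
rewrite openE//.
apply: (@le_trans _ _ (\int[mu]_(x in `]a, b[) (A + P * B)%:E)%E).
  apply: ae_ge0_le_integral => //.
  - by move=> x _; rewrite lee_fin.
  - exact/measurable_funTS/measurable_EFinP.
  - by move=> x _; rewrite lee_fin addr_ge0// mulr_ge0.
apply: (@le_trans _ _ ((A + P * B)%:E * mu `]a, b[%classic)%E).
  by rewrite integral_cst.
rewrite lebesgue_measure_itv/= lte_fin.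
case: ifP => // _; rewrite mule0 lee_fin mulr_ge0// ?subr_ge0//.
by rewrite addr_ge0// mulr_ge0.
Qed.

Hypothesis conn : forall p q, exists l, warped_lengths p q l.
Local Notation wd := (warped_pseudodist N dX dY phi).

Lemma warped_dist_inf p q : (wd p q)%:E = ereal_inf (warped_lengths p q).
Proof.
rewrite /warped_pseudodist fineK//.
have [l lpq] := conn p q; have [x x0 lx] := warped_lengths_fin lpq.
rewrite ge0_fin_numE.
  by apply: le_lt_trans (ereal_inf_lbound lpq) _; rewrite lx ltry.
apply: le_ereal_inf_tmp => y /warped_lengths_fin[z z0 ->].
by rewrite lee_fin.
Qed.

Lemma warped_dist_le p q l : warped_lengths p q l -> ((wd p q)%:E <= l)%E.
Proof. by rewrite warped_dist_inf => lpq; exact: ereal_inf_lbound. Qed.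

Lemma warped_dist_lub p q c :
  (forall x, warped_lengths p q x%:E -> c <= x) -> c <= wd p q.
Proof.
move=> H; rewrite -lee_fin warped_dist_inf; apply: le_ereal_inf_tmp => l lpq.
have [x x0 lx] := warped_lengths_fin lpq.
by rewrite lx lee_fin; apply: H; rewrite -lx.
Qed.

Lemma warped_dist_ge0 p q : 0 <= wd p q.
Proof. by apply: warped_dist_lub => x /warped_lengths_fin[y y0 [->]]. Qed.

Lemma warped_dist_xx p : wd p p = 0.
Proof.
apply/le_anti; rewrite warped_dist_ge0 andbT -lee_fin.
exact/warped_dist_le/warped_lengths_refl.
Qed.

Lemma warped_dist_sym p q : wd p q = wd q p.
Proof.
suff H x y : wd x y <= wd y x by apply/le_anti; rewrite !H.
apply: warped_dist_lub => z /warped_lengths_sym zl.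
by rewrite -lee_fin; exact: warped_dist_le.
Qed.

Lemma warped_dist_tri p q r : wd p r <= wd p q + wd q r.
Proof.
rewrite -lerBlDr; apply: warped_dist_lub => x xl.
rewrite lerBlDr -lerBlDl; apply: warped_dist_lub => y yl.
rewrite lerBlDl -lee_fin EFinD.
exact/warped_dist_le/(warped_lengths_add xl).
Qed.

End WarpedDistance.

(** * Lipschitz paths in length spaces *)

Section LipschitzPaths.
Context {R : realType} {T : Type} {d : T -> T -> R}.
Hypothesis dM : is_metric d.

Lemma path_length_xx (a : R) g : path_length d a a g = 0%E.
Proof.
apply/eqP; rewrite eq_le path_length_ge0// andbT.
apply: ge_ereal_sup => _ [p /itv_partitionxx -> <-].
by rewrite dist_variation_nil.
Qed.

(** Send [x] to the supremum of the parameters where the length travelled is at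
    most [x]. Between the parameters chosen for [x] and for [y] the length
    travelled is at most [y - x], once they are moved together a little, which
    continuity of the path allows. *)
Lemma rectifiable_arclength (a b : R) (g : R -> T) : rectifiable d a b g ->
  exists s : R -> T, [/\ s 0 = g a, s (fine (path_length d a b g)) = g b &
    forall x y, x \in `[0, fine (path_length d a b g)] ->
      y \in `[0, fine (path_length d a b g)] -> d (s x) (s y) <= `|x - y|].
Proof.
move=> [[ab gc] gfin].
have vV := rectifiable_length_control dM gfin.
pose v t := fine (path_length d a t g).
have {}vV s t : a <= s -> s <= t -> t <= b -> d (g s) (g t) <= v t - v s := vV s t.
have va : v a = 0 by rewrite /v path_length_xx.
have vle s t : a <= s -> s <= t -> t <= b -> v s <= v t.
  move=> as_ st tb; have := vV _ _ as_ st tb; have := dist_ge0 dM (g s) (g t); lra.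
pose E x := [set t | a <= t <= b /\ v t <= x].
pose h x := sup (E x).
have Ea x : 0 <= x -> E x a by move=> x0; split; rewrite ?lexx ?va.
have Eub x : has_ubound (E x) by exists b => t [/andP[_]].
have hsupE x : 0 <= x -> has_sup (E x).
  by move=> x0; split => //; exists a; exact: Ea.
have ha x : 0 <= x -> a <= h x by move=> x0; apply: ub_le_sup => //; exact: Ea.
have hb x : 0 <= x -> h x <= b.
  by move=> x0; apply: ge_sup; [exists a; exact: Ea|move=> t [/andP[_]]].
have hab x : 0 <= x -> h x \in `[a, b] by move=> x0; rewrite in_itv/= ha// hb.
have vgt x u : 0 <= x -> h x < u -> u <= b -> x < v u.
  move=> x0 hu ub; rewrite ltNge; apply/negP => vux.
  have := hu; rewrite ltNge => /negP; apply; apply: ub_le_sup => //.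
  by split => //; rewrite ub andbT (le_trans (ha x x0))// ltW.
have vle_h x u : 0 <= x -> a <= u -> u < h x -> v u <= x.
  move=> x0 au uh.
  have [z [/andP[az zb] vz] uz] := sup_gt (proj1 (hsupE x x0)) uh.
  by apply: le_trans vz; apply: vle => //; exact: ltW.
have near_pt t e : t \in `[a, b] -> 0 < e -> exists2 r : R, 0 < r &
    forall u, u \in `[a, b] -> `|u - t| < r -> d (g u) (g t) < e.
  exact: gc.
have lip x y : 0 <= x -> x <= y -> d (g (h x)) (g (h y)) <= y - x.
  move=> x0 xy; have y0 := le_trans x0 xy.
  have hxy : h x <= h y.
    apply: ge_sup; first by exists a; exact: Ea.
    move=> t [tab vt]; apply: ub_le_sup => //; split => //; exact: le_trans xy.
  move: hxy; rewrite le_eqVlt => /orP[/eqP ->|hxy].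
    by rewrite (dist_xx dM) subr_ge0.
  apply/ler_addgt0Pr => e e0; have e20 : 0 < e / 2 by lra.
  have [r r0 Hr] := near_pt _ _ (hab x x0) e20.
  have [r' r'0 Hr'] := near_pt _ _ (hab y y0) e20.
  pose k := Num.min (Num.min r r') (h y - h x).
  have k0 : 0 < k by rewrite /k !lt_min r0 r'0 subr_gt0.
  have [kr [kr' kh]] : k <= r /\ k <= r' /\ k <= h y - h x.
    by rewrite /k !ge_min !lexx !orbT.
  have hax := ha x x0; have hby := hb y y0.
  pose u := h x + k / 3; pose u' := h y - k / 3.
  have uab : u \in `[a, b] by rewrite in_itv/= /u; apply/andP; split; lra.
  have u'ab : u' \in `[a, b] by rewrite in_itv/= /u'; apply/andP; split; lra.
  have ur : d (g u) (g (h x)) < e / 2.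
    by apply: Hr => //; rewrite /u addrAC subrr add0r ger0_norm; lra.
  have u'r : d (g u') (g (h y)) < e / 2.
    by apply: Hr' => //; rewrite /u' addrAC subrr add0r normrN ger0_norm; lra.
  have au : a <= u by rewrite /u; lra.
  have uu' : u <= u' by rewrite /u /u'; lra.
  have u'b : u' <= b by rewrite /u'; lra.
  have := vV u u' au uu' u'b.
  have : x < v u by apply: vgt => //; [rewrite /u; lra|exact: le_trans u'b].
  have : v u' <= y by apply: vle_h => //; [exact: le_trans uu'|rewrite /u'; lra].
  have := dist_tri dM (g (h x)) (g u) (g (h y)).
  have := dist_tri dM (g u) (g u') (g (h y)).
  rewrite (dist_sym dM (g (h x)) (g u)); lra.
have K0 : 0 <= v b by rewrite -va; exact: vle.
exists (g \o h); split => /=.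
- apply/esym; case: dM => /(_ (g a) (g (h 0)))[+ _] _ _; apply.
  apply/le_anti; rewrite (dist_ge0 dM) andbT.
  have ah0 : a <= h 0 by exact: ha.
  have [ha0|/eqP ah] := eqVneq (h 0) a; first by rewrite ha0 (dist_xx dM).
  have {ah} ah : a < h 0 by rewrite lt_neqAle ah0 andbT; apply/eqP/nesym.
  apply/ler_addgt0Pr => e e0; rewrite add0r.
  have [r r0 Hr] := near_pt _ _ (hab 0 (lexx 0)) e0.
  pose k := Num.min r (h 0 - a).
  have k0 : 0 < k by rewrite /k lt_min r0 subr_gt0.
  have [kr kh] : k <= r /\ k <= h 0 - a by rewrite /k !ge_min !lexx !orbT.
  pose u := h 0 - k / 2.
  have au : a <= u by rewrite /u; lra.
  have ub : u <= b by have := hb 0 (lexx 0); rewrite /u; lra.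
  have ur : d (g u) (g (h 0)) < e.
    apply: Hr; first by rewrite in_itv/= au.
    by rewrite /u addrAC subrr add0r normrN ger0_norm; lra.
  have := vV a u (lexx a) au ub; rewrite va.
  have : v u <= 0 by apply: vle_h => //; rewrite /u; lra.
  have := dist_tri dM (g a) (g u) (g (h 0)); lra.
- rewrite -/(v b); congr g; apply/le_anti; rewrite hb//=.
  by apply: ub_le_sup => //; split; rewrite ?ab ?lexx.
- move=> x y; rewrite !in_itv/= => /andP[x0 _] /andP[y0 _].
  have [xy|/ltW yx] := leP x y; first by rewrite distrC ger0_norm ?subr_ge0// lip.
  by rewrite (dist_sym dM) ger0_norm ?subr_ge0// lip.
Qed.

Lemma length_space_lipschitz (x y : T) (e : R) : length_space d -> 0 < e ->
  exists (K : R) (s : R -> T), [/\ 0 <= K, K <= d x y + e, s 0 = x, s K = y &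
    forall u v, u \in `[0, K] -> v \in `[0, K] -> d (s u) (s v) <= `|u - v|].
Proof.
move=> /(_ x y)[_ dE] e0.
have : ((d x y)%:E < (d x y + e)%:E)%E by rewrite lte_fin; lra.
rewrite {1}dE => /ereal_inf_lt[_ [a [b [g [gr ga gb ->]]]] gl].
have [s [s0 sK slip]] := rectifiable_arclength gr.
have [[ab _] gfin] := gr.
have fing := rectifiable_length_fin dM gfin ab (lexx b).
exists (fine (path_length d a b g)), s; split => //.
- by rewrite fine_ge0// path_length_ge0.
- by rewrite -lee_fin fineK// ltW.
- by rewrite s0.
- by rewrite sK.
Qed.

End LipschitzPaths.

(** * Exponential growth of the warping function *)

Section ExponentialGrowth.
Context {R : realType} {alpha : R} {psi : R -> R}.
Hypothesis alpha0 : 0 < alpha.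
Hypothesis psic : {within `[0, +oo[, continuous psi}.
Hypothesis psid : forall t : R, 0 < t -> derivable psi t 1.
Hypothesis psi0 : forall t, 0 <= t -> 0 <= psi t.
Hypothesis psi_le : forall t, 0 < t -> psi t <= alpha^-1 * derive1 psi t.

(** The derivative of [psi x * expR (- (alpha * x))] is nonnegative. *)
Lemma psi_exp_le (s t : R) : 0 <= s -> s <= t ->
  psi s * expR (alpha * (t - s)) <= psi t.
Proof.
move=> s0 st.
pose f x := psi x * expR (- (alpha * x)).
suff fst : f s <= f t.
  have : f s * expR (alpha * t) <= f t * expR (alpha * t).
    by rewrite ler_wpM2r// expR_ge0.
  rewrite /f -!mulrA -!expRD addNr expR0 mulr1.
  by rewrite (_ : - _ + _ = alpha * (t - s)) //; ring.
have fd (x : R) : 0 < x -> is_derive x (1:R) f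
    (expR (- (alpha * x)) * (derive1 psi x - alpha * psi x)).
  move=> x0; have dpsi := derivableP (psid x0).
  rewrite -derive1E in dpsi.
  have dlin : is_derive x (1:R) (fun u : R => - (alpha * u)) (- alpha).
    have := is_deriveN (is_deriveZ alpha (is_derive_id x (1:R))).
    by rewrite /GRing.scale/= mulr1.
  have dexp : is_derive x (1:R) (fun u : R => expR (- (alpha * u)))
      (- alpha * expR (- (alpha * x))).
    rewrite mulrC.
    exact: (is_derive1_comp (f := expR) (is_derive_expR _) dlin).
  apply: (is_derive_eq (is_deriveM dpsi dexp)).
  by rewrite /GRing.scale/=; ring.
have : {in `[0, t] &, {homo f : x y / x <= y}}.
  apply: ger0_derive1_le_cc.
  - by move=> x; rewrite in_itv/= => /andP[x0 _]; have [] := fd x x0.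
  - move=> x; rewrite in_itv/= => /andP[x0 _].
    rewrite derive1E; have [_ ->] := fd x x0.
    rewrite mulr_ge0 ?expR_ge0// subr_ge0.
    by have := psi_le x0; rewrite mulrC ler_pdivlMr// mulrC.
  - have sub : `[0, t]%classic `<=` `[(0:R), +oo[%classic.
      by move=> x /=; rewrite !in_itv/= => /andP[->].
    apply: (continuous_subspaceW sub) => x; apply: cvgM; first exact: psic.
    apply: continuous_subspaceT => {x} x.
    apply: continuous_comp; last exact: continuous_expR.
    apply: cvgN; apply: cvgM; [exact: cvg_cst|exact: cvg_id].
by apply => //; rewrite in_itv/= ?s0 ?lexx ?andbT//= ?(le_trans s0).
Qed.

Lemma psi_nd (s t : R) : 0 <= s -> s <= t -> psi s <= psi t.
Proof.
move=> s0 st; apply: le_trans (psi_exp_le s0 st).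
rewrite ler_peMr ?psi0// -expR0 ler_expR mulr_ge0 ?subr_ge0//; exact: ltW.
Qed.

End ExponentialGrowth.

(** * The cost of a descent *)

Section DescentEstimate.
Context {R : realType} {T : Type} {d : T -> T -> R} {alpha : R} {psi : R -> R}.
Hypothesis dM : is_metric d.
Hypothesis alpha0 : 0 < alpha.
Hypothesis psi0 : forall t, 0 <= t -> 0 <= psi t.
Hypothesis psi_nd : forall s t, 0 <= s -> s <= t -> psi s <= psi t.
Hypothesis psi_exp : forall s t, 0 <= s -> s <= t ->
  psi s * expR (alpha * (t - s)) <= psi t.

(** [Lam] is the warped length travelled, [h] the height and [y] the other
    coordinate of a path. *)
Definition warped_profile (a b : R) (Lam h : R -> R) (y : R -> T) : Prop :=
  [/\ a <= b,
    forall s t, a <= s -> s <= t -> t <= b -> `|h s - h t| <= Lam t - Lam s,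
    forall s t v, a <= s -> s <= t -> t <= b -> Lam s <= v -> v <= Lam t ->
      exists r, [/\ s <= r, r <= t & Lam r = v] &
    forall s t k, a <= s -> s <= t -> t <= b -> 0 <= k ->
      (forall u, s <= u -> u <= t -> k <= psi (h u)) ->
      k * d (y s) (y t) <= Lam t - Lam s].

Lemma warped_profile_sub a b a' b' Lam h y : warped_profile a b Lam h y ->
  a <= a' -> a' <= b' -> b' <= b -> warped_profile a' b' Lam h y.
Proof.
move=> [ab hL ivt yL] aa' ab' bb'; split => //.
- by move=> s t as_ st tb; apply: hL => //; [exact: le_trans as_|exact: le_trans bb'].
- by move=> s t v as_ st tb; apply: ivt => //; [exact: le_trans as_|exact: le_trans bb'].
- by move=> s t k as_ st tb; apply: yL => //; [exact: le_trans as_|exact: le_trans bb'].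
Qed.

Lemma warped_profile_rev a b Lam h y : warped_profile a b Lam h y ->
  warped_profile (- b) (- a) (fun t => - Lam (- t)) (fun t => h (- t)) (fun t => y (- t)).
Proof.
move=> [ab hL ivt yL]; split.
- by lra.
- by move=> s t as_ st tb; rewrite distrC; have := hL (- t) (- s); lra.
- move=> s t v as_ st tb Lv vL.
  have [|||||r [rt rs rv]] := ivt (- t) (- s) (- v); try lra.
  by exists (- r); split; rewrite ?opprK ?rv ?opprK//; lra.
- move=> s t k as_ st tb k0 kpsi; rewrite (dist_sym dM).
  have : k * d (y (- t)) (y (- s)) <= Lam (- s) - Lam (- t).
    apply: yL => //; try lra.
    by move=> u tu us; rewrite -[u]opprK; apply: kpsi; lra.
  by lra.
Qed.

Lemma one_sub_exp_ge (z : R) : 0 <= z -> z <= 1 -> z / 2 <= 1 - expR (- z).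
Proof.
move=> z0 z1; have := expR_ge1Dx z; have := expR_gt0 (- z).
have : expR (- z) * expR z = 1 by rewrite -expRD addNr expR0.
move=> h h0 h1.
have : expR (- z) * (1 + z) <= 1 by rewrite -[leRHS]h ler_wpM2l// ltW.
rewrite mulrDr mulr1 => h2.
have [e2|e2] := leP (1 / 2) (expR (- z)); last lra.
have : 1 / 2 * z <= expR (- z) * z by rewrite ler_wpM2r.
lra.
Qed.

(** Along a path that is about to descend to height [m] the factor [psi] is
    exponentially larger than [psi m], so the horizontal progress is controlled
    by the increments of an exponential of the remaining length. *)
Lemma descent_estimate a b m Lam h y : warped_profile a b Lam h y -> 0 <= m ->
  (forall u, a <= u -> u <= b -> m + (Lam b - Lam u) <= h u) ->
  psi m * d (y a) (y b) <= 2 / alpha.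
Proof.
move=> [ab hL ivt yL] m0 hm.
have Lle s t : a <= s -> s <= t -> t <= b -> Lam s <= Lam t.
  by move=> as_ st tb; have := hL s t as_ st tb; have := normr_ge0 (h s - h t); lra.
pose P t := expR (- (alpha * (Lam b - Lam t))).
have P0 t : 0 < P t by exact: expR_gt0.
have small s t : a <= s -> s <= t -> t <= b -> alpha * (Lam t - Lam s) <= 1 ->
    psi m * d (y s) (y t) <= 2 / alpha * (P t - P s).
  move=> as_ st tb small.
  have at_ := le_trans as_ st.
  have Ltb := Lle t b at_ tb (lexx b).
  have Lst := Lle s t as_ st tb.
  have k0 : 0 <= psi m * expR (alpha * (Lam b - Lam t)).
    by rewrite mulr_ge0 ?psi0// expR_ge0.
  have := yL s t _ as_ st tb k0.
  have kpsi u : s <= u -> u <= t ->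
      psi m * expR (alpha * (Lam b - Lam t)) <= psi (h u).
    move=> su ut; have := hm u (le_trans as_ su) (le_trans ut tb).
    have Lut := Lle u t (le_trans as_ su) ut tb => hu.
    have mm : m <= m + (Lam b - Lam t) by lra.
    have := psi_exp m0 mm; rewrite addrAC subrr add0r => /le_trans; apply.
    by apply: psi_nd; lra.
  move=> /(_ kpsi) dle.
  have {}dle : psi m * d (y s) (y t) <= P t * (Lam t - Lam s).
    rewrite -(ler_pM2l (expR_gt0 (alpha * (Lam b - Lam t)))) mulrA.
    rewrite [X in _ <= X](_ : _ = Lam t - Lam s).
      by rewrite (mulrC (expR _)) .
    by rewrite mulrA /P -expRD subrr expR0 mul1r.
  apply: le_trans dle _.
  have PsE : P s = P t * expR (- (alpha * (Lam t - Lam s))).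
    by rewrite /P -expRD; congr expR; ring.
  have z0 : 0 <= alpha * (Lam t - Lam s) by rewrite mulr_ge0 ?subr_ge0// ltW.
  rewrite PsE (_ : 2 / alpha * (P t - _) =
    P t * (2 / alpha * (1 - expR (- (alpha * (Lam t - Lam s)))))); last by ring.
  rewrite ler_pM2l//.
  have a20 : 0 < 2 / alpha by rewrite divr_gt0.
  have := ler_wpM2l (ltW a20) (one_sub_exp_ge z0 small).
  rewrite (_ : 2 / alpha * (alpha * (Lam t - Lam s) / 2) = Lam t - Lam s)//.
  by field; rewrite gt_eqF.
have global (n : nat) s t : a <= s -> s <= t -> t <= b ->
    alpha * (Lam t - Lam s) <= n%:R ->
    psi m * d (y s) (y t) <= 2 / alpha * (P t - P s).
  elim: n s t => [|n IH] s t as_ st tb Ln; first by apply: small => //; lra.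
  have [le1|gt1] := leP (alpha * (Lam t - Lam s)) 1; first exact: small.
  have ai0 : 0 < alpha^-1 by rewrite invr_gt0.
  have aaV : alpha * alpha^-1 = 1 by rewrite mulfV// gt_eqF.
  have sv : Lam s <= Lam t - alpha^-1.
    rewrite -(ler_pM2l alpha0) mulrBr aaV; move: gt1; rewrite mulrBr; lra.
  have [|r [sr rt rv]] := ivt s t (Lam t - alpha^-1) as_ st tb sv; first lra.
  have h1 : psi m * d (y s) (y r) <= 2 / alpha * (P r - P s).
    apply: IH => //; first exact: le_trans tb.
    rewrite rv; move: Ln; rewrite -natr1 !mulrBr aaV; lra.
  have h2 : psi m * d (y r) (y t) <= 2 / alpha * (P t - P r).
    apply: small => //; first exact: le_trans sr.
    by rewrite rv subKr aaV.
  have := dist_tri dM (y s) (y r) (y t).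
  move/(ler_wpM2l (psi0 m0)); rewrite mulrDr => /le_trans; apply.
  by move: h1 h2; rewrite !mulrBr; lra.
have := global (Num.truncn (alpha * (Lam b - Lam a))).+1 a b (lexx a) ab (lexx b).
have L0 : 0 <= alpha * (Lam b - Lam a).
  by rewrite mulr_ge0 ?subr_ge0//; [exact: ltW|exact: Lle].
move=> /(_ (ltW (truncnS_gt _))) /le_trans; apply.
rewrite -[leRHS]mulr1 ler_pM2l; last by rewrite divr_gt0.
rewrite /P subrr mulr0 oppr0 expR0.
by have := P0 a; rewrite /P; lra.
Qed.

(** Split the path after the length [(Lam b - Lam a + h a - h b) / 2], the first
    moment when it can have reached height [m]: [descent_estimate] applies to the
    first part, and to the second part traversed backwards. *)
Lemma warped_profile_estimate a b Lam h y : warped_profile a b Lam h y ->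
  let m := (h a + h b - (Lam b - Lam a)) / 2 in
  0 <= m -> psi m * d (y a) (y b) <= 4 / alpha.
Proof.
move=> wp m m0; have [ab hL ivt yL] := wp.
have := hL a b (lexx a) ab (lexx b); rewrite ler_norml => /andP[h1 h2].
pose L0 := Lam a + (Lam b - Lam a + h a - h b) / 2.
have [||r [ar rb rL]] := ivt a b L0 (lexx a) ab (lexx b); [rewrite /L0; lra..|].
have left : psi m * d (y a) (y r) <= 2 / alpha.
  apply: (descent_estimate (warped_profile_sub wp (lexx a) ar rb)) => // u au ur.
  have := hL a u (lexx a) au (le_trans ur rb); rewrite ler_norml => /andP[_].
  by rewrite rL /L0 /m; lra.
have right : psi m * d (y b) (y r) <= 2 / alpha.
  have := warped_profile_rev (warped_profile_sub wp ar rb (lexx b)).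
  move/descent_estimate => /(_ m m0); rewrite !opprK; apply => u bu ur.
  have ru : r <= - u by lra.
  have ub : - u <= b by lra.
  have := hL (- u) b (le_trans ar ru) ub (lexx b).
  by rewrite ler_norml => /andP[? _]; rewrite rL /L0 /m; lra.
have := dist_tri dM (y a) (y r) (y b).
move/(ler_wpM2l (psi0 m0)); rewrite mulrDr (dist_sym dM (y r)) => /le_trans; apply.
by lra.
Qed.

End DescentEstimate.

(** * Distances in the warped product over the half-line *)

Section HalfLine.
Context {R : realType}.
Implicit Types x y : half_line R.

Lemma half_line_val_inj x y : sval x = sval y -> x = y.
Proof. exact: val_inj. Qed.

Lemma half_line_metric : is_metric (@half_line_dist R).
Proof.
rewrite /half_line_dist; split=> [x y|x y|x y z].
- split=> [/eqP|->]; last by rewrite subrr normr0.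
  by rewrite normr_eq0 subr_eq0 => /eqP; exact: half_line_val_inj.
- exact: distrC.
- exact: ler_distD.
Qed.

Lemma max0_ge0 (x : R) : 0 <= Num.max 0 x.
Proof. by rewrite le_max lexx. Qed.

(** Truncation, so that real parameters give points of the half-line. *)
Definition to_half_line (x : R) : half_line R :=
  exist _ (Num.max 0 x) (max0_ge0 x).

Lemma to_half_lineK x : to_half_line (sval x) = x.
Proof. by apply: half_line_val_inj => /=; rewrite max_r//; exact: (svalP x). Qed.

Lemma to_half_line_lipschitz (u v : R) :
  half_line_dist (to_half_line u) (to_half_line v) <= `|u - v|.
Proof.
rewrite /half_line_dist/= ler_norml.
have := ler_norm (u - v); have := ler_norm (v - u); rewrite (distrC v).
by rewrite /Num.max; do !case: ifPn; rewrite -?leNgt => *; apply/andP; split; lra.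
Qed.

Lemma half_line_continuous (psi : R -> R) :
  {within `[0, +oo[, continuous psi} ->
  dist_continuous half_line_dist (fun u v : R => `|u - v|)
    (fun x : half_line R => psi (sval x)).
Proof.
move=> /subspace_continuousP psic x e e0.
have x0 : (`[0, +oo[%classic : set R) (sval x) by rewrite /= in_itv/= (svalP x).
have /cvgrPdist_lt /(_ e e0) := psic _ x0.
move=> [r /= r0 Hr]; exists r => // y yx.
rewrite distrC; apply: Hr; first by rewrite /ball_/= distrC.
by rewrite /= in_itv/= (svalP y).
Qed.

End HalfLine.

Section Cone.
Context {R : realType} {N : R * R -> R}.
Hypotheses (nN : is_norm2 N) (uN : unitary_norm N)
  (cN : coordinate_increasing N).
Context {Y : Type} {dY : Y -> Y -> R}.
Hypotheses (dYM : is_metric dY) (lY : length_space dY).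
Context {alpha : R} {psi : R -> R}.
Hypothesis alpha0 : 0 < alpha.
Hypothesis psic : {within `[0, +oo[, continuous psi}.
Hypothesis psi0 : forall t, 0 <= t -> 0 <= psi t.
Hypothesis psi_nd : forall s t, 0 <= s -> s <= t -> psi s <= psi t.
Hypothesis psi_exp : forall s t, 0 <= s -> s <= t ->
  psi s * expR (alpha * (t - s)) <= psi t.
Local Notation mu := (@lebesgue_measure R).
Local Notation phi := (fun s : half_line R => psi (sval s)).
Local Notation dX := (@half_line_dist R).
Local Notation lengths := (warped_lengths (N := N) (dX := dX) (dY := dY) (phi := phi)).
Local Notation wd := (warped_pseudodist N dX dY phi).
Implicit Types (p q : half_line R * Y) (s t : half_line R) (y z : Y).

Let dXM : is_metric dX := half_line_metric.
Let phi0 s : 0 <= phi s. Proof. exact: psi0 (svalP s). Qed.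
Let phiC := half_line_continuous psic.

Lemma vertical_length_le s t y : exists2 l, lengths (s, y) (t, y) l &
  (l <= (half_line_dist s t)%:E)%E.
Proof.
wlog st : s t / sval s <= sval t.
  move=> H; have [|/ltW] := leP (sval s) (sval t); first exact: H.
  move=> /H[l /(warped_lengths_sym nN uN cN dXM dYM phi0 phiC) ls lst].
  by exists l => //; rewrite (dist_sym dXM).
pose g (u : R) := (to_half_line u, y).
have := @warped_lengths_lipschitz _ N nN uN cN _ _ dX dY phi dXM dYM phi0 phiC
  (sval s) (sval t) g 1 0 (psi (sval t)) st ler01 (lexx 0).
rewrite /g !to_half_lineK mulr0 addr0 mul1r /half_line_dist distrC.
rewrite ger0_norm ?subr_ge0//; apply.
- by move=> u v _ _; rewrite mul1r; exact: to_half_line_lipschitz.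
- by move=> u v _ _; rewrite (dist_xx dYM) mul0r.
- move=> u; rewrite in_itv/= => /andP[su ut].
  have u0 : 0 <= u by apply: le_trans su; exact: (svalP s).
  by rewrite max_r//; exact: psi_nd.
Qed.

(** The infimum of lengths in [Y] need not be attained, whence the [e]. *)
Lemma horizontal_length_le s y z (e : R) : 0 < e ->
  exists2 l, lengths (s, y) (s, z) l & (l <= (psi (sval s) * (dY y z + e))%:E)%E.
Proof.
move=> e0; have [K [h [K0 Kd h0 hK hlip]]] := length_space_lipschitz dYM y z lY e0.
have := @warped_lengths_lipschitz _ N nN uN cN _ _ dX dY phi dXM dYM phi0 phiC
  0 K (fun u => (s, h u)) 0 1 (psi (sval s)) K0 (lexx 0) ler01.
rewrite h0 hK mulr1 add0r subr0 => H.
have [u v _ _|u v uK vK|//|l lS ll] := H _ _ _.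
- by rewrite (dist_xx dXM) mul0r.
- by rewrite mul1r hlip.
- by exists l => //; apply: le_trans ll _; rewrite lee_fin ler_wpM2l// psi0// (svalP s).
Qed.

Lemma cone_connected p q : exists l, lengths p q l.
Proof.
case: p q => [s y] [t z].
have [l1 l1S _] := horizontal_length_le s y z (ltr01 : 0 < (1:R)).
have [l2 l2S _] := vertical_length_le s t z.
by exists (l1 + l2)%E; exact: (warped_lengths_add nN uN cN dXM dYM phi0 phiC l1S).
Qed.

Let wd_le := @warped_dist_le _ N nN uN cN _ _ dX dY phi dXM dYM phi0 phiC cone_connected.
Let wd_lub := @warped_dist_lub _ N nN uN cN _ _ dX dY phi dXM dYM phi0 phiC cone_connected.
Let wd_tri := @warped_dist_tri _ N nN uN cN _ _ dX dY phi dXM dYM phi0 phiC cone_connected.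
Let wd_xx := @warped_dist_xx _ N nN uN cN _ _ dX dY phi dXM dYM phi0 phiC cone_connected.
Let wd_sym := @warped_dist_sym _ N nN uN cN _ _ dX dY phi dXM dYM phi0 phiC cone_connected.

Lemma vertical_dist_le s t y : wd (s, y) (t, y) <= half_line_dist s t.
Proof.
have [l lS ll] := vertical_length_le s t y.
by rewrite -lee_fin; exact: le_trans (wd_le lS) ll.
Qed.

Lemma horizontal_dist_le s y z : wd (s, y) (s, z) <= psi (sval s) * dY y z.
Proof.
have psis := phi0 s.
apply/ler_addgt0Pr => e e0.
have e'0 : 0 < e / (psi (sval s) + 1) by rewrite divr_gt0//; lra.
have [l lS ll] := horizontal_length_le s y z e'0.
rewrite -lee_fin; apply: le_trans (wd_le lS) _; apply: le_trans ll _.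
rewrite lee_fin mulrDr lerD2l mulrCA ler_piMr//; first exact: ltW.
by rewrite ler_pdivrMr; lra.
Qed.

(** Descend to height [r], travel there, and climb up again. *)
Lemma cone_dist_le p q (r : R) : 0 <= r -> r <= sval p.1 -> r <= sval q.1 ->
  wd p q <= (sval p.1 - r) + (sval q.1 - r) + psi r * dY p.2 q.2.
Proof.
case: p q => [s y] [t z] /= r0 rs rt; pose r' := to_half_line r.
have r'E : sval r' = r by rewrite /= max_r.
apply: le_trans (wd_tri _ (r', y) _) _.
have h1 := vertical_dist_le s r' y.
have h2 := horizontal_dist_le r' y z.
have h3 := vertical_dist_le r' t z.
have := wd_tri (r', y) (r', z) (t, z).
move: h1 h2 h3; rewrite /half_line_dist r'E (distrC r) !ger0_norm ?subr_ge0//.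
lra.
Qed.

(** The primitive of the density of a path of length [x], together with the two
    coordinates, is a profile to which [warped_profile_estimate] applies. *)
Lemma cone_length_ge p q (x : R) : lengths p q x%:E ->
  half_line_dist p.1 q.1 <= x /\
  (0 <= (sval p.1 + sval q.1 - x) / 2 ->
   psi ((sval p.1 + sval q.1 - x) / 2) * dY p.2 q.2 <= 4 / alpha).
Proof.
move=> [a [b [g [acg ga gb xE]]]].
have [w [wv intw dXle dYle _]] := warped_density nN uN cN dXM dYM phi0 phiC acg.
have [[[ab _] _] _] := acg.
have [mw w0 _] := wv.
pose Lam (t : R) := \int[mu]_(u in `[a, t]) w u.
have incr (s t : R) : a <= s -> s <= t ->
    (\int[mu]_(u in `[s, t]) (w u)%:E = (Lam t - Lam s)%:E)%E.
  exact: integral_primitive.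
have Lama : Lam a = 0 by rewrite /Lam /Rintegral set_itv1 integral_set1.
have xL : x = Lam b.
  apply/EFin_inj; rewrite xE /warped_length.
  rewrite (ae_version_integral (warped_speed_ge0 nN g) wv).
  by rewrite incr// Lama subr0.
have Lamc : {within `[a, b], continuous Lam}.
  by apply: parameterized_integral_continuous => //; exact: integrableS intw.
have prof : warped_profile (d := dY) (psi := psi) a b Lam
    (fun t : R => sval (g t).1) (fun t : R => (g t).2).
  split => //.
  - move=> s t as_ st tb; have := dXle s t as_ st tb.
    by rewrite incr// lee_fin.
  - move=> s t v as_ st tb sv vt.
    have Lst : {within `[s, t], continuous Lam}.
      apply: (continuous_subspaceW _ Lamc) => u /=.
      rewrite !in_itv/= => /andP[su ut].
      by rewrite (le_trans as_ su) (le_trans ut tb).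
    have [|r] := @IVT _ Lam s t v st Lst.
      by rewrite ge_min le_max sv vt orbT.
    by rewrite in_itv/= => /andP[sr rt] rv; exists r.
  - move=> s t k as_ st tb k0 kpsi; have := dYle s t k as_ st tb k0 kpsi.
    by rewrite incr// lee_fin.
split.
  have := dXle a b (lexx a) ab (lexx b).
  by rewrite incr// Lama subr0 -xL lee_fin ga gb.
have := warped_profile_estimate dYM alpha0 psi0 psi_nd psi_exp prof.
by rewrite /= ga gb Lama subr0 -xL.
Qed.

Lemma cone_dist_ge p q : half_line_dist p.1 q.1 <= wd p q.
Proof. by apply: wd_lub => x /cone_length_ge[]. Qed.

(** The height at which a geodesic between two points turns, up to an additive
    error; it is a Gromov product with respect to the apex. *)
Definition cone_product p q : R := (sval p.1 + sval q.1 - wd p q) / 2.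

Lemma cone_product_sym p q : cone_product p q = cone_product q p.
Proof. by rewrite /cone_product (wd_sym p q) (addrC (sval p.1)). Qed.

Lemma cone_product_le p q : cone_product p q <= sval p.1.
Proof.
rewrite /cone_product; have := cone_dist_ge p q.
by rewrite /half_line_dist ler_norml => /andP[]; lra.
Qed.

Lemma cone_product_ge p q (r : R) : 0 <= r -> r <= sval p.1 -> r <= sval q.1 ->
  r - psi r * dY p.2 q.2 / 2 <= cone_product p q.
Proof.
by move=> r0 rp rq; have := cone_dist_le r0 rp rq; rewrite /cone_product; lra.
Qed.

(** Some path is shorter than the sum of the heights minus [2 * m], and
    [cone_length_ge] applies to it. *)
Lemma psi_cone_product_le p q (m : R) : 0 <= m -> m < cone_product p q ->
  psi m * dY p.2 q.2 <= 4 / alpha.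
Proof.
move=> m0 mpq; apply: contrapT => /negP; rewrite -ltNge => H.
suff : sval p.1 + sval q.1 - 2 * m <= wd p q by move: mpq; rewrite /cone_product; lra.
apply: wd_lub => x /cone_length_ge[_ Hx].
rewrite leNgt; apply/negP => xm.
have mx : m <= (sval p.1 + sval q.1 - x) / 2 by lra.
have := Hx (le_trans m0 mx); rewrite leNgt => /negP; apply.
by apply: lt_le_trans H _; apply: ler_wpM2r; [exact: (dist_ge0 dYM)|exact: psi_nd].
Qed.

Lemma cone_dist_props :
  [/\ forall p, wd p p = 0, forall p q, wd p q = wd q p &
      forall p q r, wd p r <= wd p q + wd q r].
Proof. by split=> [p|p q|p q r]; [exact: wd_xx|exact: wd_sym|exact: wd_tri]. Qed.

End Cone.

(** * Hyperbolicity *)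

Lemma sig_val_inj (T : Type) (P : T -> Prop) (x y : {z | P z}) :
  sval x = sval y -> x = y.
Proof.
case: x y => [x px] [y py] /= xy; move: px py; rewrite xy => px py.
by congr (exist _ _ _); exact: Prop_irrelevance.
Qed.

Section Quotient.
Context {R : realType} {T : Type} {d : T -> T -> R}.
Hypothesis dxx : forall x, d x x = 0.
Hypothesis dsym : forall x y, d x y = d y x.
Hypothesis dtri : forall x y z, d x z <= d x y + d y z.
Implicit Types A B : dist_quotient d.

Lemma quotient_reprE A : sval A = [set q | d (quotient_repr A) q = 0].
Proof. by rewrite /quotient_repr; case: cid. Qed.

Let d_ge0 x y : 0 <= d x y.
Proof. by have := dtri x y x; rewrite dxx (dsym y x); lra. Qed.

Lemma quotient_dist_metric : is_metric (@quotient_dist R T d).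
Proof.
split=> [A B|A B|A B C]; [|exact: dsym|exact: dtri].
split=> [AB|->]; last exact: dxx.
apply: sig_val_inj; apply/seteqP; rewrite !quotient_reprE.
have AB0 : d (quotient_repr A) (quotient_repr B) = 0 := AB.
split=> q /= dq; apply/le_anti; rewrite d_ge0 andbT.
- by have := dtri (quotient_repr B) (quotient_repr A) q; rewrite dq (dsym _ (quotient_repr A)) AB0 addr0.
- by have := dtri (quotient_repr A) (quotient_repr B) q; rewrite dq AB0 addr0.
Qed.

Definition quotient_class x : dist_quotient d :=
  exist _ [set q | d x q = 0] (ex_intro _ x erefl).

Lemma quotient_class_repr x : d x (quotient_repr (quotient_class x)) = 0.
Proof.
have : sval (quotient_class x) (quotient_repr (quotient_class x)).
  by rewrite quotient_reprE /= dxx.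
by [].
Qed.

End Quotient.

Section FourPoints.
Context {R : realType} {T : Type} (d : T -> T -> R) (h : T -> R) (e : R).
Let P x y := (h x + h y - d x y) / 2.
Hypothesis dsym : forall x y, d x y = d y x.
Hypothesis three_points : forall x y z, Num.min (P x z) (P y z) - e <= P x y.

(** A three-point inequality for products based at one, possibly ideal, point
    gives the four-point condition: apply it around the largest of the four
    products on the left, twice. *)
Lemma four_points x y z w :
  Num.min (gromov_product d w x z) (gromov_product d w y z) - 2 * e
    <= gromov_product d w x y.
Proof.
have Psym u v : P u v = P v u by rewrite /P dsym (addrC (h u)).
have key x1 x2 x3 x4 :
    P x2 x3 <= P x1 x3 -> P x1 x4 <= P x1 x3 ->
    P x2 x3 + P x1 x4 - 2 * e <= P x1 x2 + P x3 x4.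
  move=> h1 h2.
  have := three_points x1 x2 x3; rewrite min_r//.
  have := three_points x3 x4 x1.
  by rewrite (Psym x3 x1) (Psym x4 x1) min_r// (Psym x3 x4) => ? ?; lra.
have H : Num.min (P x z + P y w) (P y z + P x w) - 2 * e <= P x y + P z w.
  have [h1|/ltW h1] := leP (P x z) (P y w); have [h2|/ltW h2] := leP (P y z) (P x w).
  - have [h3|/ltW h3] := leP (P y w) (P x w).
    + have := key x y w z; rewrite (Psym w z) => /(_ h3 (le_trans h1 h3)) ?.
      by apply: le_trans (_ : P y w + P x z - 2 * e <= _) => //;
        rewrite lerD2r ge_min addrC lexx.
    + have := key y x w z; rewrite (Psym w z) (Psym y x) => /(_ h3 (le_trans h2 h3)) ?.
      by apply: le_trans (_ : P x w + P y z - 2 * e <= _) => //;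
        rewrite lerD2r ge_min (addrC (P y z)) lexx orbT.
  - have [h3|/ltW h3] := leP (P y w) (P y z).
    + have := key y x z w; rewrite (Psym y x) => /(_ (le_trans h1 h3) h3) ?.
      by apply: le_trans (_ : P x z + P y w - 2 * e <= _) => //;
        rewrite lerD2r ge_min lexx.
    + have := key y x w z; rewrite (Psym w z) (Psym y x) => /(_ (le_trans h2 h3) h3) ?.
      by apply: le_trans (_ : P x w + P y z - 2 * e <= _) => //;
        rewrite lerD2r ge_min (addrC (P y z)) lexx orbT.
  - have [h3|/ltW h3] := leP (P x z) (P x w).
    + have := key x y w z; rewrite (Psym w z) => /(_ (le_trans h1 h3) h3) ?.
      by apply: le_trans (_ : P y w + P x z - 2 * e <= _) => //;
        rewrite lerD2r ge_min addrC lexx.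
    + have := key x y z w => /(_ (le_trans h2 h3) h3) ?.
      by apply: le_trans (_ : P y z + P x w - 2 * e <= _) => //;
        rewrite lerD2r ge_min lexx orbT.
  - have [h3|/ltW h3] := leP (P x z) (P y z).
    + have := key y x z w; rewrite (Psym y x) => /(_ h3 (le_trans h1 h3)) ?.
      by apply: le_trans (_ : P x z + P y w - 2 * e <= _) => //;
        rewrite lerD2r ge_min lexx.
    + have := key x y z w => /(_ h3 (le_trans h2 h3)) ?.
      by apply: le_trans (_ : P y z + P x w - 2 * e <= _) => //;
        rewrite lerD2r ge_min lexx orbT.
move: H; rewrite /P /gromov_product.
by rewrite /Num.min; do !case: ifPn; rewrite -?leNgt => *; lra.
Qed.

End FourPoints.

Section ConeHyperbolic.
Context {R : realType} {N : R * R -> R}.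
Hypotheses (nN : is_norm2 N) (uN : unitary_norm N)
  (cN : coordinate_increasing N).
Context {Y : Type} {dY : Y -> Y -> R}.
Hypotheses (dYM : is_metric dY) (lY : length_space dY).
Context {alpha : R} {psi : R -> R}.
Hypothesis alpha0 : 0 < alpha.
Hypothesis psic : {within `[0, +oo[, continuous psi}.
Hypothesis psi0 : forall t, 0 <= t -> 0 <= psi t.
Hypothesis psi_nd : forall s t, 0 <= s -> s <= t -> psi s <= psi t.
Hypothesis psi_exp : forall s t, 0 <= s -> s <= t ->
  psi s * expR (alpha * (t - s)) <= psi t.
Local Notation phi := (fun s : half_line R => psi (sval s)).
Local Notation dX := (@half_line_dist R).
Local Notation wd := (warped_pseudodist N dX dY phi).
Local Notation cp := (cone_product (N := N) (dY := dY) (psi := psi)).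
Implicit Types (p q : half_line R * Y).

Let cp_le := cone_product_le nN uN cN dYM lY alpha0 psic psi0 psi_nd psi_exp.
Let cp_sym := cone_product_sym nN uN cN dYM lY psic psi0 psi_nd.
Let cp_ge := cone_product_ge nN uN cN dYM lY psic psi0 psi_nd.
Let psi_cp := psi_cone_product_le nN uN cN dYM lY alpha0 psic psi0 psi_nd psi_exp.

(** Just below both products on the left [psi] makes each of the two horizontal
    distances cheap to cross, hence also their sum. If those products are negative,
    crossing at the apex suffices. *)
Lemma cone_three_points (M : R) p q r : 0 <= M ->
  (forall y z, psi 0 * dY y z <= M) ->
  Num.min (cp p r) (cp q r) - (4 / alpha + M / 2) <= cp p q.
Proof.
move=> M0 psiM; set m := Num.min _ _.
have a40 : 0 < 4 / alpha by rewrite divr_gt0.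
have [m0|m0] := leP m 0.
  have := cp_ge (lexx 0) (svalP p.1) (svalP q.1); have := psiM p.2 q.2; lra.
suff : m - 4 / alpha <= cp p q by lra.
apply/ler_addgt0Pr => e e0.
pose r0 := Num.max 0 (m - e).
have r0m : r0 < m by rewrite /r0 gt_max m0; lra.
have r00 : 0 <= r0 by rewrite /r0 le_max lexx.
have mr : m - e <= r0 by rewrite /r0 le_max lexx orbT.
have rp : r0 < cp p r by apply: lt_le_trans r0m _; rewrite /m ge_min lexx.
have rq : r0 < cp q r by apply: lt_le_trans r0m _; rewrite /m ge_min lexx orbT.
have := psi_cp r00 rp; have := psi_cp r00 rq.
have := cp_ge r00 (le_trans (ltW rp) (cp_le p r)) (le_trans (ltW rq) (cp_le q r)).
have := dist_tri dYM p.2 r.2 q.2; rewrite (dist_sym dYM r.2).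
move/(ler_wpM2l (psi0 r00)); rewrite mulrDr.
lra.
Qed.

Theorem cone_hyperbolic (M : R) : 0 <= M ->
  (forall y z, psi 0 * dY y z <= M) ->
  gromov_hyperbolic (warped_dist N dX dY phi) (8 / alpha + M).
Proof.
move=> M0 psiM.
have [wxx wsym wtri] := cone_dist_props nN uN cN dYM lY psic psi0 psi_nd.
split.
- exact: quotient_dist_metric.
- by rewrite addr_ge0// divr_ge0// ltW.
move=> x y z w.
have -> : 8 / alpha + M = 2 * (4 / alpha + M / 2) by field; rewrite gt_eqF.
apply: (four_points (h := fun A => sval (quotient_repr A).1)).
  by move=> A B; exact: wsym.
by move=> A B C; exact: cone_three_points.
Qed.

End ConeHyperbolic.

(** * Filters and powers *)

Section Filters.
Context {R : realType}.

Lemma cvg_pinfty_natP (f : nat -> R) :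
  f @ \oo --> +oo <-> forall A : R, exists n, forall i, (n <= i)%N -> A <= f i.
Proof.
split=> [/cvgryPge H A|H]; first by have [n _ Hn] := H A; exists n.
by apply/cvgryPge => A; have [n Hn] := H A; exists n.
Qed.

Lemma near_filter_prodP (P : nat * nat -> Prop) :
  (\forall ij \near filter_prod \oo \oo, P ij) <->
  exists n, forall i j, (n <= i)%N -> (n <= j)%N -> P (i, j).
Proof.
split=> [[[A B] [/= [n _ An] [m _ Bm]] AB]|[n Hn]].
  exists (maxn n m) => i j; rewrite !geq_max => /andP[ni _] /andP[_ mj].
  by apply: AB; split; [exact: An|exact: Bm].
exists ([set i | (n <= i)%N], [set j | (n <= j)%N]); first by split; exists n.
by move=> [i j] [/= ni nj]; exact: Hn.
Qed.

Lemma cvg_pinfty_prodP (f : nat -> nat -> R) :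
  (fun ij : nat * nat => f ij.1 ij.2) @ filter_prod \oo \oo --> +oo <->
  forall A : R, exists n, forall i j, (n <= i)%N -> (n <= j)%N -> A <= f i j.
Proof.
split=> [/cvgryPge H A|H]; first by have /near_filter_prodP := H A.
by apply/cvgryPge => A; apply/near_filter_prodP; exact: H.
Qed.

Local Open Scope ereal_scope.

Lemma limf_einf_prod_ge (f : nat -> nat -> R) (A : R) :
  (exists n, forall i j, (n <= i)%N -> (n <= j)%N -> (A <= f i j)%R) ->
  A%:E <= limf_einf (fun ij : nat * nat => (f ij.1 ij.2)%:E) (filter_prod \oo \oo).
Proof.
move=> [n Hn]; rewrite limf_einfE.
pose V : set (nat * nat) := [set ij | (A <= f ij.1 ij.2)%R].
apply: (@le_trans _ _ (ereal_inf [set (f ij.1 ij.2)%:E | ij in V])).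
  by apply: le_ereal_inf_tmp => _ [ij Vij <-]; rewrite lee_fin.
apply: ereal_sup_ubound; exists V => //.
by apply/(near_filter_prodP V); exists n; exact: Hn.
Qed.

Lemma limf_einf_prod_le (f : nat -> nat -> R) (A : R) :
  (exists n, forall i j, (n <= i)%N -> (n <= j)%N -> (f i j <= A)%R) ->
  limf_einf (fun ij : nat * nat => (f ij.1 ij.2)%:E) (filter_prod \oo \oo) <= A%:E.
Proof.
move=> [n Hn]; rewrite limf_einfE.
apply: ge_ereal_sup => _ [V /near_filter_prodP[m Vm] <-].
apply: (@le_trans _ _ (f (maxn n m) (maxn n m))%:E).
  apply: ereal_inf_lbound; exists (maxn n m, maxn n m) => //.
  by apply: Vm; rewrite leq_maxr.
by rewrite lee_fin; apply: Hn; rewrite leq_maxl.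
Qed.

Lemma limf_einf_prod_swap (f : nat -> nat -> R) :
  limf_einf (fun ij : nat * nat => (f ij.1 ij.2)%:E) (filter_prod \oo \oo) =
  limf_einf (fun ij : nat * nat => (f ij.2 ij.1)%:E) (filter_prod \oo \oo).
Proof.
suff H (g : nat -> nat -> R) :
    limf_einf (fun ij : nat * nat => (g ij.1 ij.2)%:E) (filter_prod \oo \oo) <=
    limf_einf (fun ij : nat * nat => (g ij.2 ij.1)%:E) (filter_prod \oo \oo).
  by apply/le_anti/andP; split; [exact: H|exact: (H (fun i j => f j i))].
rewrite !limf_einfE; apply: ge_ereal_sup => _ [V VF <-].
pose W : set (nat * nat) := [set ij | V (ij.2, ij.1)].
apply: (@le_trans _ _ (ereal_inf [set (g ij.2 ij.1)%:E | ij in W])).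
  apply: le_ereal_inf_tmp => _ [[i j] Wij <-] /=.
  by apply: ereal_inf_lbound; exists (j, i).
apply: ereal_sup_ubound; exists W => //.
move/near_filter_prodP : VF => [n Hn]; apply/near_filter_prodP.
by exists n => i j ni nj; exact: Hn.
Qed.

End Filters.

Section Powers.
Context {R : realType}.
Implicit Types a b p q : R.

(** Divide by [a + b]: a number in the unit interval is at most its power [p]. *)
Lemma powR_subadditive a b p : 0 <= a -> 0 <= b -> 0 < p -> p <= 1 ->
  (a + b) `^ p <= a `^ p + b `^ p.
Proof.
move=> a0 b0 p0 p1.
have [ab0|ab_neq0] := eqVneq (a + b) 0.
  by rewrite ab0 powR0 ?gt_eqF// addr_ge0 ?powR_ge0.
have ab : 0 < a + b by rewrite lt_neqAle eq_sym ab_neq0 addr_ge0.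
have frac c : 0 <= c -> c <= a + b -> c / (a + b) * (a + b) `^ p <= c `^ p.
  rewrite le_eqVlt => /orP[/eqP <-|c0] cab; first by rewrite !mul0r powR_ge0.
  have -> : c `^ p = (c / (a + b)) `^ p * (a + b) `^ p.
    by rewrite -powRM ?divr_ge0 ?(ltW ab) ?(ltW c0)// divfK.
  rewrite ler_wpM2r ?powR_ge0// ger1_powR//.
  by rewrite divr_gt0//= ler_pdivrMr// mul1r.
have := frac a a0; have := frac b b0; rewrite lerDl lerDr => /(_ a0) h1 /(_ b0) h2.
apply: le_trans (lerD h2 h1); rewrite -mulrDl -mulrDl divff//.
by rewrite mul1r.
Qed.

Lemma powR_within_continuous (p : R) : 0 < p ->
  {within `[0, +oo[, continuous (fun x : R => x `^ p)}.
Proof.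
move=> p0; apply/continuous_within_itvcyP; split; last first.
  by rewrite powR0 ?gt_eqF//; exact: powR_cvg0.
move=> x x0; apply: differentiable_continuous; apply/derivable1_diffP.
by apply: derivable_powR.
Qed.

Lemma powR_homeomorphism (E q : R) : 0 < E -> 0 < q ->
  half_line_homeomorphism (fun t => E * t `^ q).
Proof.
move=> E0 q0; have qV0 : 0 < q^-1 by rewrite invr_gt0.
have EV0 : 0 <= E^-1 by rewrite invr_ge0 ltW.
exists (fun t => E^-1 `^ q^-1 * t `^ q^-1); split.
- move=> t t0; have E1 : 0 <= E * t `^ q by rewrite mulr_ge0 ?powR_ge0// ltW.
  split => //; rewrite -powRM// mulKf ?gt_eqF// -powRrM mulfV ?gt_eqF//.
  exact: powRr1.
- move=> t t0; split; first by rewrite mulr_ge0 ?powR_ge0.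
  rewrite -powRM// -powRrM mulVf ?gt_eqF// powRr1 ?mulVKf ?gt_eqF//.
  by rewrite mulr_ge0.
- by move=> x; apply: cvgM; [exact: cvg_cst|exact: powR_within_continuous].
- by move=> x; apply: cvgM; [exact: cvg_cst|exact: powR_within_continuous].
Qed.

End Powers.

(** * Boundary metrics comparable to a power of a distance *)

Section Snowflake.
Context {R : realType} {Z Y : Type} {dZ : Z -> Z -> R} {x0 : Z}
  {dY : Y -> Y -> R} {alpha k1 k2 : R}.
Local Notation bdry := (gromov_boundary dZ x0).
Context {f : bdry -> Y} {g : Y -> bdry}.
Local Notation gp := (gromov_product dZ x0).
Implicit Types xi eta zeta : bdry.
Hypotheses (dYM : is_metric dY) (alpha0 : 0 < alpha) (k10 : 0 < k1) (k20 : 0 < k2).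
Hypotheses (fK : cancel f g) (gK : cancel g f).
Hypothesis dZsym : forall A B, dZ A B = dZ B A.
Hypothesis bdry_mem : forall xi, exists u, sval xi u.
Hypothesis product_same : forall xi u v, sval xi u -> sval xi v ->
  forall a : R, exists n, forall i j, (n <= i)%N -> (n <= j)%N -> a <= gp (u i) (v j).
Hypothesis product_distinct : forall xi eta u v, sval xi u -> sval eta v ->
  f xi <> f eta -> exists n, forall i j, (n <= i)%N -> (n <= j)%N ->
  k1 * dY (f xi) (f eta) <= expR (- (alpha * gp (u i) (v j))) <=
  k2 * dY (f xi) (f eta).

Let dY0 y z : 0 <= dY y z. Proof. exact: (dist_ge0 dYM). Qed.

Let gp_sym A B : gp A B = gp B A.
Proof. by rewrite /gromov_product (dZsym A B) (addrC (dZ A x0)). Qed.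

Lemma boundary_product_sym xi eta :
  boundary_product xi eta = boundary_product eta xi.
Proof.
suff H xi' eta' : (boundary_product xi' eta' <= boundary_product eta' xi')%E.
  by apply/le_anti/andP; split; exact: H.
apply: le_ereal_inf_tmp => _ [u uxi [v veta <-]].
apply: ereal_inf_lbound; exists v => //; exists u => //.
rewrite (limf_einf_prod_swap (fun i j => gp (v i) (u j))).
congr (limf_einf _ _); apply/funext => ij; congr (_%:E).
exact: gp_sym.
Qed.

Lemma boundary_predist_same eps xi eta : 0 < eps -> f xi = f eta ->
  boundary_predist eps xi eta = 0.
Proof.
move=> eps0 /(can_inj fK) <-; rewrite /boundary_predist.
have -> : boundary_product xi xi = +oo%E.
  apply/eqP; rewrite -leye_eq.
  apply: le_ereal_inf_tmp => _ [u uxi [v vxi <-]].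
  rewrite leye_eq; apply/eqP/eqyP => a _.
  apply: (limf_einf_prod_ge (f := fun i j => gp (u i) (v j))).
  exact: product_same uxi vxi a.
by rewrite gt0_muley ?lte_fin.
Qed.

Lemma boundary_predist_distinct eps xi eta : 0 < eps -> f xi <> f eta ->
  (k1 * dY (f xi) (f eta)) `^ (eps / alpha) <= boundary_predist eps xi eta <=
  (k2 * dY (f xi) (f eta)) `^ (eps / alpha).
Proof.
move=> eps0 fxe; set D := dY _ _.
have D0 : 0 < D.
  rewrite lt_neqAle eq_sym dY0 andbT; apply/eqP => Dz; apply: fxe.
  by case: dYM => /(_ (f xi) (f eta))[/(_ Dz)].
have kD1 : 0 < k1 * D by rewrite mulr_gt0.
have kD2 : 0 < k2 * D by rewrite mulr_gt0.
pose b1 := - (ln (k1 * D) / alpha); pose b2 := - (ln (k2 * D) / alpha).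
have gpb u v : sval xi u -> sval eta v -> exists n, forall i j,
    (n <= i)%N -> (n <= j)%N -> b2 <= gp (u i) (v j) <= b1.
  move=> uxi veta; have [n Hn] := product_distinct uxi veta fxe.
  exists n => i j ni nj; have /andP[h1 h2] := Hn i j ni nj.
  rewrite /b1 /b2 lerNl lerNr ler_pdivrMr// ler_pdivlMr//.
  move: h1 h2; set G := gp _ _; rewrite mulNr (mulrC G).
  rewrite -{1}(@lnK _ (k1 * D)) ?posrE// -{1}(@lnK _ (k2 * D)) ?posrE// !ler_expR.
  by move=> -> ->.
have [b bE b21] : exists2 b, boundary_product xi eta = b%:E & b2 <= b <= b1.
  have lb : (b2%:E <= boundary_product xi eta)%E.
    apply: le_ereal_inf_tmp => _ [u uxi [v veta <-]].
    apply: (limf_einf_prod_ge (f := fun i j => gp (u i) (v j))).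
    have [n Hn] := gpb u v uxi veta.
    by exists n => i j ni nj; have /andP[] := Hn i j ni nj.
  have ub : (boundary_product xi eta <= b1%:E)%E.
    have [u uxi] := bdry_mem xi; have [v veta] := bdry_mem eta.
    apply: (@le_trans _ _ (limf_einf (fun ij : nat * nat =>
      (gp (u ij.1) (v ij.2))%:E) (filter_prod \oo \oo))).
      by apply: ereal_inf_lbound; exists u => //; exists v.
    apply: (limf_einf_prod_le (f := fun i j => gp (u i) (v j))).
    have [n Hn] := gpb u v uxi veta.
    by exists n => i j ni nj; have /andP[] := Hn i j ni nj.
  have bfin : boundary_product xi eta \is a fin_num.
    by rewrite fin_numElt (lt_le_trans (ltNyr _) lb) (le_lt_trans ub (ltry _)).
  exists (fine (boundary_product xi eta)); first by rewrite fineK.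
  by rewrite -!lee_fin fineK// lb.
rewrite /boundary_predist bE /=.
rewrite /powR !gt_eqF// !ler_expR.
move: b21; rewrite /b1 /b2 => /andP[h1 h2].
have e0 := ltW eps0.
have := ler_wpM2l e0 h1; have := ler_wpM2l e0 h2.
rewrite !mulrN !mulrA => ? ?.
rewrite !(mulrAC eps alpha^-1).
by apply/andP; split; lra.
Qed.

Lemma boundary_predist_bounds eps xi eta : 0 < eps ->
  k1 `^ (eps / alpha) * dY (f xi) (f eta) `^ (eps / alpha)
    <= boundary_predist eps xi eta <=
  k2 `^ (eps / alpha) * dY (f xi) (f eta) `^ (eps / alpha).
Proof.
move=> eps0; have p0 : eps / alpha != 0 by rewrite gt_eqF// divr_gt0.
have [fxe|fxe] := pselect (f xi = f eta).
  by rewrite boundary_predist_same// fxe (dist_xx dYM) powR0// !mulr0 lexx.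
by rewrite -!powRM ?(ltW k10) ?(ltW k20)//; exact: boundary_predist_distinct.
Qed.

Lemma boundary_predist_sym eps xi eta :
  boundary_predist eps xi eta = boundary_predist eps eta xi.
Proof. by rewrite /boundary_predist boundary_product_sym. Qed.

Section SmallExponent.
Variable eps : R.
Hypotheses (eps0 : 0 < eps) (eps_alpha : eps < alpha).
Let p := eps / alpha.
Local Notation bd := (boundary_dist dZ x0 eps).
Local Notation pd := (boundary_predist eps).

Let p0 : 0 < p. Proof. by rewrite divr_gt0. Qed.

Let p1 : p <= 1. Proof. by rewrite ler_pdivrMr// mul1r ltW. Qed.

Definition chain_sums xi eta : set R :=
  [set l | exists (k : nat) (c : nat -> bdry),
    [/\ (0 < k)%N, c 0%N = xi, c k = eta &
        l = \sum_(0 <= i < k) pd (c i) (c i.+1)]].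

Lemma chain_sums_predist xi eta : chain_sums xi eta (pd xi eta).
Proof.
by exists 1%N, (fun i => if i is 0%N then xi else eta); rewrite big_nat1.
Qed.

(** As [p <= 1], the power [p] of the distance is again a distance, so chains
    do not shorten it. *)
Lemma chain_sums_ge xi eta l : chain_sums xi eta l ->
  k1 `^ p * dY (f xi) (f eta) `^ p <= l.
Proof.
move=> [k [c [_ <- <- ->]]].
elim: k => [|k IH].
  by rewrite (dist_xx dYM) powR0 ?gt_eqF// mulr0 big_geq.
rewrite big_nat_recr//=; have /andP[h _] := boundary_predist_bounds (c k) (c k.+1) eps0.
apply: le_trans (lerD IH h); rewrite -mulrDr ler_wpM2l ?powR_ge0//.
apply: le_trans (powR_subadditive _ _ p0 p1) => //.
apply: ge0_ler_powR; rewrite ?nnegrE ?(ltW p0) ?addr_ge0//.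
exact: (dist_tri dYM).
Qed.

Lemma chain_sums_inf xi eta : has_inf (chain_sums xi eta).
Proof.
split; first by exists (pd xi eta); exact: chain_sums_predist.
exists 0 => l /chain_sums_ge; apply: le_trans.
by rewrite mulr_ge0 ?powR_ge0.
Qed.

Lemma boundary_dist_bounds xi eta :
  k1 `^ p * dY (f xi) (f eta) `^ p <= bd xi eta <= k2 `^ p * dY (f xi) (f eta) `^ p.
Proof.
have [ne lb] := chain_sums_inf xi eta.
apply/andP; split.
  by apply: lb_le_inf => // l; exact: chain_sums_ge.
have /andP[_] := boundary_predist_bounds xi eta eps0; apply: le_trans.
by apply: ge_inf => //; exact: chain_sums_predist.
Qed.

Lemma boundary_dist_metric : is_metric bd.
Proof.
split=> [xi eta|xi eta|xi eta zeta].
- have /andP[h1 h2] := boundary_dist_bounds xi eta.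
  split=> [b0|xe].
    apply: (can_inj fK); case: dYM => /(_ (f xi) (f eta))[+ _] _ _; apply.
    move: h1; rewrite b0 => h1.
    apply: (@powR_eq0_eq0 _ _ p); apply/le_anti; rewrite powR_ge0 andbT.
    by rewrite -(ler_pM2l (powR_gt0 p k10)) mulr0.
  move: h1 h2; rewrite xe (dist_xx dYM) powR0 ?gt_eqF// !mulr0 => h1 h2.
  by apply/le_anti; rewrite h1 h2.
- suff H a b : chain_sums a b `<=` chain_sums b a.
    by congr inf; apply/seteqP; split; exact: H.
  move=> l [k [c [k0 ca cb ->]]].
  exists k, (fun i => c (k - i)%N); split => //; rewrite ?subn0 ?subnn//.
  rewrite big_nat_rev/= add0n; apply: eq_big_nat => i /andP[_ ik].
  by rewrite boundary_predist_sym subnS prednK ?subn_gt0// ?subKn// 1?ltnW//;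
     rewrite subnA.
- have [ne1 lb1] := chain_sums_inf xi eta; have [ne2 lb2] := chain_sums_inf eta zeta.
  rewrite -lerBlDr; apply: lb_le_inf => // l1 [k [c [k0 c0 ck ->]]].
  rewrite lerBlDr -lerBlDl; apply: lb_le_inf => // l2 [k' [c' [k'0 c'0 c'k ->]]].
  rewrite lerBlDl; apply: ge_inf; first by have [] := chain_sums_inf xi zeta.
  exists (k + k')%N, (fun i => if (i <= k)%N then c i else c' (i - k)%N).
  split; rewrite ?addn_gt0 ?k0//.
    by rewrite addnC -{2}[k]add0n leq_add2r leqNgt k'0/= addnK.
  rewrite [RHS](@big_cat_nat _ _ _ k)//= ?leq_addr//; congr (_ + _).
    by apply: eq_big_nat => i /andP[_ ik]; rewrite ltnW// ik.
  have shift (F : nat -> R) :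
      \sum_(k <= i < k + k') F i = \sum_(0 <= i < k') F (i + k)%N.
    by rewrite -{1}[k]add0n big_addn addnC addnK.
  rewrite shift; apply: eq_big_nat => i /andP[_ ik].
  have -> : ((i + k).+1 <= k)%N = false by rewrite ltnNge leq_addl.
  have -> : ((i + k).+1 - k)%N = i.+1 by rewrite -addSn addnK.
  rewrite addnK; case: i ik => [|i] _; first by rewrite add0n leqnn ck c'0.
  by rewrite addSn ltnNge leq_addl.
Qed.

(** The boundary distance is between two multiples of the power [p] of the distance
    of [Y], so ratios of distances of [Y] are at most a multiple of the power
    [p^-1] of ratios of boundary distances. *)
Lemma boundary_quasisymmetric : quasisymmetrically_homeomorphic bd dY.
Proof.
have pV0 : 0 < p^-1 by rewrite invr_gt0.
have k1p : 0 < k1 `^ p by rewrite powR_gt0.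
have k2p : 0 < k2 `^ p by rewrite powR_gt0.
split; [exact: boundary_dist_metric|exact: dYM|].
pose E := (k2 / k1).
have E0 : 0 < E by rewrite divr_gt0.
exists f, (fun t => E * t `^ p^-1); split.
- exists g; split => //.
  + move=> xi e e0; exists (k1 `^ p * e `^ p) => [|eta h].
      by rewrite mulr_gt0// powR_gt0.
    have /andP[h1 _] := boundary_dist_bounds eta xi.
    have := le_lt_trans h1 h; rewrite ltr_pM2l//.
    by apply: contraTT; rewrite -!leNgt => ?; apply: ge0_ler_powR;
       rewrite ?nnegrE ?(ltW p0)// ltW.
  + move=> y e e0; pose r := (e / k2 `^ p) `^ p^-1.
    have ek : 0 < e / k2 `^ p by rewrite divr_gt0.
    exists r => [|z zy]; first by rewrite powR_gt0.
    have /andP[_ h] := boundary_dist_bounds (g z) (g y).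
    apply: le_lt_trans h _; rewrite !gK -ltr_pdivlMl// mulrC.
    have -> : e / k2 `^ p = r `^ p.
      by rewrite /r -powRrM mulVf ?gt_eqF// powRr1// ltW.
    by apply: gt0_ltr_powR; rewrite ?nnegrE// powR_ge0.
- exact: powR_homeomorphism.
move=> xi eta zeta _ _ xz.
have d0 : 0 < dY (f xi) (f zeta).
  rewrite lt_neqAle eq_sym dY0 andbT; apply/eqP => dz; apply: xz.
  by apply: (can_inj fK); case: dYM => /(_ (f xi) (f zeta))[/(_ dz)].
have /andP[h1 _] := boundary_dist_bounds xi eta.
have /andP[_ h2] := boundary_dist_bounds xi zeta.
have b0 : 0 < bd xi zeta.
  have /andP[h3 _] := boundary_dist_bounds xi zeta.
  by apply: lt_le_trans h3; rewrite mulr_gt0// powR_gt0.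
have b1 : 0 <= bd xi eta by apply: le_trans h1; rewrite mulr_ge0 ?powR_ge0.
have root (x : R) : 0 <= x -> (x `^ p) `^ p^-1 = x.
  by move=> x0'; rewrite -powRrM mulfV ?gt_eqF// powRr1.
have l1 : k1 * dY (f xi) (f eta) <= bd xi eta `^ p^-1.
  rewrite -[leLHS]root; last by rewrite mulr_ge0// ltW.
  apply: ge0_ler_powR; rewrite ?nnegrE ?powR_ge0 ?(ltW pV0)//.
  by rewrite powRM// ltW.
have l2 : bd xi zeta `^ p^-1 <= k2 * dY (f xi) (f zeta).
  rewrite -[leRHS]root; last by rewrite mulr_ge0// ltW.
  apply: ge0_ler_powR; rewrite ?nnegrE ?powR_ge0 ?(ltW pV0) ?(ltW b0)//.
  by rewrite powRM// ltW.
rewrite ler_pdivrMr// powRM ?invr_ge0 ?(ltW b0)//.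
have -> : (bd xi zeta)^-1 `^ p^-1 = (bd xi zeta `^ p^-1)^-1.
  by rewrite -powR_inv1 ?(ltW b0)// powRAC powR_inv1 ?powR_ge0.
have B0 : 0 < bd xi zeta `^ p^-1 by rewrite powR_gt0.
rewrite -(ler_pM2l k10); apply: le_trans l1 _.
rewrite -(ler_pM2r B0).
have -> : k1 * (E * (bd xi eta `^ p^-1 / bd xi zeta `^ p^-1) * dY (f xi) (f zeta)) *
    bd xi zeta `^ p^-1 = bd xi eta `^ p^-1 * (k2 * dY (f xi) (f zeta)).
  by rewrite /E; field; rewrite !gt_eqF.
by rewrite ler_wpM2l ?powR_ge0.
Qed.

End SmallExponent.
End Snowflake.

(** * The Gromov boundary of the warped product *)

Section ConeBoundary.
Context {R : realType} {N : R * R -> R}.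
Hypotheses (nN : is_norm2 N) (uN : unitary_norm N)
  (cN : coordinate_increasing N).
Context {Y : Type} {dY : Y -> Y -> R}.
Hypotheses (dYM : is_metric dY) (lY : length_space dY).
Context {alpha : R} {psi : R -> R}.
Hypothesis alpha0 : 0 < alpha.
Hypothesis psic : {within `[0, +oo[, continuous psi}.
Hypothesis psi0 : forall t, 0 <= t -> 0 <= psi t.
Hypothesis psi_nd : forall s t, 0 <= s -> s <= t -> psi s <= psi t.
Hypothesis psi_exp : forall s t, 0 <= s -> s <= t ->
  psi s * expR (alpha * (t - s)) <= psi t.
Context {D t0 c0 C : R}.
Hypotheses (D0 : 0 < D) (dYD : forall y z, dY y z <= D).
Hypotheses (t00 : 0 <= t0) (c00 : 0 < c0)
  (psi_lb : forall t, t0 <= t -> c0 * expR (alpha * t) <= psi t).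
Hypothesis psi_ub : forall t, 0 <= t -> psi t <= C * expR (alpha * t).
Hypothesis complete_dY : forall u : nat -> Y,
  (forall e : R, 0 < e -> exists n, forall i j, (n <= i)%N -> (n <= j)%N ->
     dY (u i) (u j) < e) ->
  exists y, forall e : R, 0 < e -> exists n, forall i, (n <= i)%N -> dY (u i) y < e.
Local Notation phi := (fun s : half_line R => psi (sval s)).
Local Notation dX := (@half_line_dist R).
Local Notation wd := (warped_pseudodist N dX dY phi).
Local Notation Z := (dist_quotient wd).
Local Notation dZ := (warped_dist N dX dY phi).
Variable x0 : Z.
Implicit Types (A B : Z) (y z : Y) (u v : nat -> Z).

Let cpt A B := cone_product (N := N) (dY := dY) (psi := psi)
  (quotient_repr A) (quotient_repr B).
Let ht A : R := sval (quotient_repr A).1.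
Let pr A : Y := (quotient_repr A).2.
Let gp A B := gromov_product dZ x0 A B.

Let ht0 A : 0 <= ht A. Proof. exact: (svalP (quotient_repr A).1). Qed.

Let cp_le A B : cpt A B <= ht A.
Proof. exact: (cone_product_le nN uN cN dYM lY alpha0 psic psi0 psi_nd psi_exp). Qed.

Let cp_sym A B : cpt A B = cpt B A.
Proof. exact: (cone_product_sym nN uN cN dYM lY psic psi0 psi_nd). Qed.

Let cp_ge A B (r : R) : 0 <= r -> r <= ht A -> r <= ht B ->
  r - psi r * dY (pr A) (pr B) / 2 <= cpt A B.
Proof. exact: (cone_product_ge nN uN cN dYM lY psic psi0 psi_nd). Qed.

Let psi_cp A B (m : R) : 0 <= m -> m < cpt A B ->
  psi m * dY (pr A) (pr B) <= 4 / alpha.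
Proof.
exact: (psi_cone_product_le nN uN cN dYM lY alpha0 psic psi0 psi_nd psi_exp).
Qed.

Let dY0 y z : 0 <= dY y z. Proof. exact: (dist_ge0 dYM). Qed.

(** Bounds the effect of moving the base point of the product from the apex to
    [x0]: distances to [x0] differ from heights by at most this much. *)
Let K := ht x0 + psi 0 * D.

Lemma gromov_cone_product A B : `|gp A B - cpt A B| <= K.
Proof.
have H E : - ht x0 <= dZ E x0 - ht E /\ dZ E x0 - ht E <= ht x0 + psi 0 * D.
  have := cp_le x0 E; rewrite cp_sym.
  have := cp_ge (lexx 0) (ht0 E) (ht0 x0).
  have : psi 0 * dY (pr E) (pr x0) <= psi 0 * D by rewrite ler_wpM2l// psi0.
  rewrite /cpt /cone_product -/(ht E) -/(ht x0) /warped_dist /quotient_dist.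
  by move=> ? ? ?; split; lra.
have [h1 h2] := H A; have [h3 h4] := H B.
have pD : 0 <= psi 0 * D by rewrite mulr_ge0 ?psi0// ltW.
have -> : gp A B - cpt A B = ((dZ A x0 - ht A) + (dZ B x0 - ht B)) / 2.
  rewrite /gp /gromov_product /cpt /cone_product -/(ht A) -/(ht B).
  by rewrite /warped_dist /quotient_dist; lra.
by rewrite ler_norml /K; apply/andP; split; lra.
Qed.

Lemma gromov_sequenceP u : gromov_sequence dZ x0 u <->
  forall a : R, exists n, forall i j, (n <= i)%N -> (n <= j)%N -> a <= cpt (u i) (u j).
Proof.
split=> [H a|H].
  have [n Hn] := (cvg_pinfty_prodP (fun i j => gp (u i) (u j))).1 H (a + K); exists n => i j ni nj.
  have := Hn i j ni nj; have := gromov_cone_product (u i) (u j).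
  by rewrite ler_norml /gp => /andP[]; lra.
apply/(cvg_pinfty_prodP (fun i j => gp (u i) (u j))) => a.
have [n Hn] := H (a + K); exists n => i j ni nj; have := Hn i j ni nj.
by have := gromov_cone_product (u i) (u j); rewrite ler_norml => /andP[]; lra.
Qed.

Lemma gromov_equivP u v : gromov_equiv dZ x0 u v <->
  forall a : R, exists n, forall i, (n <= i)%N -> a <= cpt (u i) (v i).
Proof.
split=> [H a|H].
  have [n Hn] := (cvg_pinfty_natP (fun i => gp (u i) (v i))).1 H (a + K); exists n => i ni; have := Hn i ni.
  have := gromov_cone_product (u i) (v i); rewrite ler_norml /gp => /andP[]; lra.
apply/cvg_pinfty_natP => a.
have [n Hn] := H (a + K); exists n => i ni; have := Hn i ni.
by have := gromov_cone_product (u i) (v i); rewrite ler_norml /gp => /andP[]; lra.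
Qed.

Lemma psi_unbounded (b : R) : exists2 m, 0 <= m & b < psi m.
Proof.
pose m := Num.max t0 (`|b| / (c0 * alpha)).
exists m; first by rewrite /m le_max t00.
have ca0 : 0 < c0 * alpha by rewrite mulr_gt0.
have mt : t0 <= m by rewrite /m le_max lexx.
have mb : `|b| / (c0 * alpha) <= m by rewrite /m le_max lexx orbT.
clearbody m.
apply: lt_le_trans (psi_lb mt).
apply: (@lt_le_trans _ _ (c0 * (1 + alpha * m))).
  apply: le_lt_trans (ler_norm b) _.
  apply: (@le_lt_trans _ _ (m * (c0 * alpha))); first by rewrite -ler_pdivrMr.
  by rewrite mulrDr mulr1 (mulrC m) -mulrA ltrDr.
by rewrite ler_pM2l// expR_ge1Dx.
Qed.

(** Convergence to the point at infinity above [y]. *)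
Definition converges_above u y : Prop :=
  (forall a : R, exists n, forall i, (n <= i)%N -> a <= ht (u i)) /\
  (forall e : R, 0 < e -> exists n, forall i, (n <= i)%N -> dY (pr (u i)) y < e).

(** Geodesics that turn high up cross where [psi] is large, which leaves room for
    little horizontal distance. *)
Lemma product_close (e : R) : 0 < e ->
  exists a : R, forall A B, a <= cpt A B -> dY (pr A) (pr B) < e.
Proof.
move=> e0; have [m m0 psim] := psi_unbounded (4 / alpha / e).
exists (m + 1) => A B mAB.
have mlt : m < cpt A B by lra.
have := psi_cp m0 mlt.
have psim0 : 0 < psi m.
  by apply: le_lt_trans psim; rewrite !divr_ge0// ltW.
move: psim; rewrite ltr_pdivrMr// => psim h.
by rewrite -(ltr_pM2l psim0); lra.
Qed.

Lemma gromov_sequence_converges u : gromov_sequence dZ x0 u ->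
  exists y, converges_above u y.
Proof.
move=> /gromov_sequenceP uG.
have [|y yu] := @complete_dY (fun i => pr (u i)).
  move=> e e0; have [a Ha] := product_close e0.
  by have [n Hn] := uG a; exists n => i j ni nj; exact/Ha/Hn.
exists y; split => // a; have [n Hn] := uG a; exists n => i ni.
by apply: le_trans (Hn i i ni ni) _; exact: cp_le.
Qed.

(** Points high above nearby points of [Y] are joined by crossing at any fixed
    height [r], at a cost that tends to zero. *)
Lemma converges_product u v y : converges_above u y -> converges_above v y ->
  forall a : R, exists n, forall i j, (n <= i)%N -> (n <= j)%N -> a <= cpt (u i) (v j).
Proof.
move=> [uh uy] [vh vy] a; pose r := Num.max 0 (a + 1).
have r0 : 0 <= r by rewrite /r le_max lexx.
have ra : a + 1 <= r by rewrite /r le_max lexx orbT.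
have psir := psi0 r0.
have e0 : 0 < (psi r + 1)^-1 by rewrite invr_gt0; lra.
have [n1 H1] := uh r; have [n2 H2] := vh r.
have [n3 H3] := uy _ e0; have [n4 H4] := vy _ e0.
exists (maxn (maxn n1 n2) (maxn n3 n4)) => i j.
rewrite !geq_max => /andP[/andP[i1 _] /andP[i3 _]] /andP[/andP[_ j2] /andP[_ j4]].
apply: le_trans (cp_ge r0 (H1 i i1) (H2 j j2)).
have dij : dY (pr (u i)) (pr (v j)) <= 2 * (psi r + 1)^-1.
  have := dist_tri dYM (pr (u i)) y (pr (v j)); rewrite (dist_sym dYM y).
  have := H3 i i3; have := H4 j j4; lra.
have : psi r * dY (pr (u i)) (pr (v j)) <= 2.
  apply: le_trans (ler_wpM2l psir dij) _; rewrite mulrCA ler_piMr//.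
  by rewrite ler_pdivrMr; lra.
lra.
Qed.

Lemma converges_gromov u y : converges_above u y -> gromov_sequence dZ x0 u.
Proof. by move=> uy; apply/gromov_sequenceP; exact: (converges_product uy uy). Qed.

Lemma converges_equiv u v y : converges_above u y -> converges_above v y ->
  gromov_equiv dZ x0 u v.
Proof.
move=> uy vy; apply/gromov_equivP => a.
by have [n Hn] := converges_product uy vy a; exists n => i ni; exact: Hn.
Qed.

Lemma equiv_same_limit u v y z : gromov_equiv dZ x0 u v ->
  converges_above u y -> converges_above v z -> y = z.
Proof.
move=> /gromov_equivP uv [_ uy] [_ vz].
case: dYM => /(_ y z)[+ _] _ _; apply; apply/le_anti; rewrite dY0 andbT.
apply/ler_addgt0Pr => e e0; rewrite add0r; have e30 : 0 < e / 3 by lra.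
have [a Ha] := product_close e30.
have [n1 H1] := uy _ e30; have [n2 H2] := vz _ e30; have [n3 H3] := uv a.
pose n := maxn n1 (maxn n2 n3).
have [l1 l2 l3] : [/\ (n1 <= n)%N, (n2 <= n)%N & (n3 <= n)%N].
  by rewrite /n !leq_max !leqnn !orbT.
have := H1 n l1; have := H2 n l2; have := Ha _ _ (H3 n l3).
have := dist_tri dYM y (pr (u n)) z.
have := dist_tri dYM (pr (u n)) (pr (v n)) z.
rewrite (dist_sym dYM y (pr (u n))); lra.
Qed.

Lemma same_limit_unique u y z : converges_above u y -> converges_above u z -> y = z.
Proof. by move=> uy uz; apply: (equiv_same_limit (converges_equiv uy uy)). Qed.

Definition vertical_sequence y (n : nat) : Z :=
  quotient_class (d := wd) (to_half_line n%:R, y).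

Lemma converges_vertical y : converges_above (vertical_sequence y) y.
Proof.
have [wxx wsym wtri] := cone_dist_props nN uN cN dYM lY psic psi0 psi_nd.
have rep n : wd (to_half_line n%:R, y) (quotient_repr (vertical_sequence y n)) = 0.
  exact: quotient_class_repr.
have htn n : ht (vertical_sequence y n) = n%:R.
  have := cone_dist_ge nN uN cN dYM lY alpha0 psic psi0 psi_nd psi_exp
    (to_half_line n%:R, y) (quotient_repr (vertical_sequence y n)).
  rewrite rep /half_line_dist /= max_r// normr_le0 subr_eq0 => /eqP nE.
  by rewrite /ht -nE.
have hta (a : R) : exists n, forall i, (n <= i)%N -> a <= ht (vertical_sequence y i).
  exists (Num.truncn `|a|).+1 => i ni; rewrite htn.
  apply: le_trans (ler_norm a) _; apply: le_trans (ltW (truncnS_gt _)) _.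
  by rewrite ler_nat.
split => // e e0.
have [m m0 psim] := psi_unbounded (4 / alpha / e).
have psim0 : 0 < psi m.
  by apply: le_lt_trans psim; rewrite !divr_ge0// ltW.
have [n Hn] := hta (m + 1); exists n => i ni.
have hi := Hn i ni.
have mlt : m < cone_product (N := N) (dY := dY) (psi := psi)
    (to_half_line i%:R, y) (quotient_repr (vertical_sequence y i)).
  rewrite /cone_product rep -/(ht _) htn /= max_r//.
  by move: hi; rewrite htn; lra.
have := psi_cone_product_le nN uN cN dYM lY alpha0 psic psi0 psi_nd psi_exp m0 mlt.
move: psim; rewrite ltr_pdivrMr// => psim /= h.
by rewrite (dist_sym dYM) -(ltr_pM2l psim0); exact: le_lt_trans h psim.
Qed.

Local Notation bdry := (gromov_boundary dZ x0).
Implicit Types (xi eta zeta : bdry).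

(** A point of the boundary is a set of sequences; it consists of those that
    converge above one point of [Y]. *)
Lemma boundary_class xi : exists y, sval xi = [set u | converges_above u y].
Proof.
have [u [uG ->]] := svalP xi; have [y uy] := gromov_sequence_converges uG.
exists y; apply/seteqP; split=> v /=.
  move=> [vG uv]; have [z vz] := gromov_sequence_converges vG.
  by rewrite (equiv_same_limit uv uy vz).
by move=> vy; split; [exact: converges_gromov vy|exact: converges_equiv vy].
Qed.

Definition boundary_limit xi : Y := sval (cid (boundary_class xi)).

Lemma boundary_limitP xi u : sval xi u <-> converges_above u (boundary_limit xi).
Proof. by rewrite /boundary_limit; case: cid => y /= ->. Qed.

Lemma above_is_class y : exists u, gromov_sequence dZ x0 u /\
  [set v | converges_above v y] =
  [set v | gromov_sequence dZ x0 v /\ gromov_equiv dZ x0 u v].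
Proof.
have uy := converges_vertical y.
exists (vertical_sequence y); split; first exact: converges_gromov uy.
apply/seteqP; split=> v /=.
  by move=> vy; split; [exact: converges_gromov vy|exact: converges_equiv vy].
move=> [vG uv]; have [z vz] := gromov_sequence_converges vG.
by rewrite (equiv_same_limit uv uy vz).
Qed.

Definition point_above y : bdry := exist _ _ (above_is_class y).

Lemma point_aboveK : cancel point_above boundary_limit.
Proof.
move=> y; have := converges_vertical y.
rewrite -[converges_above _ y]/(sval (point_above y) (vertical_sequence y)).
by move=> /boundary_limitP h; apply: same_limit_unique h (converges_vertical y).
Qed.

Lemma boundary_limitK : cancel boundary_limit point_above.
Proof.
move=> xi; apply: sig_val_inj; apply/seteqP; split=> u.
  by move=> uxi; apply/boundary_limitP.
by move/boundary_limitP.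
Qed.

Let L1 := Num.min (expR (- (alpha * t0)) / D) (expR (- alpha) * (c0 * alpha / 8)).
Let L2 := expR (alpha * (C * D)) / D.

Let L10 : 0 < L1.
Proof.
rewrite /L1 lt_min divr_gt0 ?expR_gt0//= mulr_gt0 ?expR_gt0//.
by rewrite divr_gt0// mulr_gt0.
Qed.

Let L20 : 0 < L2. Proof. by rewrite divr_gt0 ?expR_gt0. Qed.

(** The growth conditions on [psi] turn the height at which a geodesic descends
    into the distance of the points at infinity. *)
Lemma cone_product_distinct u v y z : converges_above u y -> converges_above v z ->
  y <> z -> exists n, forall i j, (n <= i)%N -> (n <= j)%N ->
  L1 * dY y z <= expR (- (alpha * cpt (u i) (v j))) <= L2 * dY y z.
Proof.
move=> [uh uy] [vh vz] yz; set d := dY y z.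
have d0 : 0 < d.
  rewrite lt_neqAle eq_sym dY0 andbT; apply/eqP => dz; apply: yz.
  by case: dYM => /(_ y z)[/(_ dz)].
have dD : d <= D by exact: dYD.
pose r := ln (D / d) / alpha.
have Dd0 : 0 < D / d by rewrite divr_gt0.
have ar : alpha * r = ln (D / d) by rewrite /r mulrCA mulfV ?gt_eqF// mulr1.
have r0 : 0 <= r by rewrite /r divr_ge0 ?(ltW alpha0)// ln_ge0// ler_pdivlMr// mul1r.
have d40 : 0 < d / 4 by rewrite divr_gt0.
have [n1 H1] := uh r; have [n2 H2] := vh r.
have [n3 H3] := uy _ d40; have [n4 H4] := vz _ d40.
exists (maxn (maxn n1 n2) (maxn n3 n4)) => i j.
rewrite !geq_max => /andP[/andP[i1 _] /andP[i3 _]] /andP[/andP[_ j2] /andP[_ j4]].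
have [dl du] : d / 2 <= dY (pr (u i)) (pr (v j)) /\ dY (pr (u i)) (pr (v j)) <= 2 * d.
  have := H3 i i3; have := H4 j j4; rewrite /d.
  have := dist_tri dYM y (pr (u i)) z; rewrite (dist_sym dYM y (pr (u i))).
  have := dist_tri dYM (pr (u i)) (pr (v j)) z.
  have := dist_tri dYM (pr (u i)) y (pr (v j)).
  have := dist_tri dYM y z (pr (v j)); rewrite (dist_sym dYM z).
  by move=> ? ? ? ? ? ?; split; lra.
set q := cpt (u i) (v j).
apply/andP; split.
  have [qt0|t0q] := leP q t0.
    apply: (@le_trans _ _ (expR (- (alpha * t0)))).
      apply: (@le_trans _ _ (expR (- (alpha * t0)) / D * d)).
        by apply: ler_wpM2r; [exact: ltW|rewrite /L1 ge_min lexx].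
      by rewrite mulrAC ler_pdivrMr// ler_pM2l// expR_gt0.
    by rewrite ler_expR lerN2 ler_pM2l.
  pose m := Num.max t0 (q - 1).
  have mt : t0 <= m by rewrite /m le_max lexx.
  have mq : m < q by rewrite /m gt_max t0q; lra.
  have mq1 : q - 1 <= m by rewrite /m le_max lexx orbT.
  have := psi_cp (le_trans t00 mt) mq => psim.
  have h1 : c0 * expR (alpha * m) * (d / 2) <= 4 / alpha.
    apply: le_trans psim; apply: ler_pM => //; last exact: psi_lb.
    - by rewrite mulr_ge0 ?expR_ge0// ltW.
    - by rewrite divr_ge0// ltW.
  have h2 : c0 * alpha / 8 * d <= expR (- (alpha * m)).
    have em : expR (- (alpha * m)) * expR (alpha * m) = 1.
      by rewrite -expRD addNr expR0.
    rewrite -(ler_pM2r (expR_gt0 (alpha * m))) em.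
    have := ler_wpM2r (ltW alpha0) h1; rewrite divfK ?gt_eqF//.
    have -> : c0 * alpha / 8 * d * expR (alpha * m) =
      c0 * expR (alpha * m) * (d / 2) * alpha / 4 by field.
    by lra.
  apply: (@le_trans _ _ (expR (- alpha) * (c0 * alpha / 8) * d)).
    by apply: ler_wpM2r; [exact: ltW|rewrite /L1 ge_min lexx orbT].
  rewrite -mulrA; apply: le_trans (ler_wpM2l (expR_ge0 _) h2) _.
  rewrite -expRD ler_expR -opprD lerN2 (_ : alpha + alpha * m = alpha * (1 + m)).
    by rewrite ler_pM2l//; lra.
  by ring.
have h1 : r - C * D <= q.
  apply: le_trans (cp_ge r0 (H1 i i1) (H2 j j2)).
  rewrite lerD2l lerN2 ler_pdivrMr//.
  have psir : psi r <= C * (D / d).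
    by have := psi_ub r0; rewrite ar lnK ?posrE.
  apply: (@le_trans _ _ (C * (D / d) * (2 * d))).
    by apply: ler_pM => //; exact: psi0.
  rewrite le_eqVlt; apply/orP; left; apply/eqP.
  by field; rewrite gt_eqF.
apply: (@le_trans _ _ (expR (- (alpha * (r - C * D))))).
  by rewrite ler_expR lerN2 ler_pM2l.
rewrite (_ : - (alpha * _) = alpha * (C * D) - alpha * r); last by ring.
rewrite ar expRD expRN lnK ?posrE// /L2 invf_div le_eqVlt; apply/orP; left.
by apply/eqP; ring.
Qed.

Let k1 := expR (- (alpha * K)) * L1.
Let k2 := expR (alpha * K) * L2.

Lemma boundary_product_distinct xi eta u v : sval xi u -> sval eta v ->
  boundary_limit xi <> boundary_limit eta ->
  exists n, forall i j, (n <= i)%N -> (n <= j)%N ->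
  k1 * dY (boundary_limit xi) (boundary_limit eta)
    <= expR (- (alpha * gp (u i) (v j))) <=
  k2 * dY (boundary_limit xi) (boundary_limit eta).
Proof.
move=> /boundary_limitP uxi /boundary_limitP veta xe.
have [n Hn] := cone_product_distinct uxi veta xe.
exists n => i j ni nj; have /andP[h1 h2] := Hn i j ni nj.
have := gromov_cone_product (u i) (v j); rewrite ler_norml => /andP[g1 g2].
rewrite /k1 /k2 -(mulrA _ L1) -(mulrA _ L2); apply/andP; split.
  apply: le_trans (ler_wpM2l (expR_ge0 _) h1) _.
  by rewrite -expRD ler_expR -opprD lerN2 -mulrDr ler_pM2l//; lra.
apply: (@le_trans _ _ (expR (alpha * K) * expR (- (alpha * cpt (u i) (v j))))); last first.
  by apply: ler_wpM2l => //; exact: expR_ge0.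
rewrite -expRD ler_expR -mulrBr -mulrN ler_pM2l//; lra.
Qed.

Theorem cone_boundary_quasisymmetric eps : 0 < eps -> eps < alpha ->
  quasisymmetrically_homeomorphic (boundary_dist dZ x0 eps) dY.
Proof.
move=> eps0 eps_alpha.
have [wxx wsym wtri] := cone_dist_props nN uN cN dYM lY psic psi0 psi_nd.
apply: (boundary_quasisymmetric (k1 := k1) (k2 := k2) dYM alpha0 _ _
  boundary_limitK point_aboveK) => //.
- by rewrite /k1 mulr_gt0 ?expR_gt0.
- by rewrite /k2 mulr_gt0 ?expR_gt0.
- by move=> A B; exact: wsym.
- by move=> xi; exists (vertical_sequence (boundary_limit xi));
  apply/boundary_limitP; exact: converges_vertical.
- move=> xi u v /boundary_limitP uy /boundary_limitP vy a.
  have [n Hn] := converges_product uy vy (a + K).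
  exists n => i j ni nj; have := Hn i j ni nj.
  by have := gromov_cone_product (u i) (v j); rewrite ler_norml /gp => /andP[]; lra.
- exact: boundary_product_distinct.
Qed.

End ConeBoundary.

(** * The theorem *)

Section MetricTypes.
Context {R : realType} {Y : metricType R}.

Lemma mdist_metric : is_metric (mdist : Y -> Y -> R).
Proof.
split=> [x y|x y|x y z].
- by split=> [|->]; [exact: mdist_positivity|exact: mdistxx].
- exact: metric_sym.
- exact: metric_triangle.
Qed.

Lemma complete_space_seq : complete_space Y -> forall u : nat -> Y,
  (forall e : R, 0 < e -> exists n, forall i j, (n <= i)%N -> (n <= j)%N ->
     mdist (u i) (u j) < e) ->
  exists y, forall e : R, 0 < e -> exists n, forall i, (n <= i)%N -> mdist (u i) y < e.
Proof.
move=> cY u uC; have [|y uy] := cY (u @ \oo) _.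
  apply/cauchy_exP => e e0; have [n Hn] := uC e e0.
  by exists (u n); exists n => // i /= ni; rewrite ballEmdist; exact: Hn.
exists y => e e0; have /cvg_ballP/(_ e e0)[n _ Hn] := uy.
by exists n => i ni; have := Hn i ni; rewrite ballEmdist /= metric_sym.
Qed.

End MetricTypes.

(** A nonconstant nonnegative function is positive somewhere, and from there on it
    grows exponentially. *)
Lemma nonconstant_growth (R : realType) (alpha : R) (psi : R -> R) :
  (forall t, 0 <= t -> 0 <= psi t) ->
  (forall s t, 0 <= s -> s <= t -> psi s * expR (alpha * (t - s)) <= psi t) ->
  (exists s t, [/\ 0 <= s, 0 <= t & psi s <> psi t]) ->
  exists t0 c0, [/\ 0 <= t0, 0 < c0 &
    forall t, t0 <= t -> c0 * expR (alpha * t) <= psi t].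
Proof.
move=> psi0 psi_exp [s [t [s0 t0 st]]].
have [r r0 psir] : exists2 r, 0 <= r & 0 < psi r.
  have [ps|ps] := ltP 0 (psi s); first by exists s.
  exists t => //; rewrite lt_neqAle psi0// andbT; apply/eqP => pt; apply: st.
  by rewrite -pt; apply/le_anti; rewrite ps psi0.
exists r, (psi r * expR (- (alpha * r))); split => //.
  by rewrite mulr_gt0// expR_gt0.
move=> x rx; rewrite -mulrA -expRD.
by have := psi_exp r x r0 rx; congr (_ * expR _ <= _); ring.
Qed.

Theorem theorem7p1 (R : realType) :
  exists (delta : R -> R -> R) (delta0 : R -> R),
  forall (N : R * R -> R),
    is_norm2 N -> unitary_norm N -> coordinate_increasing N ->
  forall (Y : metricType R) (alpha : R) (psi : R -> R),
    let dY : Y -> Y -> R := mdist in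
    let Z := warped_product N half_line_dist dY (fun s => psi (sval s)) in
    let dZ : Z -> Z -> R :=
      warped_dist N half_line_dist dY (fun s => psi (sval s)) in
    length_space dY ->
    0 < alpha ->
    {within `[0, +oo[, continuous psi} ->
    (forall t : R, 0 < t -> derivable psi t 1 /\ {for t, continuous (derive1 psi)}) ->
    (exists s t, [/\ 0 <= s, 0 <= t & psi s <> psi t]) ->
    (forall t, 0 <= t -> 0 <= psi t) ->
    (forall t, 0 < t -> psi t <= alpha^-1 * derive1 psi t) ->
    (~ dist_bounded dY -> psi 0 = 0) ->
    [/\ psi 0 <> 0 ->
          gromov_hyperbolic dZ (delta alpha (psi 0 * dist_diam dY)),
        psi 0 = 0 -> gromov_hyperbolic dZ (delta0 alpha) &
        complete_space Y -> dist_bounded dY ->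
        (exists2 C : R, 0 < C &
           forall t, 0 <= t -> psi t <= C * expR (alpha * t)) ->
        forall x0 : Z, exists2 eps0 : R, 0 < eps0 &
          forall eps, 0 < eps -> eps < eps0 ->
            quasisymmetrically_homeomorphic
              (boundary_dist dZ x0 eps) dY].
Proof.
exists (fun alpha M => 8 / alpha + `|M|), (fun alpha => 8 / alpha).
move=> N nN uN cN Y alpha psi dY Z dZ lY alpha0 psic psid psi_nc psi0 psi_le bdd.
have dYM : is_metric dY := mdist_metric.
have psid' t : 0 < t -> derivable psi t 1 by move=> /psid[].
have psi_exp (s t : R) : 0 <= s -> s <= t -> psi s * expR (alpha * (t - s)) <= psi t.
  exact: (psi_exp_le alpha0 psic psid' psi_le).
have psi_mono (s t : R) : 0 <= s -> s <= t -> psi s <= psi t.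
  exact: (psi_nd alpha0 psic psid' psi0 psi_le).
split.
- move=> psi00.
  have [B dYB] : dist_bounded dY by apply: contrapT => /bdd.
  apply: (cone_hyperbolic nN uN cN dYM lY alpha0 psic psi0 psi_mono psi_exp) => // y z.
  apply: le_trans (ler_norm _); apply: ler_wpM2l; first exact: psi0.
  by apply: ub_le_sup; [exists B => _ [a _ [b _ <-]]|exists y => //; exists z].
- move=> psi00; rewrite -[8 / alpha]addr0.
  apply: (cone_hyperbolic nN uN cN dYM lY alpha0 psic psi0 psi_mono psi_exp) => // y z.
  by rewrite psi00 mul0r.
move=> cY [B dYB] [C C0 psi_ub] x0; exists alpha => // eps eps0 eps_alpha.
have [t0 [c0 [t00 c00 psi_lb]]] := nonconstant_growth psi0 psi_exp psi_nc.
have D0 : 0 < Num.max 1 B by rewrite lt_max ltr01.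
have dYD y z : dY y z <= Num.max 1 B by rewrite le_max dYB orbT.
exact: (cone_boundary_quasisymmetric nN uN cN dYM lY alpha0 psic psi0 psi_mono
  psi_exp D0 dYD t00 c00 psi_lb psi_ub (complete_space_seq cY) x0 eps0 eps_alpha).
Qed.
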